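(* Let $k\ge1$, $\alpha,\beta>0$, $I_{2k}$ with multiplicity $(\alpha,\beta)$, $z=|z|e^{i\phi_1},w=|w|e^{i\phi_2}\in\mathbb{C}$, and let $E_\kappa(z,w,t):=t^{k(\alpha+\beta)}E_\kappa(tz,w)$ for $t\ge0$. Then for real $s>|z||w|$, $$\int_0^\infty e^{-st}E_\kappa(z,w,t)\,dt=\Gamma(k(\alpha+\beta)+1)\int_{-1}^1\int_{-1}^1\frac{(1+u)(1+v)-\frac{2}{\alpha+\beta}\big(\alpha u(1+v)+\beta v(1+u)\big)}{B(s,z,w)\,[A(s,|zw|,q_{u,v}(k\phi_1,k\phi_2))]^{\alpha+\beta}}\,d\nu^\alpha(u)\,d\nu^\beta(v),$$ where $B(s,z,w)=s-\mathrm{Re}(z\bar w)$ and $A(s,b,q)=\prod_{\ell=0}^{k-1}\big(s-b\cos\frac{q+2\pi\ell}{k}\big)$.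
   Context: Identify $\mathbb{R}^2$ with $\mathbb{C}$, $\langle z,w\rangle=\mathrm{Re}(z\bar w)$. The dihedral group $I_{2k}$ (order $4k$) contains the reflections $z\mapsto\bar ze^{ij\pi/k}$, $j=0,\dots,2k-1$, forming two conjugacy classes ($j$ even, containing $z\mapsto\bar z$; $j$ odd); $\kappa=(\alpha,\beta)$ is $\alpha$ on the class with $j$ even and $\beta$ on the class with $j$ odd. The Dunkl kernel is $E_\kappa(z,w)=V_\kappa(e^{\langle\cdot,w\rangle})(z)$ (joint eigenfunction of the Dunkl operators in $z$ with eigenvalues the coordinates of $w$, $E_\kappa(0,w)=1$). $d\nu^\alpha(u)=\frac{\Gamma(\alpha+1/2)}{\sqrt\pi\Gamma(\alpha)}(1-u^2)^{\alpha-1}du$ on $[-1,1]$. $\xi_{u,v}(\theta_1,\theta_2)=v\cos\theta_1\cos\theta_2+u\sin\theta_1\sin\theta_2$, $q_{u,v}=\arccos\xi_{u,v}\in[0,\pi]$. *)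

(* Defs.v *)
From Stdlib Require Import Reals Lra ClassicalEpsilon.
Open Scope R_scope.

Definition RI_val (f : R -> R) (a b v : R) : Prop :=
  exists pr : Riemann_integrable f a b, RiemannInt pr = v.

Definition improper_int_open (f : R -> R) (a b l : R) : Prop :=
  a < b /\
  (forall x y, a < x -> x <= y -> y < b -> exists v, RI_val f x y v) /\
  (forall eps, eps > 0 -> exists delta, delta > 0 /\
     forall x y v, a < x < a + delta -> b - delta < y < b -> x <= y ->
       RI_val f x y v -> Rabs (v - l) < eps).

Definition improper_int_0_inf (f : R -> R) (l : R) : Prop :=
  (forall x y, 0 < x -> x <= y -> exists v, RI_val f x y v) /\
  (forall eps, eps > 0 -> exists delta M, delta > 0 /\
     forall x y v, 0 < x < delta -> M < y -> x <= y ->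
       RI_val f x y v -> Rabs (v - l) < eps).

Definition Gamma (x : R) : R :=
  epsilon (inhabits 0)
    (fun g => improper_int_0_inf (fun t => Rpower t (x - 1) * exp (- t)) g).

Definition nu_density (a u : R) : R :=
  Gamma (a + / 2) / (sqrt PI * Gamma a) * Rpower (1 - u ^ 2) (a - 1).

Fixpoint prodR (f : nat -> R) (n : nat) : R :=
  match n with
  | O => 1
  | S m => prodR f m * f m
  end.

(** * Geometry of R^2 = C, points as pairs (x, y) = x + i y *)

Definition pt := (R * R)%type.
Definition inner (z w : pt) : R := fst z * fst w + snd z * snd w.
Definition norm2 (z : pt) : R := sqrt (fst z ^ 2 + snd z ^ 2).

(** Reflection sigma_j : z |-> conj(z) e^{i j pi / k}. *)
Definition refl (k j : nat) (z : pt) : pt :=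
  let th := INR j * PI / INR k in
  (fst z * cos th + snd z * sin th, fst z * sin th - snd z * cos th).

(** A root (normal vector to the mirror) of sigma_j:
    sigma_j x = x - 2 <x, r_j> r_j. *)
Definition root (k j : nat) : pt :=
  let th := INR j * PI / INR k in (- sin (th / 2), cos (th / 2)).

Definition mult (a b : R) (j : nat) : R := if Nat.even j then a else b.

Definition cont2 (g : pt -> R) : Prop :=
  forall x eps, eps > 0 -> exists d, d > 0 /\
    forall y, Rabs (fst y - fst x) < d -> Rabs (snd y - snd x) < d ->
      Rabs (g y - g x) < eps.

(** Dunkl operator T_xi applied to g at x (x off all mirrors), given the
    directional derivative [dg] of g at x in direction xi:
    T_xi g(x) = d_xi g(x) + sum_{j<2k} kappa_j <r_j,xi> (g x - g(sigma_j x))/<r_j,x>. *)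
Definition dunkl_term (k : nat) (a b : R) (g : pt -> R) (xi x : pt) : R :=
  sum_f_R0 (fun j => mult a b j * inner (root k j) xi *
                     (g x - g (refl k j x)) / inner (root k j) x) (2 * k - 1).

(** [is_dunkl_kernel k a b w g]: g = E_kappa(., w) for the dihedral group
    I_{2k} with multiplicity (a,b): g is C^1 on R^2 (continuous partial
    derivatives D1, D2), g(0) = 1, and g is a joint eigenfunction of the
    Dunkl operators T_1, T_2 with eigenvalues w1, w2 (at every point off the
    mirrors, where the Dunkl operators are given by the defining formula). *)
Definition is_dunkl_kernel (k : nat) (a b : R) (w : pt) (g : pt -> R) : Prop :=
  g (0, 0) = 1 /\ cont2 g /\
  exists D1 D2 : pt -> R,
    cont2 D1 /\ cont2 D2 /\
    (forall x : pt, derivable_pt_lim (fun t => g (t, snd x)) (fst x) (D1 x)) /\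
    (forall x : pt, derivable_pt_lim (fun t => g (fst x, t)) (snd x) (D2 x)) /\
    (forall x : pt, (forall j, (j < 2 * k)%nat -> inner (root k j) x <> 0) ->
       D1 x + dunkl_term k a b g (1, 0) x = fst w * g x /\
       D2 x + dunkl_term k a b g (0, 1) x = snd w * g x).

Definition xi_uv (u v th1 th2 : R) : R :=
  v * cos th1 * cos th2 + u * sin th1 * sin th2.
Definition q_uv (u v th1 th2 : R) : R := acos (xi_uv u v th1 th2).

Definition A_fun (k : nat) (s b q : R) : R :=
  prodR (fun l => s - b * cos ((q + 2 * PI * INR l) / INR k)) k.

Definition B_fun (s : R) (z w : pt) : R := s - inner z w.

(* Main.v *)
(* Contracting the Dunkl system with the position vector gives, on each ray, a first order
   system with a regular singularity coupling the values of the kernel on the orbit of [z]: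
   [t y_i' = t d_i y_i - sum_j kappa_j (y_i - y_(sigma_j i))] with [d_i = <z_i, w>].
   The sum of the [y_i^2] grows at most like [exp (2 |z| |w| t)], so with [p = k (al + be)] the
   Laplace transforms [Z_i] of [t^p y_i] exist for [s > |z| |w|], and [P_i = (s - d_i) Z_i] solves
   [P_i' = - sum_j kappa_j P_(sigma_j i) / (s - d_(sigma_j i))].

   The double integral solves the same system.  As [A(s, b, q) = a(s) - c cos q] with [a] a
   Chebyshev polynomial, everything depends on [s] through [a], and the sums of
   [1 / (s - d_(sigma_j i))] over each class of reflections are logarithmic derivatives of [A].
   This reduces the claim to the case [k = 1], where it is an integration by parts together
   with the fact that the numerator equals
   [(al (1 + v) (1 - u) + be (1 + u) (1 - v)) / (al + be)].

   Both solutions are [(Gamma (p + 1) + o(1)) s^(-p)] at infinity, and a solution that is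
   [o(s^(-p))] vanishes because [(s - b)^(2p)] times its squared norm is nondecreasing.  That
   [nu^al] has mass one, which fixes the constant, follows from the periodicity in [al] of
   [Gamma (al + 1/2) / Gamma al] times the mass of [(1 - u^2)^(al - 1)], and Wallis' squeeze. *)

From Stdlib Require Import Reals Lra Lia ZArith ClassicalEpsilon FunctionalExtensionality.
From Coquelicot Require Import Coquelicot.
Require Import Defs.
Set Bullet Behavior "Strict Subproofs".
Open Scope R_scope.

(** * Improper integrals over an open interval *)

(** The kernel enters through its differential-difference equations and its value at the origin, so
    the proof compares two solutions of one linear system. The power [t^p] is made for this: the sum
    of [kappa_j (y_i - y_(sigma_j i))] contains the diagonal term [p y_i], which the derivative of
    [t^(p+1)] cancels up to one copy of [y_i], and the derivative of the factor [s - d_i] removes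
    that copy. The system is indexed by the [4 k] group elements and not by the points of the orbit,
    so a [z] on a mirror needs no separate case. Two obstacles shape the analysis. The density of
    [nu^al] is unbounded at both ends for [al < 1], so integrals are limits over compact
    subintervals, and the integrands in front of the density are kept bounded and Lipschitz on the
    square, a class closed under sums and products. And the equation along a ray is singular at
    [t = 0], where only continuity of the [y_i] is used: an estimate of the squared norm over the
    whole orbit succeeds because the terms in [1 / t] have a favourable sign there. *)

Record open_interval (D : R -> Prop) : Prop := {
  interval_convex : forall x y t, D x -> D y -> x <= t <= y -> D t;
  interval_open : forall x, D x -> locally x D;
  interval_inhabited : exists x, D x }.

(* The filter of pairs tending to the two ends of [D] is described through [D] itself, so
   that bounded and unbounded intervals are treated alike. *)
Definition improper (D : R -> Prop) (f : R -> R) (l : R) : Prop :=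
  (forall x, D x -> continuous f x) /\
  forall eps, 0 < eps -> exists x0 y0, D x0 /\ D y0 /\
    forall x y, D x -> D y -> x <= x0 -> y0 <= y -> Rabs (RInt f x y - l) < eps.

Definition vanishes_at_ends (D : R -> Prop) (F : R -> R) : Prop :=
  forall eps, 0 < eps -> exists x0 y0, D x0 /\ D y0 /\
    forall x y, D x -> D y -> x <= x0 -> y0 <= y -> Rabs (F x) < eps /\ Rabs (F y) < eps.

Section Improper.

Variable D : R -> Prop.
Hypothesis HD : open_interval D.

Lemma interval_between x y t : D x -> D y -> Rmin x y <= t <= Rmax x y -> D t.
Proof.
  intros Hx Hy Ht. destruct (Rle_dec x y) as [h|h].
  - rewrite Rmin_left, Rmax_right in Ht by lra. exact (interval_convex D HD x y t Hx Hy Ht).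
  - rewrite Rmin_right, Rmax_left in Ht by lra. exact (interval_convex D HD y x t Hy Hx Ht).
Qed.

Lemma interval_Rmin x y : D x -> D y -> D (Rmin x y).
Proof. intros; unfold Rmin; destruct Rle_dec; assumption. Qed.

Lemma interval_Rmax x y : D x -> D y -> D (Rmax x y).
Proof. intros; unfold Rmax; destruct Rle_dec; assumption. Qed.

Lemma ex_RInt_interval (f : R -> R) x y :
  (forall t, D t -> continuous f t) -> D x -> D y -> ex_RInt f x y.
Proof.
  intros Hf Hx Hy. apply (@ex_RInt_continuous R_CompleteNormedModule).
  intros t Ht. apply Hf. exact (interval_between x y t Hx Hy Ht).
Qed.

(** [RInt] is signed, so comparing two integrals needs endpoints in order; both thresholds can be
    moved outwards until [x0 <= y0]. *)
Lemma improper_ordered f l eps : improper D f l -> 0 < eps ->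
  exists x0 y0, D x0 /\ D y0 /\ x0 <= y0 /\
    forall x y, D x -> D y -> x <= x0 -> y0 <= y -> Rabs (RInt f x y - l) < eps.
Proof.
  intros [_ Hl] He. destruct (Hl eps He) as (x0 & y0 & Hx & Hy & H).
  exists (Rmin x0 y0), (Rmax x0 y0).
  repeat split; auto using interval_Rmin, interval_Rmax.
  - apply Rle_trans with x0; [apply Rmin_l | apply Rmax_l].
  - intros x y Dx Dy h1 h2. apply H; auto.
    + apply Rle_trans with (1 := h1), Rmin_l.
    + apply Rle_trans with (2 := h2), Rmax_r.
Qed.

Lemma continuous_interval_ext (f g : R -> R) :
  (forall x, D x -> f x = g x) -> (forall x, D x -> continuous f x) ->
  forall x, D x -> continuous g x.
Proof.
  intros E Hf x Hx. apply continuous_ext_loc with (g := f); [|auto].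
  apply filter_imp with (2 := interval_open D HD x Hx). exact E.
Qed.

Lemma improper_ext f g l :
  (forall x, D x -> f x = g x) -> improper D f l -> improper D g l.
Proof.
  intros E [Hf Hl]. split; [exact (continuous_interval_ext f g E Hf)|].
  intros eps He. destruct (Hl eps He) as (x0 & y0 & Hx & Hy & H).
  exists x0, y0. repeat split; auto. intros x y Dx Dy h1 h2.
  rewrite (RInt_ext g f); [auto|]. intros t Ht. symmetry; apply E.
  apply (interval_between x y); auto; lra.
Qed.

Lemma improper_plus f g l m : improper D f l -> improper D g m ->
  improper D (fun x => f x + g x) (l + m).
Proof.
  intros [Hf Hl] [Hg Hm]. split.
  { intros x Hx. apply (continuous_plus (V := R_NormedModule)); auto. }
  intros eps He. destruct (Hl (eps/2)) as (x0 & y0 & Hx & Hy & H); [lra|].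
  destruct (Hm (eps/2)) as (x1 & y1 & Hx1 & Hy1 & H1); [lra|].
  exists (Rmin x0 x1), (Rmax y0 y1). repeat split; auto using interval_Rmin, interval_Rmax.
  intros x y Dx Dy h1 h2.
  rewrite (RInt_plus (V := R_CompleteNormedModule) f g) by auto using ex_RInt_interval.
  unfold plus; simpl.
  generalize (Rmin_l x0 x1) (Rmin_r x0 x1) (Rmax_l y0 y1) (Rmax_r y0 y1); intros.
  specialize (H x y Dx Dy ltac:(lra) ltac:(lra)).
  specialize (H1 x y Dx Dy ltac:(lra) ltac:(lra)).
  apply Rabs_def2 in H; apply Rabs_def2 in H1. apply Rabs_def1; lra.
Qed.

Lemma improper_scal c f l : improper D f l -> improper D (fun x => c * f x) (c * l).
Proof.
  intros [Hf Hl]. split.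
  { intros x Hx. apply (continuous_scal_r (V := R_NormedModule)); auto. }
  intros eps He.
  assert (Hc : 0 < Rabs c + 1) by (generalize (Rabs_pos c); lra).
  destruct (Hl (eps / (Rabs c + 1))) as (x0 & y0 & Hx & Hy & H).
  { apply Rdiv_lt_0_compat; lra. }
  exists x0, y0. repeat split; auto. intros x y Dx Dy h1 h2.
  rewrite (RInt_scal (V := R_CompleteNormedModule) f) by auto using ex_RInt_interval.
  unfold scal; simpl; unfold Hierarchy.mult; simpl.
  replace (c * RInt f x y - c * l) with (c * (RInt f x y - l)) by ring.
  rewrite Rabs_mult. specialize (H x y Dx Dy h1 h2).
  apply Rle_lt_trans with ((Rabs c) * (eps / (Rabs c + 1))).
  - apply Rmult_le_compat_l; [apply Rabs_pos | lra].
  - apply Rlt_le_trans with ((Rabs c + 1) * (eps / (Rabs c + 1))).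
    + apply Rmult_lt_compat_r; [apply Rdiv_lt_0_compat|]; lra.
    + right; field; lra.
Qed.

Lemma improper_le f g l m : (forall x, D x -> f x <= g x) ->
  improper D f l -> improper D g m -> l <= m.
Proof.
  intros Hle If Ig. apply Rnot_lt_le; intros Hlt.
  destruct (improper_ordered f l ((l - m)/2) If) as (x0 & y0 & Hx & Hy & H0 & H); [lra|].
  destruct (improper_ordered g m ((l - m)/2) Ig) as (x1 & y1 & Hx1 & Hy1 & H01 & H1); [lra|].
  generalize (Rmin_l x0 x1) (Rmin_r x0 x1) (Rmax_l y0 y1) (Rmax_r y0 y1); intros.
  assert (D1 : D (Rmin x0 x1)) by auto using interval_Rmin.
  assert (D2 : D (Rmax y0 y1)) by auto using interval_Rmax.
  specialize (H _ _ D1 D2 ltac:(lra) ltac:(lra)).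
  specialize (H1 _ _ D1 D2 ltac:(lra) ltac:(lra)).
  apply Rabs_def2 in H; apply Rabs_def2 in H1.
  assert (RInt f (Rmin x0 x1) (Rmax y0 y1) <= RInt g (Rmin x0 x1) (Rmax y0 y1)).
  { apply RInt_le; [lra | apply ex_RInt_interval; [apply If| |]; auto
                   | apply ex_RInt_interval; [apply Ig| |]; auto | ].
    intros t Ht. apply Hle. apply (interval_convex D HD _ _ t D1 D2); lra. }
  lra.
Qed.

Lemma improper_unique f l m : improper D f l -> improper D f m -> l = m.
Proof.
  intros H1 H2. apply Rle_antisym; eapply improper_le; eauto; intros; lra.
Qed.

Lemma improper_0 : improper D (fun _ => 0) 0.
Proof.
  destruct (interval_inhabited D HD) as [x0 H0]. split.
  - intros; apply continuous_const.
  - intros eps He. exists x0, x0. repeat split; auto. intros.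
    rewrite RInt_const. unfold scal; simpl; unfold Hierarchy.mult; simpl.
    rewrite Rmult_0_r, Rminus_0_r, Rabs_R0; lra.
Qed.

Lemma RInt_nonneg_mono (f : R -> R) x x' y y' : (forall t, D t -> continuous f t) ->
  (forall t, D t -> 0 <= f t) -> D x -> D x' -> D y -> D y' ->
  x' <= x -> x <= y -> y <= y' -> RInt f x y <= RInt f x' y'.
Proof.
  intros Hc Hp Dx Dx' Dy Dy' h1 h2 h3.
  rewrite <- (RInt_Chasles (V := R_CompleteNormedModule) f x' x y') by auto using ex_RInt_interval.
  rewrite <- (RInt_Chasles (V := R_CompleteNormedModule) f x y y') by auto using ex_RInt_interval.
  unfold plus; simpl.
  assert (0 <= RInt f x' x).
  { apply RInt_ge_0; auto using ex_RInt_interval. intros t Ht. apply Hp.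
    apply (interval_convex D HD x' x); auto; lra. }
  assert (0 <= RInt f y y').
  { apply RInt_ge_0; auto using ex_RInt_interval. intros t Ht. apply Hp.
    apply (interval_convex D HD y y'); auto; lra. }
  lra.
Qed.

(** The integrals over compact subintervals grow with the interval, so the limit is their
    supremum. *)
Lemma improper_nonneg_ex (f : R -> R) K : (forall t, D t -> continuous f t) ->
  (forall t, D t -> 0 <= f t) ->
  (forall x y, D x -> D y -> x <= y -> RInt f x y <= K) ->
  exists l, improper D f l.
Proof.
  intros Hc Hp HK.
  destruct (interval_inhabited D HD) as [p Hp0].
  destruct (completeness (fun v => exists x y, D x /\ D y /\ x <= y /\ v = RInt f x y))
    as [l [Hub Hlub]].
  { exists K. intros v (x & y & Hx & Hy & Hxy & ->). auto. }
  { exists (RInt f p p), p, p. repeat split; auto; lra. }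
  exists l. split; [auto|]. intros eps He.
  assert (exists x y, D x /\ D y /\ x <= y /\ l - eps < RInt f x y) as (x0 & y0 & Hx & Hy & Hxy & Hv).
  { apply NNPP. intros HN. assert (l <= l - eps); [|lra].
    apply Hlub. intros v (x & y & Hx & Hy & Hxy & ->). apply Rnot_lt_le. intros Hlt.
    apply HN. exists x, y. auto. }
  exists x0, y0. repeat split; auto. intros x y Dx Dy h1 h2.
  assert (RInt f x0 y0 <= RInt f x y) by (apply RInt_nonneg_mono; auto).
  assert (RInt f x y <= l).
  { apply Hub. exists x, y. repeat split; auto; lra. }
  apply Rabs_def1; lra.
Qed.

Lemma improper_nonneg_bound f l x y : (forall t, D t -> 0 <= f t) ->
  improper D f l -> D x -> D y -> x <= y -> RInt f x y <= l.
Proof.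
  intros Hp If Dx Dy Hxy. apply Rnot_lt_le; intros Hlt.
  destruct (improper_ordered f l ((RInt f x y - l)) If) as (x0 & y0 & Hx & Hy & H0 & H); [lra|].
  generalize (Rmin_l x0 x) (Rmin_r x0 x) (Rmax_l y0 y) (Rmax_r y0 y); intros.
  assert (D1 : D (Rmin x0 x)) by auto using interval_Rmin.
  assert (D2 : D (Rmax y0 y)) by auto using interval_Rmax.
  specialize (H _ _ D1 D2 ltac:(lra) ltac:(lra)).
  assert (RInt f x y <= RInt f (Rmin x0 x) (Rmax y0 y)).
  { apply RInt_nonneg_mono; auto. apply If. }
  apply Rabs_def2 in H. lra.
Qed.

(** [f + h] lies between [0] and [2 h], so the nonnegative case applies to it, and [h] is subtracted
    again. *)
Lemma improper_dominated_ex (f h : R -> R) m : (forall t, D t -> continuous f t) ->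
  (forall t, D t -> Rabs (f t) <= h t) -> improper D h m -> exists l, improper D f l.
Proof.
  intros Hc Hle Ih.
  assert (Hh : forall t, D t -> 0 <= h t).
  { intros t Ht. apply Rle_trans with (2 := Hle t Ht), Rabs_pos. }
  destruct (improper_nonneg_ex (fun x => f x + h x) (2 * m)) as [l Hl].
  - intros t Ht. apply (continuous_plus (V := R_NormedModule)); [auto | apply Ih; auto].
  - intros t Ht. generalize (Hle t Ht); intros H. apply Rabs_le_between in H. lra.
  - intros x y Dx Dy Hxy. apply Rle_trans with (RInt (fun t => 2 * h t) x y).
    + apply RInt_le; auto.
      * apply ex_RInt_interval; auto. intros t Ht.
        apply (continuous_plus (V := R_NormedModule)); [auto | apply Ih; auto].
      * apply ex_RInt_interval; auto. intros t Ht.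
        apply (continuous_scal_r (V := R_NormedModule)). apply Ih; auto.
      * intros t Ht. assert (D t) as Dt by (apply (interval_convex D HD x y); auto; lra).
        generalize (Hle t Dt); intros H. apply Rabs_le_between in H. lra.
    + apply (improper_nonneg_bound (fun t => 2 * h t)); auto.
      * intros t Ht. generalize (Hh t Ht); lra.
      * apply improper_scal; auto.
  - exists (l + (-1) * m).
    apply (improper_ext (fun x => (f x + h x) + (-1) * h x)); [intros; ring|].
    apply improper_plus; auto. apply improper_scal; auto.
Qed.

Lemma improper_derive (F f : R -> R) : (forall t, D t -> is_derive F t (f t)) ->
  (forall t, D t -> continuous f t) -> vanishes_at_ends D F -> improper D f 0.
Proof.
  intros HF Hc HV. split; auto. intros eps He.
  destruct (HV (eps/2)) as (x0 & y0 & Hx & Hy & H); [lra|].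
  exists x0, y0. repeat split; auto. intros x y Dx Dy h1 h2.
  assert (E : is_RInt f x y (minus (F y) (F x))).
  { apply (is_RInt_derive (V := R_CompleteNormedModule)); intros t Ht;
      [apply HF | apply Hc]; apply (interval_between x y); auto. }
  rewrite (is_RInt_unique (V := R_CompleteNormedModule) _ _ _ _ E).
  unfold minus, plus, opp; simpl.
  destruct (H x y Dx Dy h1 h2) as [A B]. apply Rabs_def2 in A; apply Rabs_def2 in B.
  apply Rabs_def1; lra.
Qed.

Definition integral (f : R -> R) : R := epsilon (inhabits 0) (improper D f).

Lemma integral_correct f : (exists l, improper D f l) -> improper D f (integral f).
Proof. intros H. exact (epsilon_spec (inhabits 0) _ H). Qed.

Lemma integral_eq f l : improper D f l -> integral f = l.
Proof.
  intros H. apply improper_unique with f; [apply integral_correct; eauto | auto].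
Qed.

End Improper.

Arguments improper_ext {D} HD f g l.
Arguments improper_plus {D} HD f g l m.
Arguments improper_scal {D} HD c f l.
Arguments improper_le {D} HD f g l m.
Arguments improper_unique {D} HD f l m.
Arguments improper_nonneg_ex {D} HD f K.
Arguments improper_dominated_ex {D} HD f h m.
Arguments improper_derive {D} HD F f.
Arguments integral_eq {D} HD f l.
Arguments integral_correct {D} f.

(** * The two intervals, and the improper integrals of the definitions *)

Definition unit_interval (x : R) : Prop := -1 < x < 1.
Definition half_line (x : R) : Prop := 0 < x.

Lemma unit_interval_open : open_interval unit_interval.
Proof.
  unfold unit_interval. split.
  - intros; lra.
  - intros x Hx. apply filter_and; [apply open_gt | apply open_lt]; lra.
  - exists 0; lra.
Qed.

Lemma half_line_open : open_interval half_line.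
Proof.
  unfold half_line. split.
  - intros; lra.
  - intros x Hx. apply open_gt; lra.
  - exists 1; lra.
Qed.

Lemma RI_val_RInt (f : R -> R) x y v : RI_val f x y v -> v = RInt f x y.
Proof. intros [pr <-]. symmetry; apply RInt_Reals. Qed.

Lemma ex_RI_val (f : R -> R) x y : ex_RInt f x y -> exists v, RI_val f x y v.
Proof. intros H. exists (RiemannInt (ex_RInt_Reals_0 f x y H)). now eexists. Qed.

Lemma improper_unit_interval f l :
  improper unit_interval f l -> improper_int_open f (-1) 1 l.
Proof.
  intros [Hc Hl]. split; [lra|]. split.
  - intros x y hx hxy hy. apply ex_RI_val. apply (ex_RInt_interval _ unit_interval_open); auto;
    unfold unit_interval; lra.
  - intros eps He. destruct (Hl eps He) as (x0 & y0 & Hx & Hy & H).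
    unfold unit_interval in *. exists (Rmin (x0 + 1) (1 - y0)). split.
    + apply Rmin_glb_lt; lra.
    + intros x y v h1 h2 h3 hv. rewrite (RI_val_RInt _ _ _ _ hv).
      generalize (Rmin_l (x0 + 1) (1 - y0)) (Rmin_r (x0 + 1) (1 - y0)); intros.
      apply H; lra.
Qed.

Lemma improper_half_line f l : improper half_line f l -> improper_int_0_inf f l.
Proof.
  intros [Hc Hl]. split.
  - intros x y hx hxy. apply ex_RI_val. apply (ex_RInt_interval _ half_line_open); auto;
    unfold half_line; lra.
  - intros eps He. destruct (Hl eps He) as (x0 & y0 & Hx & Hy & H).
    unfold half_line in *. exists x0, y0. split; auto.
    intros x y v h1 h2 h3 hv. rewrite (RI_val_RInt _ _ _ _ hv). apply H; lra.
Qed.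

(** [Gamma] is picked by [epsilon] among the values of [improper_int_0_inf]; this identifies the
    value so picked with a limit in the sense of [improper]. One pair of endpoints beyond both
    thresholds compares the two. *)
Lemma improper_0_inf_unique f l m :
  improper half_line f l -> improper_int_0_inf f m -> m = l.
Proof.
  intros [Hc Hl] [_ Hm]. apply cond_eq. intros eps He.
  destruct (Hl (eps/2)) as (x0 & y0 & Hx & Hy & H); [lra|].
  destruct (Hm (eps/2)) as (d & M & Hd & H'); [lra|]. unfold half_line in *.
  pose (x := Rmin x0 (d/2)). pose (y := Rmax (Rmax y0 (M+1)) x).
  assert (hx0 : 0 < x) by (apply Rmin_glb_lt; lra).
  generalize (Rmin_l x0 (d/2)) (Rmin_r x0 (d/2)) (Rmax_l y0 (M+1)) (Rmax_r y0 (M+1))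
    (Rmax_l (Rmax y0 (M+1)) x) (Rmax_r (Rmax y0 (M+1)) x). fold x y. intros.
  destruct (ex_RI_val f x y) as [v Hv].
  { apply (ex_RInt_interval _ half_line_open); auto; unfold half_line; lra. }
  specialize (H x y ltac:(lra) ltac:(lra) ltac:(lra) ltac:(lra)).
  specialize (H' x y v ltac:(lra) ltac:(lra) ltac:(lra) Hv).
  rewrite (RI_val_RInt _ _ _ _ Hv) in H'.
  apply Rabs_def2 in H; apply Rabs_def2 in H'. apply Rabs_def1; lra.
Qed.

(** * Calculus lemmas *)

Lemma exp_monotone x y : x <= y -> exp x <= exp y.
Proof. intros [H| ->]; [left; apply exp_increasing; auto | right; auto]. Qed.

Lemma Rpower_pos x y : 0 < Rpower x y.
Proof. apply exp_pos. Qed.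

Lemma Rpower_pred x y : 0 < x -> Rpower x y = x * Rpower x (y - 1).
Proof.
  intros Hx. rewrite <- (Rpower_1 x) at 2 by auto. rewrite <- Rpower_plus. f_equal; ring.
Qed.

Lemma is_derive_Rpower x y : 0 < x ->
  is_derive (fun t => Rpower t y) x (y * Rpower x (y - 1)).
Proof. intros Hx. apply is_derive_Reals. apply derivable_pt_lim_power; auto. Qed.

Lemma Rpower_le_1 x y : 0 < x <= 1 -> 0 <= y -> Rpower x y <= 1.
Proof.
  intros Hx Hy. unfold Rpower. rewrite <- exp_0. apply exp_monotone.
  assert (ln x <= ln 1) by (apply ln_le; lra). rewrite ln_1 in *. nra.
Qed.

Lemma Rpower_small y eps : 0 < y -> 0 < eps ->
  exists d, 0 < d /\ forall x, 0 < x < d -> Rpower x y < eps.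
Proof.
  intros Hy He. exists (Rpower eps (/ y)). split; [apply Rpower_pos|].
  intros x Hx. replace eps with (Rpower (Rpower eps (/ y)) y).
  - apply Rlt_Rpower_l; lra.
  - rewrite Rpower_mult, Rinv_l, Rpower_1; lra.
Qed.

Lemma is_derive_continuity_pt (f : R -> R) x l : is_derive f x l -> continuity_pt f x.
Proof.
  intros H. apply continuity_pt_filterlim.
  apply (ex_derive_continuous (V := R_NormedModule)). now exists l.
Qed.

Lemma nonneg_derive_le (f df : R -> R) x y : x <= y ->
  (forall t, x < t < y -> is_derive f t (df t)) ->
  (forall t, x <= t <= y -> continuity_pt f t) ->
  (forall t, x < t < y -> 0 <= df t) -> f x <= f y.
Proof.
  intros Hxy Hd Hc Hp. destruct (Req_dec x y) as [<-|Hne]; [lra|].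
  assert (pr1 : forall c, x < c < y -> derivable_pt f c).
  { intros c h. apply ex_derive_Reals_0. eexists; apply Hd; auto. }
  assert (pr2 : forall c, x < c < y -> derivable_pt id c) by (intros; apply derivable_pt_id).
  destruct (MVT f id x y pr1 pr2) as (c & Pc & E); [lra | auto | |].
  { intros c h. apply derivable_continuous_pt, derivable_pt_id. }
  rewrite (derive_pt_eq_0 id c 1) in E by apply derivable_pt_lim_id.
  rewrite (derive_pt_eq_0 f c (df c)) in E by (apply is_derive_Reals; auto).
  unfold id in E. specialize (Hp c Pc). nra.
Qed.

(** The mean value theorem is applied to [f] and then to [f1], which loses the factor 1/2 of
    Taylor's formula; only the quadratic order matters for [is_derive_quadratic]. *)
Lemma taylor1_bound (f f1 f2 : R -> R) x y C :
  (forall t, Rmin x y <= t <= Rmax x y -> is_derive f t (f1 t)) ->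
  (forall t, Rmin x y <= t <= Rmax x y -> is_derive f1 t (f2 t)) ->
  (forall t, Rmin x y <= t <= Rmax x y -> Rabs (f2 t) <= C) ->
  Rabs (f y - f x - (y - x) * f1 x) <= C * (y - x)².
Proof.
  intros H1 H2 HC.
  destruct (MVT_gen f x y f1) as (c & Pc & E1).
  { intros; apply H1; lra. }
  { intros. apply (is_derive_continuity_pt _ _ (f1 x0)). apply H1; lra. }
  assert (Pc' : forall t, Rmin x c <= t <= Rmax x c -> Rmin x y <= t <= Rmax x y).
  { revert Pc. unfold Rmin, Rmax. repeat destruct Rle_dec; intros; lra. }
  destruct (MVT_gen f1 x c f2) as (e & Pe & E2).
  { intros; apply H2, Pc'; lra. }
  { intros. apply (is_derive_continuity_pt _ _ (f2 x0)). apply H2, Pc'; lra. }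
  specialize (HC e (Pc' e Pe)).
  replace (f y - f x - (y - x) * f1 x) with (f2 e * ((c - x) * (y - x))) by (rewrite E1; replace (f1 c) with (f1 x + f2 e * (c - x)) by lra; ring).
  rewrite Rabs_mult. rewrite Rabs_mult.
  assert (Hcx : Rabs (c - x) <= Rabs (y - x)).
  { revert Pc. unfold Rmin, Rmax, Rabs. repeat destruct Rle_dec; repeat destruct Rcase_abs; intros; lra. }
  replace ((y - x)²) with (Rabs (y - x) * Rabs (y - x)) by (symmetry; apply Rsqr_abs).
  apply Rmult_le_compat; auto using Rabs_pos.
  - apply Rmult_le_pos; apply Rabs_pos.
  - apply Rmult_le_compat_r; auto using Rabs_pos.
Qed.

(* A second order remainder bound is the form in which derivatives pass under integrals. *)
Lemma is_derive_quadratic (f : R -> R) x l C d : 0 < d ->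
  (forall y, Rabs (y - x) < d -> Rabs (f y - f x - (y - x) * l) <= C * (y - x)²) ->
  is_derive f x l.
Proof.
  intros Hd H. apply is_derive_Reals. intros eps He.
  assert (HC : 0 < Rabs C + 1) by (generalize (Rabs_pos C); lra).
  assert (Hm : 0 < Rmin d (eps / (Rabs C + 1))).
  { apply Rmin_glb_lt; auto. apply Rdiv_lt_0_compat; lra. }
  exists (mkposreal _ Hm). simpl. intros h Hh0 Hh.
  specialize (H (x + h)). replace (x + h - x) with h in H by ring.
  generalize (Rmin_l d (eps / (Rabs C + 1))) (Rmin_r d (eps / (Rabs C + 1))); intros.
  specialize (H ltac:(lra)).
  replace ((f (x + h) - f x) / h - l) with ((f (x + h) - f x - h * l) / h) by (field; auto).
  assert (Hap : 0 < Rabs h) by (apply Rabs_pos_lt; auto).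
  unfold Rdiv. rewrite Rabs_mult, Rabs_inv.
  apply Rle_lt_trans with (C * h² * / Rabs h).
  - apply Rmult_le_compat_r; auto. left; apply Rinv_0_lt_compat; auto.
  - rewrite (Rsqr_abs h). unfold Rsqr.
    replace (C * (Rabs h * Rabs h) * / Rabs h) with (C * Rabs h) by (field; lra).
    apply Rle_lt_trans with (Rabs C * Rabs h).
    + apply Rmult_le_compat_r; [lra | apply Rle_abs].
    + apply Rle_lt_trans with (Rabs C * (eps / (Rabs C + 1))).
      * apply Rmult_le_compat_l; [apply Rabs_pos | lra].
      * apply Rlt_le_trans with ((Rabs C + 1) * (eps / (Rabs C + 1))).
        -- apply Rmult_lt_compat_r; [apply Rdiv_lt_0_compat|]; lra.
        -- right; field; lra.
Qed.

(** * The weight [(1 - u^2)^(al - 1)] *)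

Definition jacobi (al u : R) : R := Rpower (1 - u ^ 2) (al - 1).

Lemma one_minus_sqr_pos u : unit_interval u -> 0 < 1 - u ^ 2 <= 1.
Proof. unfold unit_interval; intros; nra. Qed.

Lemma jacobi_pos al u : 0 < jacobi al u.
Proof. apply Rpower_pos. Qed.

Lemma is_derive_jacobi al u : unit_interval u ->
  is_derive (jacobi (al + 1)) u (- 2 * al * u * jacobi al u).
Proof.
  intros Hu. unfold jacobi.
  assert (H := one_minus_sqr_pos u Hu).
  evar_last.
  - apply (is_derive_comp (fun t => Rpower t (al + 1 - 1)) (fun u => 1 - u ^ 2)).
    + apply is_derive_Rpower; lra.
    + auto_derive; auto.
  - unfold scal; simpl; unfold Hierarchy.mult; simpl.
    replace (al + 1 - 1 - 1) with (al - 1) by ring. ring.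
Qed.

Lemma continuous_jacobi al u : unit_interval u -> continuous (jacobi al) u.
Proof.
  intros Hu. replace al with (al - 1 + 1) by ring.
  apply (ex_derive_continuous (V := R_NormedModule)). eexists. now apply is_derive_jacobi.
Qed.

Lemma jacobi_succ al u : unit_interval u -> jacobi (al + 1) u = (1 - u ^ 2) * jacobi al u.
Proof.
  intros Hu. unfold jacobi. rewrite (Rpower_pred (1 - u ^ 2) (al + 1 - 1)).
  - f_equal. f_equal. ring.
  - apply one_minus_sqr_pos; auto.
Qed.

Lemma jacobi_le al be u : unit_interval u -> al <= be -> jacobi be u <= jacobi al u.
Proof.
  intros Hu Hle. unfold jacobi. replace (be - 1) with ((be - al) + (al - 1)) by ring.
  rewrite Rpower_plus. rewrite <- (Rmult_1_l (Rpower _ (al - 1))) at 2.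
  apply Rmult_le_compat_r; [left; apply Rpower_pos|].
  apply Rpower_le_1; [apply one_minus_sqr_pos; auto | lra].
Qed.

Lemma jacobi_1 u : unit_interval u -> jacobi 1 u = 1.
Proof.
  intros Hu. unfold jacobi. rewrite Rminus_diag. apply Rpower_O. apply one_minus_sqr_pos; auto.
Qed.

Lemma jacobi_vanishes al F M : 0 < al -> (forall u, unit_interval u -> Rabs (F u) <= M) ->
  vanishes_at_ends unit_interval (fun u => jacobi (al + 1) u * F u).
Proof.
  intros Ha HM eps He.
  assert (HM0 : 0 <= M).
  { apply Rle_trans with (2 := HM 0 ltac:(unfold unit_interval; lra)). apply Rabs_pos. }
  destruct (Rpower_small al (eps / (M + 1))) as (d & Hd & Hs); auto.
  { apply Rdiv_lt_0_compat; lra. }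
  (* Within [m] of an end of the interval [1 - u ^ 2 <= 2 * m], which is below [d] since
     [m <= d / 3]. *)
  assert (Hm : 0 < Rmin (d / 3) (1/2)) by (apply Rmin_glb_lt; lra).
  generalize (Rmin_l (d/3) (1/2)) (Rmin_r (d/3) (1/2)). set (m := Rmin _ _) in *. intros h1 h2.
  assert (HB : forall u, unit_interval u -> 1 - u ^ 2 < d -> Rabs (jacobi (al + 1) u * F u) < eps).
  { intros u Hu Hud. rewrite Rabs_mult. unfold jacobi. rewrite (Rabs_right (Rpower _ _)).
    2: left; apply Rpower_pos.
    replace (al + 1 - 1) with al by ring.
    assert (H := Hs (1 - u ^ 2) ltac:(generalize (one_minus_sqr_pos u Hu); lra)).
    apply Rle_lt_trans with (Rpower (1 - u ^ 2) al * M).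
    - apply Rmult_le_compat_l; [left; apply Rpower_pos | auto].
    - apply Rle_lt_trans with (eps / (M + 1) * M).
      + apply Rmult_le_compat_r; lra.
      + apply Rlt_le_trans with (eps / (M + 1) * (M + 1)).
        * apply Rmult_lt_compat_l; [apply Rdiv_lt_0_compat|]; lra.
        * right; field; lra. }
  exists (-1 + m), (1 - m). unfold unit_interval in *. repeat split; try lra.
  - apply HB; auto. nra.
  - apply HB; auto. nra.
Qed.

(** The derivative of [u * jacobi (al + 1) u] combines the weights of parameters [al] and [al + 1].
    This trades the weight that is unbounded for [al < 1] for a bounded one, which is how
    integrability is obtained. *)
Lemma RInt_jacobi_identity al x y : unit_interval x -> unit_interval y ->
  2 * al * RInt (jacobi al) x y
  = (1 + 2 * al) * RInt (jacobi (al + 1)) x y - (y * jacobi (al + 1) y - x * jacobi (al + 1) x).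
Proof.
  intros Hx Hy.
  assert (Hc : forall be t, unit_interval t -> continuous (jacobi be) t)
    by (intros; apply continuous_jacobi; auto).
  assert (E : is_RInt (fun u => (1 + 2 * al) * jacobi (al + 1) u - 2 * al * jacobi al u) x y
                (minus (y * jacobi (al + 1) y) (x * jacobi (al + 1) x))).
  { apply (is_RInt_derive (V := R_CompleteNormedModule) (fun u => u * jacobi (al + 1) u)).
    - intros t Ht. assert (Dt := interval_between _ unit_interval_open x y t Hx Hy Ht).
      evar_last.
      + apply (is_derive_mult (fun u => u) (jacobi (al + 1))).
        * apply is_derive_id.
        * apply is_derive_jacobi; auto.
        * intros; apply Rmult_comm.
      + unfold plus, one, Hierarchy.mult; simpl. unfold Hierarchy.mult; simpl. rewrite !jacobi_succ by auto. ring.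
    - intros t Ht. assert (Dt := interval_between _ unit_interval_open x y t Hx Hy Ht).
      apply (continuous_minus (V := R_NormedModule));
        apply (continuous_scal_r (V := R_NormedModule)); auto. }
  apply (is_RInt_unique (V := R_CompleteNormedModule)) in E.
  rewrite (RInt_minus (V := R_CompleteNormedModule) (fun u => (1 + 2 * al) * jacobi (al + 1) u)
     (fun u => 2 * al * jacobi al u)) in E.
  - rewrite (RInt_scal (V := R_CompleteNormedModule) (jacobi (al + 1))) in E.
    rewrite (RInt_scal (V := R_CompleteNormedModule) (jacobi al)) in E.
    unfold minus, plus, opp, scal, Hierarchy.mult in E; simpl in E.
    unfold Hierarchy.mult in E; simpl in E. lra.
    all: refine (ex_RInt_interval _ unit_interval_open _ _ _ _ _ _); auto.
  - refine (ex_RInt_interval _ unit_interval_open _ _ _ _ _ _); auto. intros.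
    apply (continuous_scal_r (V := R_NormedModule)); auto.
  - refine (ex_RInt_interval _ unit_interval_open _ _ _ _ _ _); auto. intros.
    apply (continuous_scal_r (V := R_NormedModule)); auto.
Qed.

Lemma jacobi_integrable al : 0 < al -> exists l, improper unit_interval (jacobi al) l.
Proof.
  intros Ha.
  (* In the bound, the first [2] is the length of the interval and the second covers the two
     boundary terms. *)
  apply (improper_nonneg_ex unit_interval_open _ (((1 + 2 * al) * 2 + 2) / (2 * al))).
  - intros; apply continuous_jacobi; auto.
  - intros; left; apply jacobi_pos.
  - intros x y Hx Hy Hxy. assert (E := RInt_jacobi_identity al x y Hx Hy).
    assert (HB : forall t, unit_interval t -> 0 < jacobi (al + 1) t <= 1).
    { intros t Ht. split; [apply jacobi_pos|]. apply Rle_trans with (jacobi 1 t).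
      - apply jacobi_le; auto; lra.
      - right; apply jacobi_1; auto. }
    assert (RInt (jacobi (al + 1)) x y <= RInt (fun _ => 1) x y).
    { apply RInt_le; auto.
      - refine (ex_RInt_interval _ unit_interval_open _ _ _ _ _ _); auto.
        intros; apply continuous_jacobi; auto.
      - apply ex_RInt_const.
      - intros t Ht. apply HB. unfold unit_interval in *; lra. }
    rewrite RInt_const in H. unfold scal in H; simpl in H. unfold Hierarchy.mult in H; simpl in H.
    assert (Bx := HB x Hx). assert (By := HB y Hy). unfold unit_interval in *.
    apply Rmult_le_reg_l with (2 * al); [lra|]. rewrite E.
    replace (2 * al * (((1 + 2 * al) * 2 + 2) / (2 * al))) with ((1 + 2 * al) * 2 + 2) by (field; lra).
    nra.
Qed.

Definition jacobi_mass (al : R) : R := integral unit_interval (jacobi al).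

Lemma jacobi_mass_spec al : 0 < al -> improper unit_interval (jacobi al) (jacobi_mass al).
Proof. intros. apply integral_correct. now apply jacobi_integrable. Qed.

Lemma jacobi_test_integrable al (f : R -> R) M : 0 < al ->
  (forall u, unit_interval u -> continuous f u) ->
  (forall u, unit_interval u -> Rabs (f u) <= M) ->
  exists l, improper unit_interval (fun u => f u * jacobi al u) l.
Proof.
  intros Ha Hc HM.
  apply (improper_dominated_ex unit_interval_open _ (fun u => M * jacobi al u) (M * jacobi_mass al)).
  - intros u Hu. apply (continuous_mult (K := R_AbsRing)); auto. apply continuous_jacobi; auto.
  - intros u Hu. rewrite Rabs_mult, (Rabs_right (jacobi al u)).
    + apply Rmult_le_compat_r; auto. left; apply jacobi_pos.
    + left; apply jacobi_pos.
  - apply improper_scal; [apply unit_interval_open | apply jacobi_mass_spec; auto].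
Qed.

(** The integrand is the derivative of [jacobi (al + 1) u * f u], whose boundary values vanish
    because [al > 0] and [f] is bounded. *)
Lemma jacobi_by_parts al (f f' : R -> R) M : 0 < al ->
  (forall u, unit_interval u -> is_derive f u (f' u)) ->
  (forall u, unit_interval u -> continuous f' u) ->
  (forall u, unit_interval u -> Rabs (f u) <= M) ->
  improper unit_interval (fun u => ((1 - u ^ 2) * f' u - 2 * al * u * f u) * jacobi al u) 0.
Proof.
  intros Ha Hd Hc HM.
  apply (improper_derive unit_interval_open (fun u => jacobi (al + 1) u * f u)).
  - intros u Hu. evar_last.
    + apply (is_derive_mult (jacobi (al + 1)) f).
      * apply is_derive_jacobi; auto.
      * apply Hd; auto.
      * intros; apply Rmult_comm.
    + unfold plus, Hierarchy.mult; simpl. unfold Hierarchy.mult; simpl. rewrite jacobi_succ by auto. ring.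
  - intros u Hu. apply (continuous_mult (K := R_AbsRing)); [|apply continuous_jacobi; auto].
    apply (continuous_minus (V := R_NormedModule)).
    + apply (continuous_mult (K := R_AbsRing)); auto.
      apply (ex_derive_continuous (V := R_NormedModule)). auto_derive; auto.
    + apply (continuous_mult (K := R_AbsRing)).
      * apply (ex_derive_continuous (V := R_NormedModule)). auto_derive; auto.
      * apply (ex_derive_continuous (V := R_NormedModule)). eexists; apply Hd; auto.
  - apply (jacobi_vanishes al f M); auto.
Qed.

Lemma jacobi_mass_pos al : 0 < al -> 0 < jacobi_mass al.
Proof.
  intros Ha.
  apply Rlt_le_trans with (RInt (jacobi al) 0 (1/2)).
  - apply RInt_gt_0; [lra | intros; apply jacobi_pos |].
    intros; apply continuous_jacobi; unfold unit_interval; lra.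
  - apply (improper_nonneg_bound _ unit_interval_open); try (unfold unit_interval; lra).
    + intros; left; apply jacobi_pos.
    + apply jacobi_mass_spec; auto.
Qed.

Lemma jacobi_mass_le al be : 0 < al -> al <= be -> jacobi_mass be <= jacobi_mass al.
Proof.
  intros Ha Hle. apply (improper_le unit_interval_open (jacobi be) (jacobi al)).
  - intros; apply jacobi_le; auto.
  - apply jacobi_mass_spec; lra.
  - apply jacobi_mass_spec; lra.
Qed.

(** Integration by parts with [f u = u]: the recursion of the beta integral. *)
Lemma jacobi_mass_succ al : 0 < al ->
  (1 + 2 * al) * jacobi_mass (al + 1) = 2 * al * jacobi_mass al.
Proof.
  intros Ha.
  assert (H := jacobi_by_parts al (fun u => u) (fun _ => 1) 1 Ha).
  assert (H0 := H ltac:(intros; exact (is_derive_id (K := R_AbsRing) _)) ltac:(intros; apply continuous_const)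
    ltac:(unfold unit_interval; intros; apply Rabs_le; lra)).
  assert (H1 : improper unit_interval
     (fun u => (1 + 2 * al) * jacobi (al + 1) u + (- (2 * al)) * jacobi al u)
     ((1 + 2 * al) * jacobi_mass (al + 1) + (- (2 * al)) * jacobi_mass al)).
  { apply (improper_plus unit_interval_open); apply (improper_scal unit_interval_open);
    apply jacobi_mass_spec; lra. }
  assert (E' : (1 + 2 * al) * jacobi_mass (al + 1) + (- (2 * al)) * jacobi_mass al = 0).
  { apply (improper_unique unit_interval_open) with (1 := H1). apply (improper_ext unit_interval_open) with (2 := H0).
    intros u Hu. rewrite jacobi_succ by auto. ring. }
  lra.
Qed.

Lemma jacobi_mass_1 : jacobi_mass 1 = 2.
Proof.
  apply (integral_eq unit_interval_open). split.
  - intros; apply continuous_jacobi; auto.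
  - intros eps He.
    assert (Hm : 0 < Rmin (eps / 3) (1/2)) by (apply Rmin_glb_lt; lra).
    generalize (Rmin_l (eps/3) (1/2)) (Rmin_r (eps/3) (1/2)). set (m := Rmin _ _) in *. intros h1 h2.
    exists (-1 + m), (1 - m). unfold unit_interval. repeat split; try lra.
    intros x y Hx Hy hx hy. rewrite (RInt_ext _ (fun _ => 1)).
    + rewrite RInt_const. unfold scal; simpl; unfold Hierarchy.mult; simpl. apply Rabs_def1; lra.
    + intros t Ht. apply jacobi_1. apply (interval_between _ unit_interval_open x y);
      unfold unit_interval; lra.
Qed.

Lemma asin_near_1 d y : 0 < d < PI -> unit_interval y -> cos d <= y -> PI / 2 - d <= asin y.
Proof.
  intros Hd Hy Hle. apply Rnot_lt_le; intros Hlt.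
  assert (B := asin_bound y). unfold unit_interval in Hy.
  assert (sin (asin y) < sin (PI / 2 - d)) by (apply sin_increasing_1; lra).
  rewrite sin_asin in H by lra. rewrite sin_shift in H. lra.
Qed.

Lemma is_derive_asin x : unit_interval x -> is_derive asin x (jacobi (/ 2) x).
Proof.
  intros Hx. apply is_derive_Reals.
  assert (H := derive_pt_asin x Hx).
  apply derive_pt_eq_1 in H.
  replace (jacobi (/ 2) x) with (1 / sqrt (1 - x²)); auto.
  unfold jacobi. replace (/ 2 - 1) with (- / 2) by field. rewrite Rpower_Ropp, Rpower_sqrt.
  - unfold Rdiv, Rsqr. rewrite Rmult_1_l. do 3 f_equal. ring.
  - apply one_minus_sqr_pos; auto.
Qed.

Lemma jacobi_mass_half : jacobi_mass (/ 2) = PI.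
Proof.
  apply (integral_eq unit_interval_open). split.
  - intros; apply continuous_jacobi; auto.
  - intros eps He. assert (HP := PI_RGT_0). assert (HP2 := PI2_1).
    assert (Hm : 0 < Rmin (eps / 3) (1/2)) by (apply Rmin_glb_lt; lra).
    generalize (Rmin_l (eps/3) (1/2)) (Rmin_r (eps/3) (1/2)). set (m := Rmin _ _) in *. intros h1 h2.
    assert (Hc1 : cos m < 1).
    { rewrite <- cos_0. apply cos_decreasing_1; lra. }
    assert (Hc0 : 0 < cos m) by (apply cos_gt_0; lra).
    (* Beyond [cos m] the value of [asin] is within [m] of [PI / 2], and symmetrically at the other
       end. *)
    exists (- cos m), (cos m). unfold unit_interval. repeat split; try lra.
    intros x y Hx Hy hx hy.
    assert (E : is_RInt (jacobi (/ 2)) x y (minus (asin y) (asin x))).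
    { apply (is_RInt_derive (V := R_CompleteNormedModule)).
      - intros t Ht. apply is_derive_asin. apply (interval_between _ unit_interval_open x y); auto.
      - intros t Ht. apply continuous_jacobi. apply (interval_between _ unit_interval_open x y); auto. }
    apply (is_RInt_unique (V := R_CompleteNormedModule)) in E. rewrite E.
    unfold minus, plus, opp; simpl.
    assert (A := asin_near_1 m y ltac:(lra) Hy hy).
    assert (A' := asin_near_1 m (- x) ltac:(lra) ltac:(unfold unit_interval; lra) ltac:(lra)).
    rewrite asin_opp in A'. generalize (asin_bound x) (asin_bound y); intros.
    apply Rabs_def1; lra.
Qed.

(** The Wallis product: the case [m = 0] is [PI * 2], and [jacobi_mass_succ] moves the smaller of
    the two half-integers past the larger. *)
Lemma jacobi_mass_wallis m :
  jacobi_mass (INR (S m) / 2) * jacobi_mass (INR (S (S m)) / 2) = 2 * PI / INR (S m).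
Proof.
  induction m as [|m IH].
  - simpl INR. replace (1 / 2) with (/ 2) by field. replace ((1 + 1) / 2) with 1 by field.
    rewrite jacobi_mass_half, jacobi_mass_1. field.
  - assert (H : 0 < INR (S m)) by (apply lt_0_INR; lia).
    replace (INR (S (S (S m))) / 2) with (INR (S m) / 2 + 1) by (rewrite !S_INR; field).
    assert (E := jacobi_mass_succ (INR (S m) / 2) ltac:(lra)).
    replace (jacobi_mass (INR (S m) / 2 + 1))
      with (INR (S m) / (1 + INR (S m)) * jacobi_mass (INR (S m) / 2)).
    + rewrite (S_INR (S m)) in *. 
      replace (2 * PI / (INR (S m) + 1)) with (INR (S m) / (1 + INR (S m)) * (2 * PI / INR (S m))) by (field; lra).
      rewrite <- IH. ring.
    + apply Rmult_eq_reg_l with (1 + 2 * (INR (S m) / 2)); [|lra]. rewrite E. field. lra.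
Qed.

(** * The weight [t^q exp (-e t)] and the Gamma function *)

Definition laguerre (q e t : R) : R := Rpower t q * exp (- (e * t)).

Lemma laguerre_pos q e t : 0 < laguerre q e t.
Proof. apply Rmult_lt_0_compat; [apply Rpower_pos | apply exp_pos]. Qed.

Lemma laguerre_succ q e t : 0 < t -> laguerre (q + 1) e t = t * laguerre q e t.
Proof.
  intros Ht. unfold laguerre. rewrite (Rpower_pred t (q + 1)) by auto.
  replace (q + 1 - 1) with q by ring. ring.
Qed.

Lemma is_derive_laguerre q e t : 0 < t ->
  is_derive (laguerre (q + 1) e) t ((q + 1) * laguerre q e t - e * laguerre (q + 1) e t).
Proof.
  intros Ht. unfold laguerre. evar_last.
  - apply (is_derive_mult (fun t => Rpower t (q + 1)) (fun t => exp (- (e * t)))).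
    + apply is_derive_Rpower; auto.
    + auto_derive; auto.
    + intros; apply Rmult_comm.
  - unfold plus, Hierarchy.mult; simpl. unfold Hierarchy.mult; simpl.
    replace (q + 1 - 1) with q by ring. ring.
Qed.

Lemma continuous_laguerre q e t : 0 < t -> continuous (laguerre q e) t.
Proof.
  intros Ht. replace q with (q - 1 + 1) by ring.
  apply (ex_derive_continuous (V := R_NormedModule)). eexists. now apply is_derive_laguerre.
Qed.

Lemma laguerre_exp_bound q e : 0 <= q -> 0 < e ->
  exists K, 0 < K /\ forall t, 0 < t -> laguerre q e t <= K * exp (- (e / 2 * t)).
Proof.
  (* With this [M] the bound [ln t <= ln M + t / M] has slope [q / M <= e / 2] after multiplication
     by [q]; [q + 1] in place of [q] keeps [M] positive at [q = 0]. *)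
  intros Hq He. pose (M := 2 * (q + 1) / e).
  assert (HM : 0 < M) by (apply Rdiv_lt_0_compat; lra).
  exists (exp (q * ln M)). split; [apply exp_pos|]. intros t Ht.
  unfold laguerre, Rpower. rewrite <- !exp_plus. apply exp_monotone.
  assert (Hl : ln t <= ln M + t / M).
  { assert (H := exp_ineq1_le (ln (t / M))). rewrite exp_ln in H by (apply Rdiv_lt_0_compat; lra).
    unfold Rdiv in H at 1. rewrite ln_mult in H; [|lra|apply Rinv_0_lt_compat; lra].
    rewrite ln_Rinv in H by auto. lra. }
  assert (q * ln t <= q * (ln M + t / M)) by (apply Rmult_le_compat_l; lra).
  assert (q * (t / M) <= e / 2 * t).
  { unfold M. replace (q * (t / (2 * (q + 1) / e))) with (q / (q + 1) * (e / 2 * t)) by (field; lra).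
    rewrite <- (Rmult_1_l (e / 2 * t)) at 2. apply Rmult_le_compat_r; [nra|].
    apply Rmult_le_reg_r with (q + 1); [lra|]. unfold Rdiv.
    rewrite Rmult_assoc, Rinv_l by lra. lra. }
  lra.
Qed.

Lemma laguerre_vanishes q e F M : 0 < q -> 0 < e ->
  (forall t, half_line t -> Rabs (F t) <= M) ->
  vanishes_at_ends half_line (fun t => laguerre q e t * F t).
Proof.
  intros Hq He HM eps Heps.
  assert (HM0 : 0 <= M).
  { apply Rle_trans with (2 := HM 1 ltac:(unfold half_line; lra)). apply Rabs_pos. }
  pose (d := eps / (M + 1)).
  assert (Hd : 0 < d) by (apply Rdiv_lt_0_compat; lra).
  assert (HB : forall t, 0 < t -> laguerre q e t < d -> Rabs (laguerre q e t * F t) < eps).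
  { intros t Ht Hl. rewrite Rabs_mult, (Rabs_right (laguerre q e t)) by (left; apply laguerre_pos).
    apply Rle_lt_trans with (laguerre q e t * M).
    - apply Rmult_le_compat_l; [left; apply laguerre_pos | auto].
    - apply Rle_lt_trans with (d * M); [apply Rmult_le_compat_r; lra|].
      apply Rlt_le_trans with (d * (M + 1)); [nra|]. unfold d. right; field; lra. }
  destruct (Rpower_small q d Hq Hd) as (x1 & Hx1 & Hs).
  destruct (laguerre_exp_bound q e) as (K & HK & Hb); try lra.
  (* Beyond [y0] the bound [K * exp (- (e / 2 * t))] is below [d], because [exp x >= 1 + x]. *)
  pose (y0 := K / (e / 2 * d)).
  assert (Hy0 : 0 < y0) by (apply Rdiv_lt_0_compat; [auto | apply Rmult_lt_0_compat; lra]).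
  exists (x1 / 2), y0. unfold half_line. repeat split; try lra.
  - apply HB; auto. unfold laguerre.
    apply Rle_lt_trans with (Rpower x q * 1); [|rewrite Rmult_1_r; apply Hs; lra].
    apply Rmult_le_compat_l; [left; apply Rpower_pos|].
    rewrite <- exp_0. apply exp_monotone. nra.
  - apply HB; auto. apply Rle_lt_trans with (1 := Hb y ltac:(auto)).
    rewrite exp_Ropp.
    assert (H3 := exp_ineq1_le (e / 2 * y)).
    apply Rmult_lt_reg_r with (exp (e / 2 * y)); [apply exp_pos|].
    rewrite Rmult_assoc, Rinv_l, Rmult_1_r by (apply Rgt_not_eq, exp_pos).
    assert (K <= d * (e / 2 * y)).
    { apply Rle_trans with (d * (e / 2 * y0)).
      - unfold y0. right. field. lra.
      - apply Rmult_le_compat_l; [lra|]. apply Rmult_le_compat_l; lra. }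
    apply Rlt_le_trans with (d * (1 + e / 2 * y)); [lra|].
    apply Rmult_le_compat_l; lra.
Qed.

Lemma RInt_exp_bound e x y : 0 < e -> 0 < x -> x <= y ->
  RInt (fun t => exp (- (e * t))) x y <= / e.
Proof.
  intros He Hx Hxy.
  assert (E : is_RInt (fun t => exp (- (e * t))) x y
     (minus (- / e * exp (- (e * y))) (- / e * exp (- (e * x))))).
  { apply (is_RInt_derive (V := R_CompleteNormedModule) (fun t => - / e * exp (- (e * t)))).
    - intros t Ht. auto_derive; auto. field; lra.
    - intros t Ht. apply (ex_derive_continuous (V := R_NormedModule)). auto_derive; auto. }
  apply (is_RInt_unique (V := R_CompleteNormedModule)) in E. rewrite E.
  unfold minus, plus, opp; simpl.
  assert (H1 : 0 < exp (- (e * y))) by apply exp_pos.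
  assert (H2 : exp (- (e * x)) <= 1) by (rewrite <- exp_0; apply exp_monotone; nra).
  assert (H3 : 0 < / e) by (apply Rinv_0_lt_compat; auto). nra.
Qed.

(** For [-1 < q < 0] the weight is unbounded at [0]; as for the Jacobi weight, the derivative of
    [laguerre (q + 1) e] expresses its integral by that of the weight of exponent [q + 1], which an
    exponential dominates. *)
Lemma laguerre_integrable q e : -1 < q -> 0 < e -> exists l, improper half_line (laguerre q e) l.
Proof.
  intros Hq He.
  destruct (laguerre_exp_bound (q + 1) e) as (K & HK & Hb); try lra.
  apply (improper_nonneg_ex half_line_open _ ((K + e * (K * / (e / 2))) / (q + 1))).
  - intros; apply continuous_laguerre; auto.
  - intros; left; apply laguerre_pos.
  - intros x y Hx Hy Hxy.
    assert (Hc : forall p t, half_line t -> continuous (laguerre p e) t)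
      by (intros; apply continuous_laguerre; auto).
    assert (E : is_RInt (fun t => (q + 1) * laguerre q e t - e * laguerre (q + 1) e t) x y
       (minus (laguerre (q + 1) e y) (laguerre (q + 1) e x))).
    { apply (is_RInt_derive (V := R_CompleteNormedModule)).
      - intros t Ht. apply is_derive_laguerre. apply (interval_between _ half_line_open x y); auto.
      - intros t Ht. assert (Dt := interval_between _ half_line_open x y t Hx Hy Ht).
        apply (continuous_minus (V := R_NormedModule));
          apply (continuous_scal_r (V := R_NormedModule)); auto. }
    apply (is_RInt_unique (V := R_CompleteNormedModule)) in E.
    rewrite (RInt_minus (V := R_CompleteNormedModule) (fun t => (q + 1) * laguerre q e t)
       (fun t => e * laguerre (q + 1) e t)) in E.
    + rewrite (RInt_scal (V := R_CompleteNormedModule) (laguerre q e)) in E.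
      rewrite (RInt_scal (V := R_CompleteNormedModule) (laguerre (q + 1) e)) in E.
      all: try (apply (ex_RInt_interval _ half_line_open); auto).
      unfold minus, plus, opp, scal, Hierarchy.mult in E; simpl in E.
      unfold Hierarchy.mult in E; simpl in E.
      assert (HB : RInt (laguerre (q + 1) e) x y <= K * / (e / 2)).
      { apply Rle_trans with (RInt (fun t => K * exp (- (e / 2 * t))) x y).
        - assert (Hce : forall t, continuous (fun t => exp (- (e / 2 * t))) t).
          { intros t. apply (ex_derive_continuous (V := R_NormedModule)). auto_derive; auto. }
          apply RInt_le; auto.
          + apply (ex_RInt_interval _ half_line_open); auto.
          + apply (ex_RInt_interval _ half_line_open); auto. intros.
            apply (continuous_scal_r (V := R_NormedModule)); auto.
          + intros t Ht. apply Hb. unfold half_line in *; lra.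
        - rewrite (RInt_scal (V := R_CompleteNormedModule) (fun t => exp (- (e / 2 * t)))).
          + unfold scal; simpl; unfold Hierarchy.mult; simpl.
            apply Rmult_le_compat_l; [lra|]. apply RInt_exp_bound; auto; lra.
          + apply (ex_RInt_interval _ half_line_open); auto. intros.
            apply (ex_derive_continuous (V := R_NormedModule)). auto_derive; auto. }
      assert (H1 := Hb y Hy). assert (H2 := laguerre_pos (q + 1) e x).
      assert (H3 : exp (- (e / 2 * y)) <= 1).
      { rewrite <- exp_0; apply exp_monotone. unfold half_line in *. nra. }
      apply Rmult_le_reg_l with (q + 1); [lra|].
      replace ((q + 1) * ((K + e * (K * / (e / 2))) / (q + 1))) with (K + e * (K * / (e / 2)))
        by (field; lra).
      assert (K * exp (- (e / 2 * y)) <= K) by nra.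
      assert (e * RInt (laguerre (q + 1) e) x y <= e * (K * / (e / 2)))
        by (apply Rmult_le_compat_l; lra).
      lra.
    + apply (ex_RInt_interval _ half_line_open); auto. intros.
      apply (continuous_scal_r (V := R_NormedModule)); auto.
    + apply (ex_RInt_interval _ half_line_open); auto. intros.
      apply (continuous_scal_r (V := R_NormedModule)); auto.
Qed.

Lemma laguerre_scale q e l : 0 < e -> improper half_line (laguerre q 1) l ->
  improper half_line (laguerre q e) (l / Rpower e (q + 1)).
Proof.
  intros He [_ Hl]. split; [intros; apply continuous_laguerre; auto|].
  intros eps Heps.
  assert (HP := Rpower_pos e (q + 1)).
  destruct (Hl (eps * Rpower e (q + 1))) as (x0 & y0 & Hx & Hy & H).
  { apply Rmult_lt_0_compat; auto. }
  unfold half_line in *.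
  exists (x0 / e), (y0 / e). repeat split; try (apply Rdiv_lt_0_compat; lra).
  intros x y Dx Dy h1 h2.
  assert (Hex : e * x <= x0).
  { apply Rmult_le_compat_l with (r := e) in h1; [|lra]. replace (e * (x0 / e)) with x0 in h1 by (field; lra). auto. }
  assert (Hey : y0 <= e * y).
  { apply Rmult_le_compat_l with (r := e) in h2; [|lra]. replace (e * (y0 / e)) with y0 in h2 by (field; lra). auto. }
  assert (Dex : 0 < e * x) by (apply Rmult_lt_0_compat; auto).
  assert (Dey : 0 < e * y) by (apply Rmult_lt_0_compat; auto).
  specialize (H (e * x) (e * y) Dex Dey Hex Hey).
  assert (HI : ex_RInt (laguerre q 1) (e * x + 0) (e * y + 0)).
  { rewrite !Rplus_0_r. apply (ex_RInt_interval _ half_line_open); auto.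
    intros; apply continuous_laguerre; auto. }
  assert (E := RInt_comp_lin (V := R_CompleteNormedModule) (laguerre q 1) e 0 x y HI).
  rewrite !Rplus_0_r in E.
  rewrite (RInt_ext _ (fun t => scal (Rpower e (q + 1)) (laguerre q e t))) in E.
  - rewrite (RInt_scal (V := R_CompleteNormedModule)) in E.
    + unfold scal in E; simpl in E; unfold Hierarchy.mult in E; simpl in E.
      rewrite <- E in H.
      replace (RInt (laguerre q e) x y - l / Rpower e (q + 1))
        with ((Rpower e (q + 1) * RInt (laguerre q e) x y - l) / Rpower e (q + 1)) by (field; lra).
      unfold Rdiv. rewrite Rabs_mult, Rabs_inv, (Rabs_right (Rpower e (q + 1))) by lra.
      apply Rmult_lt_reg_r with (Rpower e (q + 1)); auto.
      rewrite Rmult_assoc, Rinv_l, Rmult_1_r by lra. auto.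
    + apply (ex_RInt_interval _ half_line_open); auto. intros; apply continuous_laguerre; auto.
  - intros t Ht. assert (Dt : 0 < t).
    { apply (interval_between _ half_line_open x y); auto; lra. }
    unfold scal; simpl; unfold Hierarchy.mult; simpl. unfold laguerre.
    rewrite Rplus_0_r, (Rpower_pred e (q + 1)) by auto.
    replace (q + 1 - 1) with q by ring.
    rewrite <- Rpower_mult_distr by auto. rewrite Rmult_1_l. ring.
Qed.

Lemma Gamma_spec x : 0 < x -> improper half_line (laguerre (x - 1) 1) (Gamma x).
Proof.
  intros Hx. destruct (laguerre_integrable (x - 1) 1) as [l Hl]; try lra.
  assert (Hl' : improper half_line (fun t => Rpower t (x - 1) * exp (- t)) l).
  { apply (improper_ext half_line_open) with (2 := Hl). intros t Ht. unfold laguerre.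
    rewrite Rmult_1_l; auto. }
  assert (HG : improper_int_0_inf (fun t => Rpower t (x - 1) * exp (- t)) (Gamma x)).
  { unfold Gamma. apply epsilon_spec. exists l. now apply improper_half_line. }
  now rewrite (improper_0_inf_unique _ _ _ Hl' HG).
Qed.

Lemma laguerre_mass q e : -1 < q -> 0 < e ->
  improper half_line (laguerre q e) (Gamma (q + 1) / Rpower e (q + 1)).
Proof.
  intros Hq He. apply laguerre_scale; auto.
  assert (H := Gamma_spec (q + 1) ltac:(lra)). now replace (q + 1 - 1) with q in H by ring.
Qed.

Lemma Gamma_pos x : 0 < x -> 0 < Gamma x.
Proof.
  intros Hx. apply Rlt_le_trans with (RInt (laguerre (x - 1) 1) 1 2).
  - apply RInt_gt_0; [lra | intros; apply laguerre_pos |].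
    intros; apply continuous_laguerre; lra.
  - apply (improper_nonneg_bound _ half_line_open); try (unfold half_line; lra).
    + intros; left; apply laguerre_pos.
    + apply Gamma_spec; auto.
Qed.

Lemma Gamma_succ x : 0 < x -> Gamma (x + 1) = x * Gamma x.
Proof.
  intros Hx.
  assert (H1 : improper half_line (fun t => x * laguerre (x - 1) 1 t + (-1) * laguerre (x + 1 - 1) 1 t)
    (x * Gamma x + (-1) * Gamma (x + 1))).
  { apply (improper_plus half_line_open); apply (improper_scal half_line_open); apply Gamma_spec; lra. }
  assert (H0 : improper half_line (fun t => x * laguerre (x - 1) 1 t + (-1) * laguerre (x + 1 - 1) 1 t) 0).
  { apply (improper_derive half_line_open (fun t => laguerre (x - 1 + 1) 1 t * 1)).
    - intros t Ht. apply is_derive_ext with (laguerre (x - 1 + 1) 1); [intros; simpl; ring|].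
      evar_last; [apply is_derive_laguerre; auto|].
      replace (x + 1 - 1) with (x - 1 + 1) by ring. ring.
    - apply H1.
    - apply (laguerre_vanishes _ 1 (fun _ => 1) 1); try lra. intros; rewrite Rabs_R1; lra. }
  assert (E := improper_unique half_line_open _ _ _ H0 H1). lra.
Qed.

(* Cauchy-Schwarz, in the form that the integral of [(sqrt x - sqrt t)^2 t^(x-1) exp (-t)]
   is nonnegative. *)
Lemma Gamma_half_le x : 0 < x -> Gamma (x + / 2) <= sqrt x * Gamma x.
Proof.
  intros Hx.
  assert (Hs : 0 < sqrt x) by (apply sqrt_lt_R0; auto).
  assert (H : improper half_line (fun t => x * laguerre (x - 1) 1 t + ((- (2 * sqrt x)) * laguerre (x + / 2 - 1) 1 t
       + 1 * laguerre (x + 1 - 1) 1 t)) (x * Gamma x + ((- (2 * sqrt x)) * Gamma (x + / 2) + 1 * Gamma (x + 1)))).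
  { repeat apply (improper_plus half_line_open); apply (improper_scal half_line_open); apply Gamma_spec; lra. }
  assert (H0 := improper_0 _ half_line_open).
  assert (Hle : 0 <= x * Gamma x + ((- (2 * sqrt x)) * Gamma (x + / 2) + 1 * Gamma (x + 1))).
  { apply (improper_le half_line_open) with (2 := H0) (3 := H). intros t Ht. unfold laguerre.
    replace (x + / 2 - 1) with ((x - 1) + / 2) by ring.
    replace (x + 1 - 1) with ((x - 1) + 1) by ring. rewrite !Rpower_plus, Rpower_1, Rpower_sqrt by auto.
    assert (E1 := sqrt_sqrt x ltac:(lra)). assert (E2 := sqrt_sqrt t ltac:(unfold half_line in Ht; lra)).
    replace (_ + _) with ((Rpower t (x - 1) * exp (- (1 * t))) * ((sqrt x - sqrt t) * (sqrt x - sqrt t))).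
    - apply Rmult_le_pos; [left; apply laguerre_pos | apply Rle_0_sqr].
    - revert E1 E2. generalize (Rpower t (x - 1)) (exp (- (1 * t))) (sqrt x) (sqrt t).
      intros p' e' a' b' <- <-. ring. }
  rewrite Gamma_succ in Hle by auto.
  assert (E1 := sqrt_sqrt x ltac:(lra)).
  apply Rmult_le_reg_l with (sqrt x); auto. nra.
Qed.

(** * Total mass of [nu^al] *)

(** That this is constantly [sqrt PI] is the beta integral: [jacobi_mass al] is [B(1/2, al)]. *)
Definition beta_ratio (al : R) : R := jacobi_mass al * Gamma (al + / 2) / Gamma al.

Lemma beta_ratio_pos al : 0 < al -> 0 < beta_ratio al.
Proof.
  intros Ha. apply Rdiv_lt_0_compat; [apply Rmult_lt_0_compat|].
  - apply jacobi_mass_pos; auto.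
  - apply Gamma_pos; lra.
  - apply Gamma_pos; auto.
Qed.

(** The factors [(al + 1/2) / al] from [Gamma] and [2 al / (1 + 2 al)] from the mass cancel. *)
Lemma beta_ratio_succ al : 0 < al -> beta_ratio (al + 1) = beta_ratio al.
Proof.
  intros Ha. unfold beta_ratio. replace (al + 1 + / 2) with (al + / 2 + 1) by ring.
  rewrite !Gamma_succ by lra.
  assert (H := jacobi_mass_succ al Ha). assert (G := Gamma_pos al Ha).
  replace (jacobi_mass (al + 1)) with (2 * al * jacobi_mass al / (1 + 2 * al)) by (rewrite <- H; field; lra).
  field. lra.
Qed.

Lemma beta_ratio_shift al N : 0 < al -> beta_ratio (al + INR N) = beta_ratio al.
Proof.
  intros Ha. induction N as [|N IH].
  - simpl. now rewrite Rplus_0_r.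
  - rewrite S_INR, <- Rplus_assoc, beta_ratio_succ; auto. assert (H := pos_INR N). lra.
Qed.

(** The square is [w^2 * r^2], with [w] the mass and [r] the quotient of Gamma values. Monotonicity
    of the mass puts [w^2] between products at consecutive half-integers, which [jacobi_mass_wallis]
    evaluates; [Gamma_half_le] at [al] and at [al + 1/2] puts [r^2] between [al^2 / (al + 1/2)] and
    [al]. *)
Lemma beta_ratio_bounds al n : INR (n + 2) <= 2 * al <= INR (n + 2) + 1 ->
  PI - 2 * PI / INR (S n) <= (beta_ratio al)² <= PI + 2 * PI / INR (S n).
Proof.
  intros Hal.
  assert (Hn : 0 < INR (S n)) by (apply lt_0_INR; lia).
  assert (E2 : INR (n + 2) = INR (S n) + 1) by (rewrite plus_INR, (S_INR n); simpl; ring).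
  rewrite E2 in Hal. set (x := INR (S n)) in *.
  assert (Ha : 0 < al) by lra. assert (HP := PI_RGT_0).
  assert (G0 := Gamma_pos al Ha).
  set (r := Gamma (al + / 2) / Gamma al).
  assert (Hr0 : 0 < r) by (apply Rdiv_lt_0_compat; auto; apply Gamma_pos; lra).
  assert (Hr1 : r * r <= al).
  { rewrite <- (sqrt_sqrt al) by lra.
    assert (r <= sqrt al).
    { unfold r. apply Rmult_le_reg_r with (Gamma al); auto.
      unfold Rdiv. rewrite Rmult_assoc, Rinv_l, Rmult_1_r by lra. apply Gamma_half_le; auto. }
    apply Rmult_le_compat; lra. }
  assert (Hr2 : al * al <= r * r * (al + / 2)).
  { assert (H := Gamma_half_le (al + / 2) ltac:(lra)).
    replace (al + / 2 + / 2) with (al + 1) in H by field. rewrite Gamma_succ in H by auto.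
    assert (H1 : al <= sqrt (al + / 2) * r).
    { unfold r. apply Rmult_le_reg_r with (Gamma al); auto.
      unfold Rdiv. rewrite !Rmult_assoc, Rinv_l, Rmult_1_r by lra. auto. }
    rewrite <- (sqrt_sqrt (al + / 2)) at 1 by lra.
    replace (r * r * (sqrt (al + / 2) * sqrt (al + / 2)))
      with ((sqrt (al + / 2) * r) * (sqrt (al + / 2) * r)) by ring.
    apply Rmult_le_compat; lra. }
  assert (W0 := jacobi_mass_pos al Ha). set (w := jacobi_mass al) in *.
  assert (Hw1 : w * w <= 2 * PI / x).
  { unfold x. rewrite <- jacobi_mass_wallis. 
    rewrite (S_INR (S n)). fold x. apply Rmult_le_compat; try lra; apply jacobi_mass_le; lra. }
  assert (Hw2 : 2 * PI / (x + 2) <= w * w).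
  { replace (x + 2) with (INR (S (S (S n)))) by (unfold x; rewrite !S_INR; ring).
    rewrite <- jacobi_mass_wallis.
    replace (INR (S (S (S (S n))))) with (x + 3) by (unfold x; rewrite !S_INR; ring).
    replace (INR (S (S (S n)))) with (x + 2) by (unfold x; rewrite !S_INR; ring).
    apply Rmult_le_compat; try (left; apply jacobi_mass_pos; lra); apply jacobi_mass_le; lra. }
  replace (beta_ratio al) with (w * r) by (unfold beta_ratio, w, r; field; lra).
  unfold Rsqr. replace (w * r * (w * r)) with ((w * w) * (r * r)) by ring.
  (* [al^2 / (al + 1/2) >= al - 1/2], and [al >= (x + 1) / 2]. *)
  assert (Hr3 : x / 2 <= r * r).
  { apply Rmult_le_reg_r with (al + / 2); [lra|]. nra. }
  assert (Hx2 : 2 * PI / (x + 2) * (x / 2) = PI - 2 * PI / (x + 2)) by (field; lra).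
  assert (Hx1 : 2 * PI / x * ((x + 2) / 2) = PI + 2 * PI / x) by (field; lra).
  assert (Hx3 : 2 * PI / (x + 2) <= 2 * PI / x).
  { apply Rmult_le_compat_l; [lra|]. apply Rinv_le_contravar; lra. }
  assert (0 < 2 * PI / (x + 2)) by (apply Rdiv_lt_0_compat; lra).
  split.
  - apply Rle_trans with (2 * PI / (x + 2) * (x / 2)); [lra|]. apply Rmult_le_compat; lra.
  - rewrite <- Hx1. apply Rmult_le_compat; try nra.
Qed.

(** The ratio is periodic, so [al] may be shifted by a large integer, where the bounds of
    [beta_ratio_bounds] are as close to [PI] as desired. *)
Lemma beta_ratio_eq al : 0 < al -> beta_ratio al = sqrt PI.
Proof.
  intros Ha. assert (HP := PI_RGT_0).
  assert (E : (beta_ratio al)² = PI).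
  { apply cond_eq. intros eps He.
    destruct (nfloor_ex (2 * PI / eps)) as [N HN].
    { left; apply Rdiv_lt_0_compat; lra. }
    assert (HN0 := pos_INR N).
    destruct (nfloor_ex (2 * (al + INR (N + 1)))) as [m Hm].
    { rewrite plus_INR; simpl; lra. }
    (* This makes the truncated subtraction [m - 2] exact and its successor larger than
       [2 * PI / eps]. *)
    assert (Hm2 : (2 * N + 2 <= m)%nat).
    { apply Nat.lt_succ_r. apply INR_lt. rewrite S_INR.
      apply Rle_lt_trans with (2 := proj2 Hm).
      rewrite !plus_INR, mult_INR. simpl. lra. }
    assert (B := beta_ratio_bounds (al + INR (N + 1)) (m - 2)).
    replace (m - 2 + 2)%nat with m in B by lia.
    specialize (B ltac:(lra)). rewrite beta_ratio_shift in B by auto.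
    assert (INR N + 1 <= INR (S (m - 2))).
    { rewrite <- S_INR. apply le_INR. lia. }
    assert (2 * PI / INR (S (m - 2)) < eps).
    { apply Rle_lt_trans with (2 * PI / (INR N + 1)).
      - apply Rmult_le_compat_l; [lra|]. apply Rinv_le_contravar; lra.
      - apply Rmult_lt_reg_r with (INR N + 1); [lra|].
        replace (2 * PI / (INR N + 1) * (INR N + 1)) with (2 * PI / eps * eps) by (field; lra).
        rewrite Rmult_comm. apply Rmult_lt_compat_l; lra. }
    apply Rabs_def1; lra. }
  rewrite <- E, sqrt_Rsqr; auto. left; apply beta_ratio_pos; auto.
Qed.

Lemma nu_density_jacobi al u : 0 < al -> nu_density al u = / jacobi_mass al * jacobi al u.
Proof.
  intros Ha. unfold nu_density. fold (jacobi al u). f_equal.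
  assert (H := beta_ratio_eq al Ha). assert (W := jacobi_mass_pos al Ha).
  assert (G := Gamma_pos al Ha). assert (G' := Gamma_pos (al + / 2) ltac:(lra)).
  rewrite <- H. unfold beta_ratio. field. lra.
Qed.

(** * Integration against [nu^al] *)

Definition nu_int (al : R) (f : R -> R) : R :=
  integral unit_interval (fun u => f u * nu_density al u).

(** Continuity on the open interval and a bound suffice for integrability against a density that may
    be unbounded at the ends. *)
Definition test_fun (f : R -> R) : Prop :=
  (forall u, unit_interval u -> continuous f u) /\
  exists M, forall u, unit_interval u -> Rabs (f u) <= M.

Lemma improper_nu al (f : R -> R) l : 0 < al ->
  improper unit_interval (fun u => f u * jacobi al u) l ->
  improper unit_interval (fun u => f u * nu_density al u) (/ jacobi_mass al * l).
Proof.
  intros Ha H. apply (improper_scal unit_interval_open (/ jacobi_mass al)) in H.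
  apply (improper_ext unit_interval_open) with (2 := H).
  intros u _. rewrite nu_density_jacobi by auto. ring.
Qed.

Section NuInt.

Variable al : R.
Hypothesis Hal : 0 < al.

Lemma nu_int_spec f : test_fun f ->
  improper unit_interval (fun u => f u * nu_density al u) (nu_int al f).
Proof.
  intros [Hc [M HM]]. apply integral_correct.
  destruct (jacobi_test_integrable al f M Hal Hc HM) as [l Hl].
  eexists. apply improper_nu; eauto.
Qed.

Lemma nu_int_eq f l : improper unit_interval (fun u => f u * nu_density al u) l ->
  nu_int al f = l.
Proof. apply (integral_eq unit_interval_open). Qed.

Lemma nu_int_ext f g : test_fun f -> (forall u, unit_interval u -> f u = g u) ->
  nu_int al f = nu_int al g.
Proof.
  intros Hf E. symmetry. apply nu_int_eq.
  apply (improper_ext unit_interval_open) with (2 := nu_int_spec f Hf).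
  intros u Hu. now rewrite E.
Qed.

Lemma nu_int_plus f g : test_fun f -> test_fun g ->
  nu_int al (fun u => f u + g u) = nu_int al f + nu_int al g.
Proof.
  intros Hf Hg. apply nu_int_eq.
  apply (improper_ext unit_interval_open) with
    (2 := improper_plus unit_interval_open _ _ _ _ (nu_int_spec f Hf) (nu_int_spec g Hg)).
  intros; ring.
Qed.

Lemma nu_int_scal c f : test_fun f -> nu_int al (fun u => c * f u) = c * nu_int al f.
Proof.
  intros Hf. apply nu_int_eq.
  apply (improper_ext unit_interval_open) with
    (2 := improper_scal unit_interval_open c _ _ (nu_int_spec f Hf)).
  intros; ring.
Qed.

Lemma nu_int_const c : nu_int al (fun _ => c) = c.
Proof.
  apply nu_int_eq.
  assert (H := improper_nu al (fun _ => c) (c * jacobi_mass al) Hal).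
  replace (/ jacobi_mass al * (c * jacobi_mass al)) with c in H.
  - apply H. apply (improper_scal unit_interval_open). apply jacobi_mass_spec; auto.
  - field. apply Rgt_not_eq, jacobi_mass_pos; auto.
Qed.

Lemma nu_density_pos u : 0 < nu_density al u.
Proof.
  rewrite nu_density_jacobi by auto. apply Rmult_lt_0_compat; [|apply jacobi_pos].
  apply Rinv_0_lt_compat, jacobi_mass_pos; auto.
Qed.

Lemma test_fun_const c : test_fun (fun _ => c).
Proof.
  split; [intros; apply continuous_const|]. exists (Rabs c). intros; lra.
Qed.

Lemma nu_int_le f g : test_fun f -> test_fun g ->
  (forall u, unit_interval u -> f u <= g u) -> nu_int al f <= nu_int al g.
Proof.
  intros Hf Hg Hle.
  apply (improper_le unit_interval_open) with (2 := nu_int_spec f Hf) (3 := nu_int_spec g Hg).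
  intros u Hu. apply Rmult_le_compat_r; auto. left; apply nu_density_pos.
Qed.

Lemma nu_int_abs_le f M : test_fun f -> (forall u, unit_interval u -> Rabs (f u) <= M) ->
  Rabs (nu_int al f) <= M.
Proof.
  intros Hf HM. apply Rabs_le. split.
  - rewrite <- (nu_int_const (- M)). apply nu_int_le; auto using test_fun_const.
    intros u Hu. specialize (HM u Hu). apply Rabs_le_between in HM; lra.
  - rewrite <- (nu_int_const M). apply nu_int_le; auto using test_fun_const.
    intros u Hu. specialize (HM u Hu). apply Rabs_le_between in HM; lra.
Qed.

Lemma improper_unit_opp f l : improper unit_interval f l ->
  improper unit_interval (fun u => f (- u)) l.
Proof.
  intros [Hc Hl]. assert (Hopp : forall u, unit_interval u -> unit_interval (- u)).
  { unfold unit_interval; intros; lra. }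
  assert (Hc' : forall u, unit_interval u -> continuous (fun u => f (- u)) u).
  { intros u Hu. apply (continuous_comp (fun u => - u) f); [|apply Hc, Hopp; auto].
    apply (continuous_opp (V := R_NormedModule)), continuous_id. }
  split; auto. intros eps He. destruct (Hl eps He) as (x0 & y0 & Hx & Hy & H).
  exists (- y0), (- x0). repeat split; auto; try (apply Hopp; auto).
  intros x y Dx Dy h1 h2.
  assert (E : is_RInt f (-1 * x + 0) (-1 * y + 0) (RInt f (- x) (- y))).
  { replace (-1 * x + 0) with (- x) by ring. replace (-1 * y + 0) with (- y) by ring.
    apply (RInt_correct (V := R_CompleteNormedModule)).
    apply (ex_RInt_interval _ unit_interval_open); auto. }
  apply (is_RInt_comp_lin (V := R_NormedModule)) in E.
  apply (is_RInt_unique (V := R_CompleteNormedModule)) in E.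
  rewrite (RInt_ext _ (fun u => scal (-1) (f (- u)))) in E.
  - rewrite (RInt_scal (V := R_CompleteNormedModule)) in E.
    + rewrite <- (opp_RInt_swap (V := R_CompleteNormedModule) f) in E.
      * unfold scal, opp in E; simpl in E; unfold Hierarchy.mult in E; simpl in E.
        replace (RInt (fun u => f (- u)) x y) with (RInt f (- y) (- x)) by lra.
        apply H; auto; lra.
      * apply (ex_RInt_interval _ unit_interval_open); auto.
    + apply (ex_RInt_interval _ unit_interval_open); auto.
  - intros t _. f_equal. f_equal. ring.
Qed.

Lemma nu_int_opp f : test_fun f -> nu_int al (fun u => f (- u)) = nu_int al f.
Proof.
  intros Hf. apply nu_int_eq.
  apply (improper_ext unit_interval_open) with (2 := improper_unit_opp _ _ (nu_int_spec f Hf)).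
  intros u _. simpl. f_equal. unfold nu_density. do 3 f_equal. ring.
Qed.

Lemma nu_int_by_parts (f f' : R -> R) M :
  (forall u, unit_interval u -> is_derive f u (f' u)) ->
  (forall u, unit_interval u -> continuous f' u) ->
  (forall u, unit_interval u -> Rabs (f u) <= M) ->
  nu_int al (fun u => (1 - u ^ 2) * f' u - 2 * al * u * f u) = 0.
Proof.
  intros Hd Hc HM. apply nu_int_eq. rewrite <- (Rmult_0_r (/ jacobi_mass al)).
  apply improper_nu; auto. apply (jacobi_by_parts al f f' M); auto.
Qed.

End NuInt.

(** The outer variable [v] comes first. A joint Lipschitz bound, unlike plain continuity, passes
    through the inner integral with its constant, so that the outer integrand is again a test
    function. *)
Definition lip2 (f : R -> R -> R) : Prop := exists M,
  (forall v u, unit_interval v -> unit_interval u -> Rabs (f v u) <= M) /\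
  (forall v v' u u', unit_interval v -> unit_interval v' -> unit_interval u -> unit_interval u' ->
     Rabs (f v u - f v' u') <= M * (Rabs (v - v') + Rabs (u - u'))).

Lemma lip2_ext f g : (forall v u, unit_interval v -> unit_interval u -> f v u = g v u) ->
  lip2 f -> lip2 g.
Proof.
  intros E [M [H1 H2]]. exists M. split; intros; rewrite <- !E; auto.
Qed.

Lemma lip2_const c : lip2 (fun _ _ => c).
Proof.
  exists (Rabs c). split; intros; [lra|]. rewrite Rminus_diag, Rabs_R0.
  apply Rmult_le_pos; [apply Rabs_pos|].
  generalize (Rabs_pos (v - v')) (Rabs_pos (u - u')); lra.
Qed.

Lemma lip2_fst : lip2 (fun v _ => v).
Proof.
  exists 1. split; unfold unit_interval; intros.
  - apply Rabs_le; lra.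
  - generalize (Rabs_pos (u - u')); lra.
Qed.

Lemma lip2_snd : lip2 (fun _ u => u).
Proof.
  exists 1. split; unfold unit_interval; intros.
  - apply Rabs_le; lra.
  - generalize (Rabs_pos (v - v')); lra.
Qed.

Lemma lip2_plus f g : lip2 f -> lip2 g -> lip2 (fun v u => f v u + g v u).
Proof.
  intros [M [H1 H2]] [N [H3 H4]]. exists (M + N). split; intros.
  - apply Rle_trans with (1 := Rabs_triang _ _). specialize (H1 v u). specialize (H3 v u).
    apply Rplus_le_compat; auto.
  - replace (f v u + g v u - (f v' u' + g v' u')) with ((f v u - f v' u') + (g v u - g v' u')) by ring.
    apply Rle_trans with (1 := Rabs_triang _ _). rewrite Rmult_plus_distr_r.
    apply Rplus_le_compat; auto.
Qed.

Lemma lip2_mult f g : lip2 f -> lip2 g -> lip2 (fun v u => f v u * g v u).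
Proof.
  intros [M [H1 H2]] [N [H3 H4]].
  assert (D0 : unit_interval 0) by (unfold unit_interval; lra).
  assert (HM : 0 <= M) by (apply Rle_trans with (2 := H1 0 0 D0 D0), Rabs_pos).
  assert (HN : 0 <= N) by (apply Rle_trans with (2 := H3 0 0 D0 D0), Rabs_pos).
  exists (M * N + M * N). split; intros.
  - rewrite Rabs_mult. apply Rle_trans with (M * N); [|nra].
    apply Rmult_le_compat; auto using Rabs_pos.
  - replace (f v u * g v u - f v' u' * g v' u')
      with (f v u * (g v u - g v' u') + (f v u - f v' u') * g v' u') by ring.
    apply Rle_trans with (1 := Rabs_triang _ _). rewrite !Rabs_mult.
    set (d := Rabs (v - v') + Rabs (u - u')).
    replace ((M * N + M * N) * d) with (M * (N * d) + (M * d) * N) by ring.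
    apply Rplus_le_compat; apply Rmult_le_compat; auto using Rabs_pos; apply H2 || apply H4; auto.
Qed.

Lemma lip2_scal c f : lip2 f -> lip2 (fun v u => c * f v u).
Proof. apply lip2_mult, lip2_const. Qed.

Lemma lip2_minus f g : lip2 f -> lip2 g -> lip2 (fun v u => f v u - g v u).
Proof.
  intros Hf Hg. apply lip2_ext with (fun v u => f v u + (-1) * g v u); [intros; ring|].
  apply lip2_plus, lip2_scal; auto.
Qed.

Lemma lipschitz_continuous (f : R -> R) M :
  (forall u u', unit_interval u -> unit_interval u' -> Rabs (f u - f u') <= M * Rabs (u - u')) ->
  forall u, unit_interval u -> continuous f u.
Proof.
  intros H u Hu. apply continuity_pt_filterlim. intros eps He.
  assert (HM : 0 < Rabs M + 1) by (generalize (Rabs_pos M); lra).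
  destruct (interval_open _ unit_interval_open u Hu) as [d Hd].
  exists (Rmin d (eps / (Rabs M + 1))). split.
  { apply Rmin_glb_lt; [apply cond_pos | apply Rdiv_lt_0_compat; lra]. }
  intros y [_ Hy]. simpl in *. unfold Rdist in *.
  generalize (Rmin_l d (eps / (Rabs M + 1))) (Rmin_r d (eps / (Rabs M + 1))); intros.
  assert (Dy : unit_interval y) by (apply Hd; change (Rabs (y - u) < d); lra).
  apply Rle_lt_trans with (1 := H y u Dy Hu).
  apply Rle_lt_trans with (Rabs M * Rabs (y - u)).
  { apply Rmult_le_compat_r; [apply Rabs_pos | apply Rle_abs]. }
  apply Rle_lt_trans with (Rabs M * (eps / (Rabs M + 1))).
  { apply Rmult_le_compat_l; [apply Rabs_pos | lra]. }
  apply Rlt_le_trans with ((Rabs M + 1) * (eps / (Rabs M + 1))).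
  - apply Rmult_lt_compat_r; [apply Rdiv_lt_0_compat|]; lra.
  - right; field; lra.
Qed.

Lemma lip2_section f v : lip2 f -> unit_interval v -> test_fun (f v).
Proof.
  intros [M [H1 H2]] Hv. split; [|exists M; auto].
  apply (lipschitz_continuous _ M). intros u u' Hu Hu'.
  specialize (H2 v v u u' Hv Hv Hu Hu'). rewrite Rminus_diag, Rabs_R0, Rplus_0_l in H2. auto.
Qed.

(** [nu^al] is a probability measure, so the inner integral inherits both the bound and the
    Lipschitz constant of [f]. *)
Lemma lip2_inner al f : 0 < al -> lip2 f -> test_fun (fun v => nu_int al (f v)).
Proof.
  intros Ha Hf. assert (Hf' := Hf). destruct Hf' as [M [H1 H2]]. split.
  - apply (lipschitz_continuous _ M). intros v v' Hv Hv'.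
    replace (nu_int al (f v) - nu_int al (f v')) with (nu_int al (fun u => f v u + (-1) * f v' u)).
    + apply nu_int_abs_le; auto.
      * apply (lip2_section (fun _ u => f v u + (-1) * f v' u) v); auto.
        exists (2 * M). split; intros.
        -- generalize (H1 v u Hv H0) (H1 v' u Hv' H0). intros A B.
           apply Rabs_le_between in A; apply Rabs_le_between in B. apply Rabs_le; lra.
        -- generalize (H2 v v u u' Hv Hv H3 H4) (H2 v' v' u u' Hv' Hv' H3 H4).
           rewrite !Rminus_diag, Rabs_R0, Rplus_0_l. intros A B.
           assert (HM : 0 <= M) by (apply Rle_trans with (2 := H1 v v Hv Hv), Rabs_pos).
           assert (0 <= M * Rabs (v0 - v'0)) by (apply Rmult_le_pos; auto using Rabs_pos).
           apply Rabs_le_between in A; apply Rabs_le_between in B. apply Rabs_le; split; nra.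
      * intros u Hu. specialize (H2 v v' u u Hv Hv' Hu Hu).
        rewrite Rminus_diag, Rabs_R0, Rplus_0_r in H2.
        replace (f v u + -1 * f v' u) with (f v u - f v' u) by ring. auto.
    + rewrite (nu_int_plus al Ha (f v) (fun u => -1 * f v' u)).
      * rewrite nu_int_scal; auto; [ring | apply lip2_section; auto].
      * apply lip2_section; auto.
      * apply (lip2_section (fun v u => -1 * f v u) v'); auto. apply lip2_scal; auto.
  - exists M. intros v Hv. apply nu_int_abs_le; auto. apply lip2_section; auto.
Qed.

Definition nu_int2 (al be : R) (f : R -> R -> R) : R := nu_int be (fun v => nu_int al (f v)).

Section NuInt2.

Variables al be : R.
Hypothesis Hal : 0 < al.
Hypothesis Hbe : 0 < be.

Lemma nu_int2_ext f g : lip2 f ->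
  (forall v u, unit_interval v -> unit_interval u -> f v u = g v u) ->
  nu_int2 al be f = nu_int2 al be g.
Proof.
  intros Hf E. apply nu_int_ext; auto; [apply lip2_inner; auto|].
  intros v Hv. apply nu_int_ext; auto. apply lip2_section; auto.
Qed.

Lemma nu_int2_plus f g : lip2 f -> lip2 g ->
  nu_int2 al be (fun v u => f v u + g v u) = nu_int2 al be f + nu_int2 al be g.
Proof.
  intros Hf Hg. unfold nu_int2. rewrite <- nu_int_plus; auto using lip2_inner.
  apply nu_int_ext; auto.
  - apply (lip2_inner al (fun v u => f v u + g v u)); auto. apply lip2_plus; auto.
  - intros v Hv. apply nu_int_plus; auto using lip2_section.
Qed.

Lemma nu_int2_scal c f : lip2 f ->
  nu_int2 al be (fun v u => c * f v u) = c * nu_int2 al be f.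
Proof.
  intros Hf. unfold nu_int2. rewrite <- nu_int_scal; auto using lip2_inner.
  apply nu_int_ext; auto.
  - apply (lip2_inner al (fun v u => c * f v u)); auto. apply lip2_scal; auto.
  - intros v Hv. apply nu_int_scal; auto using lip2_section.
Qed.

Lemma nu_int2_abs_le f M : lip2 f ->
  (forall v u, unit_interval v -> unit_interval u -> Rabs (f v u) <= M) ->
  Rabs (nu_int2 al be f) <= M.
Proof.
  intros Hf HM. apply nu_int_abs_le; auto using lip2_inner.
  intros v Hv. apply nu_int_abs_le; auto using lip2_section.
Qed.

Lemma nu_int2_opp_u f : lip2 f -> nu_int2 al be (fun v u => f v (- u)) = nu_int2 al be f.
Proof.
  intros Hf. symmetry. apply nu_int_ext; auto using lip2_inner.
  intros v Hv. symmetry. apply nu_int_opp; auto using lip2_section.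
Qed.

Lemma nu_int2_opp_v f : lip2 f -> nu_int2 al be (fun v u => f (- v) u) = nu_int2 al be f.
Proof. intros Hf. apply (nu_int_opp be Hbe (fun v => nu_int al (f v))). apply lip2_inner; auto. Qed.

End NuInt2.

(** * The integrals of [(a - v x - u y)^(-d)] *)

(** With [a = cheb b k s] and [x], [y] the scaled products of cosines and of sines this is the power
    [- d] of [A_fun] (see [ker_A_fun]). The parameters are kept free because the differential system
    is closed in [a] under sign changes of [x] and [y]. *)
Definition ker (d a x y v u : R) : R := Rpower (a - v * x - u * y) (- d).

Lemma Rpower_neg_le d m r : 0 < m <= r -> 0 <= d -> Rpower r (- d) <= Rpower m (- d).
Proof.
  intros Hm Hd. rewrite !Rpower_Ropp. apply Rinv_le_contravar; [apply Rpower_pos|].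
  apply Rle_Rpower_l; lra.
Qed.

Lemma Rpower_neg_taylor d m r r' : 0 < d -> 0 < m -> m <= r -> m <= r' ->
  Rabs (Rpower r' (- d) - Rpower r (- d) - (r' - r) * (- d * Rpower r (- (d + 1))))
  <= d * (d + 1) * Rpower m (- (d + 2)) * (r' - r)².
Proof.
  intros Hd Hm Hr Hr'.
  assert (HB : forall t, Rmin r r' <= t <= Rmax r r' -> m <= t).
  { intros t Ht. apply Rle_trans with (2 := proj1 Ht). apply Rmin_glb; auto. }
  apply (taylor1_bound (fun t => Rpower t (- d)) (fun t => - d * Rpower t (- (d + 1)))
      (fun t => d * (d + 1) * Rpower t (- (d + 2)))).
  - intros t Ht. specialize (HB t Ht). replace (- (d + 1)) with (- d - 1) by ring.
    apply is_derive_Rpower; lra.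
  - intros t Ht. specialize (HB t Ht). evar_last.
    + apply is_derive_scal. apply is_derive_Rpower; lra.
    + replace (- (d + 1) - 1) with (- (d + 2)) by ring. ring.
  - intros t Ht. specialize (HB t Ht). rewrite Rabs_right.
    + apply Rmult_le_compat_l; [nra|]. apply Rpower_neg_le; lra.
    + apply Rle_ge, Rmult_le_pos; [nra | left; apply Rpower_pos].
Qed.

Lemma Rpower_neg_lipschitz d m r r' : 0 < d -> 0 < m -> m <= r -> m <= r' ->
  Rabs (Rpower r' (- d) - Rpower r (- d)) <= d * Rpower m (- (d + 1)) * Rabs (r' - r).
Proof.
  intros Hd Hm Hr Hr'.
  assert (HB : forall t, Rmin r r' <= t <= Rmax r r' -> m <= t).
  { intros t Ht. apply Rle_trans with (2 := proj1 Ht). apply Rmin_glb; auto. }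
  assert (HD : forall t, m <= t -> is_derive (fun t => Rpower t (- d)) t (- d * Rpower t (- (d + 1)))).
  { intros t Ht. replace (- (d + 1)) with (- d - 1) by ring. apply is_derive_Rpower; lra. }
  destruct (MVT_gen (fun t => Rpower t (- d)) r r' (fun t => - d * Rpower t (- (d + 1)))) as (c & Pc & E).
  - intros t Ht. apply HD, HB; lra.
  - intros t Ht. exact (is_derive_continuity_pt _ _ _ (HD t (HB t Ht))).
  - rewrite E, !Rabs_mult, Rabs_Ropp, (Rabs_right d), (Rabs_right (Rpower _ _)).
    + apply Rmult_le_compat_r; [apply Rabs_pos|]. apply Rmult_le_compat_l; [lra|].
      apply Rpower_neg_le; [|lra]. specialize (HB c Pc); lra.
    + left; apply Rpower_pos.
    + lra.
Qed.

Lemma ker_arg_bound a x y v u : unit_interval v -> unit_interval u ->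
  a - (Rabs x + Rabs y) <= a - v * x - u * y.
Proof.
  unfold unit_interval. intros Hv Hu.
  assert (H1 : Rabs (v * x) <= Rabs x).
  { rewrite Rabs_mult. rewrite <- (Rmult_1_l (Rabs x)) at 2.
    apply Rmult_le_compat_r; [apply Rabs_pos | apply Rabs_le; lra]. }
  assert (H2 : Rabs (u * y) <= Rabs y).
  { rewrite Rabs_mult. rewrite <- (Rmult_1_l (Rabs y)) at 2.
    apply Rmult_le_compat_r; [apply Rabs_pos | apply Rabs_le; lra]. }
  apply Rabs_le_between in H1; apply Rabs_le_between in H2. lra.
Qed.

Lemma ker_succ d a x y v u : Rabs x + Rabs y < a -> unit_interval v -> unit_interval u ->
  ker d a x y v u = (a - v * x - u * y) * ker (d + 1) a x y v u.
Proof.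
  intros H Hv Hu. assert (B := ker_arg_bound a x y v u Hv Hu). unfold ker.
  rewrite (Rpower_pred _ (- d)) by lra. do 2 f_equal. ring.
Qed.

Lemma lip2_ker d a x y : 0 < d -> Rabs x + Rabs y < a -> lip2 (ker d a x y).
Proof.
  intros Hd H. set (m := a - (Rabs x + Rabs y)). assert (Hm : 0 < m) by (unfold m; lra).
  pose (M1 := d * Rpower m (- (d + 1)) * (Rabs x + Rabs y)).
  pose (M2 := Rpower m (- d)).
  assert (H1 : 0 <= d * Rpower m (- (d + 1))) by (apply Rmult_le_pos; [lra | left; apply Rpower_pos]).
  assert (H0 : 0 <= M1) by (apply Rmult_le_pos; auto; generalize (Rabs_pos x) (Rabs_pos y); lra).
  assert (H2 : 0 < M2) by apply Rpower_pos.
  exists (M1 + M2). split.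
  - intros v u Hv Hu. unfold ker. rewrite Rabs_right by (left; apply Rpower_pos).
    apply Rle_trans with M2; [|lra]. apply Rpower_neg_le; [|lra].
    split; auto. apply ker_arg_bound; auto.
  - intros v v' u u' Hv Hv' Hu Hu'. unfold ker.
    apply Rle_trans with (1 := Rpower_neg_lipschitz d m _ _ Hd Hm (ker_arg_bound a x y v' u' Hv' Hu')
       (ker_arg_bound a x y v u Hv Hu)).
    replace (a - v * x - u * y - (a - v' * x - u' * y)) with ((v' - v) * x + (u' - u) * y) by ring.
    set (S := Rabs (v - v') + Rabs (u - u')).
    assert (HS : 0 <= S) by (unfold S; generalize (Rabs_pos (v - v')) (Rabs_pos (u - u')); lra).
    apply Rle_trans with (M1 * S); [|nra]. unfold M1. rewrite (Rmult_assoc _ _ S).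
    apply Rmult_le_compat_l; auto.
    apply Rle_trans with (1 := Rabs_triang _ _). rewrite !Rabs_mult.
    rewrite (Rabs_minus_sym v' v), (Rabs_minus_sym u' u). unfold S.
    generalize (Rabs_pos x) (Rabs_pos y) (Rabs_pos (v - v')) (Rabs_pos (u - u')). nra.
Qed.

Definition numer (al be v u : R) : R :=
  (1 + u) * (1 + v) - 2 / (al + be) * (al * u * (1 + v) + be * v * (1 + u)).

Ltac lip2_tac :=
  repeat match goal with
  | |- lip2 (fun v u => ker _ _ _ _ v u) => apply lip2_ker; [lra | auto]
  | |- lip2 (fun v u => @?f v u + @?g v u) => apply (lip2_plus f g)
  | |- lip2 (fun v u => @?f v u - @?g v u) => apply (lip2_minus f g)
  | |- lip2 (fun v u => @?f v u * @?g v u) => apply (lip2_mult f g)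
  | |- lip2 (fun v u => v) => apply lip2_fst
  | |- lip2 (fun v u => u) => apply lip2_snd
  | |- lip2 (fun v u => ?c) => apply lip2_const
  | |- lip2 _ => unfold numer, Rsqr, pow
  end.

Section Core.

Variables al be : R.
Hypothesis Hal : 0 < al.
Hypothesis Hbe : 0 < be.

(** The factor [/ B] of the theorem is left out, so this is the counterpart of [P_i] and not of
    [Z_i]. *)
Definition core (a x y : R) : R :=
  nu_int2 al be (fun v u => numer al be v u * ker (al + be) a x y v u).

(** For [k = 1] the counterpart of [Z_i]: [core1_by_parts] shows that it is [core] divided by
    [a - x - y]. *)
Definition core1 (a x y : R) : R :=
  nu_int2 al be (fun v u => (1 + u) * (1 + v) * ker (al + be + 1) a x y v u).

Lemma is_derive_ker_u v a x y u : Rabs x + Rabs y < a -> unit_interval v -> unit_interval u ->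
  is_derive (fun u => ker (al + be) a x y v u) u ((al + be) * y * ker (al + be + 1) a x y v u).
Proof.
  intros H Hv Hu. unfold ker. assert (B := ker_arg_bound a x y v u Hv Hu). evar_last.
  - apply (is_derive_comp (fun t => Rpower t (- (al + be))) (fun u => a - v * x - u * y)).
    + apply is_derive_Rpower; lra.
    + auto_derive; auto.
  - unfold scal; simpl; unfold Hierarchy.mult; simpl.
    replace (- (al + be) - 1) with (- (al + be + 1)) by ring. ring.
Qed.

Lemma is_derive_inner_v a x y v : Rabs x + Rabs y < a -> unit_interval v ->
  is_derive (fun v => nu_int al (fun u => (1 + u) * ker (al + be) a x y v u)) v
    (nu_int al (fun u => (1 + u) * ((al + be) * x * ker (al + be + 1) a x y v u))).
Proof.
  intros H Hv. destruct (interval_open _ unit_interval_open v Hv) as [d Hd].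
  set (m := a - (Rabs x + Rabs y)). assert (Hm : 0 < m) by (unfold m; lra).
  set (g := al + be) in *. assert (Hg : 0 < g) by (unfold g; lra).
  set (C := g * (g + 1) * Rpower m (- (g + 2))).
  assert (HC : 0 <= C) by (apply Rmult_le_pos; [nra | left; apply Rpower_pos]).
  (* The factor [2] bounds [1 + u], and [x²] appears because the base of the power moves by
     [(v' - v) * x] up to sign. *)
  apply (is_derive_quadratic _ v _ (2 * (C * x²)) d (cond_pos d)).
  intros v' Hv'. assert (Dv' : unit_interval v') by (apply Hd; exact Hv').
  assert (L1 : lip2 (fun v u => (1 + u) * ker g a x y v u)) by lip2_tac.
  assert (L2 : lip2 (fun v u => (1 + u) * (g * x * ker (g + 1) a x y v u))) by lip2_tac.
  assert (T1 : test_fun (fun u => (1 + u) * ker g a x y v' u)) by exact (lip2_section _ v' L1 Dv').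
  assert (T0 : test_fun (fun u => (1 + u) * ker g a x y v u)) by exact (lip2_section _ v L1 Hv).
  assert (T2 : test_fun (fun u => (1 + u) * (g * x * ker (g + 1) a x y v u))) by exact (lip2_section _ v L2 Hv).
  assert (Tm : forall c f, test_fun f -> test_fun (fun u => c * f u)).
  { intros c f [Hf [M HM]]. split.
    - intros u Hu. apply (continuous_scal_r (V := R_NormedModule)); auto.
    - exists (Rabs c * M). intros u Hu. rewrite Rabs_mult. apply Rmult_le_compat_l; auto using Rabs_pos. }
  assert (Tp : forall f h, test_fun f -> test_fun h -> test_fun (fun u => f u + h u)).
  { intros f h [Hf [M HM]] [Hh [N HN]]. split.
    - intros u Hu. apply (continuous_plus (V := R_NormedModule)); auto.
    - exists (M + N). intros u Hu. apply Rle_trans with (1 := Rabs_triang _ _).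
      apply Rplus_le_compat; auto. }
  rewrite <- (nu_int_scal al Hal (v' - v)) by auto.
  replace (_ - _ - _) with (nu_int al (fun u => (1 + u) * ker g a x y v' u
    + ((-1) * ((1 + u) * ker g a x y v u)
       + (-1) * ((v' - v) * ((1 + u) * (g * x * ker (g + 1) a x y v u)))))).
  - apply nu_int_abs_le; auto.
    intros u Hu.
    assert (B := Rpower_neg_taylor g m (a - v * x - u * y) (a - v' * x - u * y) Hg Hm
      (ker_arg_bound a x y v u Hv Hu) (ker_arg_bound a x y v' u Dv' Hu)).
    fold (ker g a x y v u) in B. fold (ker g a x y v' u) in B. fold (ker (g + 1) a x y v u) in B. fold C in B.
    replace (a - v' * x - u * y - (a - v * x - u * y)) with (- ((v' - v) * x)) in B by ring.
    rewrite <- Rsqr_neg, Rsqr_mult in B.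
    replace (_ + _) with ((1 + u) * (ker g a x y v' u - ker g a x y v u -
       - ((v' - v) * x) * (- g * ker (g + 1) a x y v u))) by ring.
    rewrite Rabs_mult. replace (2 * (C * x²) * (v' - v)²) with (2 * (C * ((v' - v)² * x²))) by ring.
    apply Rmult_le_compat; auto using Rabs_pos. unfold unit_interval in Hu. apply Rabs_le; lra.
  - rewrite (nu_int_plus al Hal (fun u => (1 + u) * ker g a x y v' u)) by auto.
    rewrite (nu_int_plus al Hal (fun u => (-1) * ((1 + u) * ker g a x y v u))) by auto.
    rewrite (nu_int_scal al Hal (-1) (fun u => (1 + u) * ker g a x y v u)) by auto.
    rewrite (nu_int_scal al Hal (-1) (fun u => (v' - v) * ((1 + u) * (g * x * ker (g + 1) a x y v u)))) by auto.
    ring.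
Qed.

(* [a - x - y = (a - v x - u y) - x (1 - v) - y (1 - u)], and the last two terms are
   integrated by parts in [v] and in [u]. *)
Lemma core1_by_parts a x y : Rabs x + Rabs y < a -> (a - x - y) * core1 a x y = core a x y.
Proof.
  intros H. set (g := al + be) in *. assert (Hg : 0 < g) by (unfold g; lra).
  set (T1 := fun v u => (1 + v) * ((1 - u ^ 2) * (g * y * ker (g + 1) a x y v u)
                                   - 2 * al * u * ker g a x y v u)).
  set (T2 := fun v u => (1 - v ^ 2) * ((1 + u) * (g * x * ker (g + 1) a x y v u))
                        + - (2 * be * v) * ((1 + u) * ker g a x y v u)).
  assert (L1 : lip2 T1) by (unfold T1; lip2_tac).
  assert (L2 : lip2 T2).
  { apply lip2_ext with (fun v u => (1 - v ^ 2) * ((1 + u) * (g * x * ker (g + 1) a x y v u))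
                        - (2 * be * v) * ((1 + u) * ker g a x y v u)); [intros; unfold T2; ring|]. lip2_tac. }
  assert (E1 : nu_int2 al be T1 = 0).
  { unfold nu_int2. rewrite <- (nu_int_const be Hbe 0). apply nu_int_ext; auto.
    - apply lip2_inner; auto.
    - intros v Hv. unfold T1.
      assert (L : lip2 (fun v u => (1 - u ^ 2) * (g * y * ker (g + 1) a x y v u)
                                   - 2 * al * u * ker g a x y v u)) by lip2_tac.
      rewrite (nu_int_scal al Hal (1 + v)) by exact (lip2_section _ v L Hv).
      assert (LK : lip2 (ker g a x y)) by (apply lip2_ker; auto). destruct LK as [M [HM _]].
      rewrite (nu_int_by_parts al Hal (fun u => ker g a x y v u) (fun u => g * y * ker (g + 1) a x y v u) M).
      + ring.
      + intros u Hu. apply is_derive_ker_u; auto.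
      + intros u Hu.
        assert (L3 : lip2 (fun v u => g * y * ker (g + 1) a x y v u)) by lip2_tac.
        apply (lip2_section _ v L3 Hv); auto.
      + auto. }
  assert (LH : lip2 (fun v u => (1 + u) * ker g a x y v u)) by lip2_tac.
  assert (LH' : lip2 (fun v u => (1 + u) * (g * x * ker (g + 1) a x y v u))) by lip2_tac.
  assert (E2 : nu_int2 al be T2 = 0).
  { destruct (lip2_inner al _ Hal LH) as [_ [M HM]].
    destruct (lip2_inner al _ Hal LH') as [HC' _].
    rewrite <- (nu_int_by_parts be Hbe (fun v => nu_int al (fun u => (1 + u) * ker g a x y v u))
      (fun v => nu_int al (fun u => (1 + u) * (g * x * ker (g + 1) a x y v u))) M); auto.
    - apply nu_int_ext; auto; [apply lip2_inner; auto|]. intros v Hv. unfold T2.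
      assert (A1 : test_fun (fun u => (1 + u) * (g * x * ker (g + 1) a x y v u)))
        by exact (lip2_section _ v LH' Hv).
      assert (A2 : test_fun (fun u => (1 + u) * ker g a x y v u)) by exact (lip2_section _ v LH Hv).
      rewrite (nu_int_plus al Hal (fun u => (1 - v ^ 2) * ((1 + u) * (g * x * ker (g + 1) a x y v u)))).
      + rewrite (nu_int_scal al Hal (1 - v ^ 2) (fun u => (1 + u) * (g * x * ker (g + 1) a x y v u))) by auto.
        rewrite (nu_int_scal al Hal (- (2 * be * v)) (fun u => (1 + u) * ker g a x y v u)) by auto. ring.
      + assert (L3 := lip2_scal (1 - v ^ 2) _ LH'). exact (lip2_section _ v L3 Hv).
      + assert (L3 := lip2_scal (- (2 * be * v)) _ LH). exact (lip2_section _ v L3 Hv).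
    - intros v Hv. apply is_derive_inner_v; auto. }
  assert (LN : lip2 (fun v u => numer al be v u * ker g a x y v u)) by lip2_tac.
  assert (LQ : lip2 (fun v u => (1 + u) * (1 + v) * ker (g + 1) a x y v u)) by lip2_tac.
  apply Rmult_eq_reg_l with g; [|lra]. unfold core, core1. fold g.
  rewrite <- (nu_int2_scal al be Hal Hbe g) by auto.
  rewrite <- (nu_int2_scal al be Hal Hbe (a - x - y)), <- (nu_int2_scal al be Hal Hbe g); auto.
  2: apply (lip2_scal (a - x - y)); auto.
  (* This pointwise identity accounts for the form of [numer]: the terms with [2 al u (1 + v)] and
     [2 be v (1 + u)] are those in which the integrations by parts differentiate the weight. *)
  transitivity (nu_int2 al be (fun v u => g * (numer al be v u * ker g a x y v u) + ((-1) * T1 v u + (-1) * T2 v u))).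
  - apply nu_int2_ext; auto.
    + apply (lip2_scal g). apply (lip2_scal (a - x - y)); auto.
    + intros v u Hv Hu. unfold T1, T2, numer. fold g. rewrite (ker_succ g a x y v u H Hv Hu).
      replace (g * (((1 + u) * (1 + v) - 2 / g * (al * u * (1 + v) + be * v * (1 + u)))
          * ((a - v * x - u * y) * ker (g + 1) a x y v u)))
        with ((g * (1 + u) * (1 + v) - 2 * (al * u * (1 + v) + be * v * (1 + u)))
          * ((a - v * x - u * y) * ker (g + 1) a x y v u)) by (field; lra).
      ring.
  - rewrite (nu_int2_plus al be Hal Hbe (fun v u => g * (numer al be v u * ker g a x y v u))).
    + rewrite (nu_int2_plus al be Hal Hbe (fun v u => (-1) * T1 v u)).
      * rewrite (nu_int2_scal al be Hal Hbe (-1) T1), (nu_int2_scal al be Hal Hbe (-1) T2), E1, E2; auto. ring.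
      * apply lip2_scal; auto.
      * apply lip2_scal; auto.
    + apply (lip2_scal g); auto.
    + apply (lip2_plus (fun v u => (-1) * T1 v u)); apply lip2_scal; auto.
Qed.

Lemma is_derive_core_aux a x y : Rabs x + Rabs y < a ->
  is_derive (fun a => core a x y) a
    (nu_int2 al be (fun v u => - ((al + be) * numer al be v u) * ker (al + be + 1) a x y v u)).
Proof.
  intros H. set (g := al + be) in *. assert (Hg : 0 < g) by (unfold g; lra).
  (* Half the distance of [a] to the singular value [|x| + |y|], so that every base stays above [m]
     while [a] moves by less than [m]. *)
  set (m := (a - (Rabs x + Rabs y)) / 2). assert (Hm : 0 < m) by (unfold m; lra).
  set (C := g * (g + 1) * Rpower m (- (g + 2))).
  assert (HC : 0 <= C) by (apply Rmult_le_pos; [nra | left; apply Rpower_pos]).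
  assert (LN : lip2 (numer al be)) by lip2_tac. destruct LN as [M [HM _]].
  apply (is_derive_quadratic _ a _ (M * C) m Hm).
  intros a' Ha'. apply Rabs_def2 in Ha'.
  assert (H' : Rabs x + Rabs y < a') by (unfold m in *; lra).
  assert (L1 : lip2 (fun v u => numer al be v u * ker g a' x y v u)) by lip2_tac.
  assert (L0 : lip2 (fun v u => numer al be v u * ker g a x y v u)) by lip2_tac.
  assert (L2 : lip2 (fun v u => - (g * numer al be v u) * ker (g + 1) a x y v u)).
  { apply lip2_ext with (fun v u => (-1) * (g * numer al be v u * ker (g + 1) a x y v u));
      [intros; ring | lip2_tac]. }
  unfold core. fold g. rewrite <- (nu_int2_scal al be Hal Hbe (a' - a)) by auto.
  replace (_ - _ - _) with (nu_int2 al be (fun v u => numer al be v u * ker g a' x y v u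
    + ((-1) * (numer al be v u * ker g a x y v u)
       + (-1) * ((a' - a) * (- (g * numer al be v u) * ker (g + 1) a x y v u))))).
  - apply nu_int2_abs_le; auto.
    + apply (lip2_plus (fun v u => numer al be v u * ker g a' x y v u)); auto.
      apply (lip2_plus (fun v u => (-1) * (numer al be v u * ker g a x y v u))).
      * apply (lip2_scal (-1)); auto.
      * apply (lip2_scal (-1)), (lip2_scal (a' - a)); auto.
    + intros v u Hv Hu.
      assert (A1 := ker_arg_bound a x y v u Hv Hu). assert (A2 := ker_arg_bound a' x y v u Hv Hu).
      assert (B := Rpower_neg_taylor g m (a - v * x - u * y) (a' - v * x - u * y) Hg Hm
        ltac:(unfold m in *; lra) ltac:(unfold m in *; lra)).
      fold (ker g a x y v u) in B. fold (ker g a' x y v u) in B. fold (ker (g + 1) a x y v u) in B. fold C in B.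
      replace (a' - v * x - u * y - (a - v * x - u * y)) with (a' - a) in B by ring.
      replace (_ + _) with (numer al be v u * (ker g a' x y v u - ker g a x y v u -
         (a' - a) * (- g * ker (g + 1) a x y v u))) by ring.
      rewrite Rabs_mult, Rmult_assoc. apply Rmult_le_compat; auto using Rabs_pos.
  - rewrite (nu_int2_plus al be Hal Hbe (fun v u => numer al be v u * ker g a' x y v u)); auto.
    + rewrite (nu_int2_plus al be Hal Hbe (fun v u => (-1) * (numer al be v u * ker g a x y v u))).
      * rewrite (nu_int2_scal al be Hal Hbe (-1) (fun v u => numer al be v u * ker g a x y v u)) by auto.
        rewrite (nu_int2_scal al be Hal Hbe (-1) (fun v u => (a' - a) * (- (g * numer al be v u) * ker (g + 1) a x y v u))).
        -- ring.
        -- apply (lip2_scal (a' - a)); auto.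
      * apply (lip2_scal (-1)); auto.
      * apply (lip2_scal (-1)), (lip2_scal (a' - a)); auto.
    + apply (lip2_plus (fun v u => (-1) * (numer al be v u * ker g a x y v u))).
      * apply (lip2_scal (-1)); auto.
      * apply (lip2_scal (-1)), (lip2_scal (a' - a)); auto.
Qed.

(* The numerator is [(al (1 + v) (1 - u) + be (1 + u) (1 - v)) / (al + be)]. *)
Lemma is_derive_core a x y : Rabs x + Rabs y < a ->
  is_derive (fun a => core a x y) a
    (- (al * (core a x (- y) / (a - x + y)) + be * (core a (- x) y / (a + x - y)))).
Proof.
  intros H. evar_last; [apply is_derive_core_aux; auto|].
  assert (B := Rabs_le_between x (Rabs x)). assert (B' := Rabs_le_between y (Rabs y)).
  assert (Bx : - Rabs x <= x <= Rabs x) by (apply B; lra).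
  assert (By : - Rabs y <= y <= Rabs y) by (apply B'; lra).
  rewrite <- !core1_by_parts by (rewrite ?Rabs_Ropp; auto).
  replace ((a - x - - y) * core1 a x (- y) / (a - x + y)) with (core1 a x (- y)) by (field; lra).
  replace ((a - - x - y) * core1 a (- x) y / (a + x - y)) with (core1 a (- x) y) by (field; lra).
  set (g := al + be) in *. assert (Hg : 0 < g) by (unfold g; lra).
  unfold core1. fold g.
  assert (Hx : Rabs x + Rabs (- y) < a) by (rewrite Rabs_Ropp; auto).
  assert (Hy : Rabs (- x) + Rabs y < a) by (rewrite Rabs_Ropp; auto).
  assert (LX : lip2 (fun v u => (1 + u) * (1 + v) * ker (g + 1) a x (- y) v u)) by lip2_tac.
  assert (LY : lip2 (fun v u => (1 + u) * (1 + v) * ker (g + 1) a (- x) y v u)) by lip2_tac.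
  assert (LX' : lip2 (fun v u => (1 - u) * (1 + v) * ker (g + 1) a x y v u)) by lip2_tac.
  assert (LY' : lip2 (fun v u => (1 + u) * (1 - v) * ker (g + 1) a x y v u)) by lip2_tac.
  (* The symmetry of [nu^al] under [u -> - u] moves the sign of [y] into the factor [1 + u]; the
     same is then done with [x] and [v]. *)
  replace (nu_int2 al be (fun v u => (1 + u) * (1 + v) * ker (g + 1) a x (- y) v u))
    with (nu_int2 al be (fun v u => (1 - u) * (1 + v) * ker (g + 1) a x y v u)).
  2:{ rewrite <- (nu_int2_opp_u al be Hal Hbe _ LX). apply nu_int2_ext; auto.
      intros v u _ _. unfold ker.
      replace (a - v * x - - u * - y) with (a - v * x - u * y) by ring. ring. }
  replace (nu_int2 al be (fun v u => (1 + u) * (1 + v) * ker (g + 1) a (- x) y v u))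
    with (nu_int2 al be (fun v u => (1 + u) * (1 - v) * ker (g + 1) a x y v u)).
  2:{ rewrite <- (nu_int2_opp_v al be Hal Hbe _ LY). apply nu_int2_ext; auto.
      intros v u _ _. unfold ker.
      replace (a - - v * - x - u * y) with (a - v * x - u * y) by ring. ring. }
  rewrite <- (nu_int2_scal al be Hal Hbe al) by auto. rewrite <- (nu_int2_scal al be Hal Hbe be) by auto.
  rewrite <- (nu_int2_plus al be Hal Hbe); try (apply lip2_scal; auto).
  match goal with |- _ = - ?X => replace (- X) with ((-1) * X) by ring end.
  rewrite <- (nu_int2_scal al be Hal Hbe).
  - symmetry. apply nu_int2_ext; auto.
    + lip2_tac.
    + intros v u Hv Hu. unfold numer. fold g.
      replace (g * ((1 + u) * (1 + v) - 2 / g * (al * u * (1 + v) + be * v * (1 + u))))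
        with (g * (1 + u) * (1 + v) - 2 * (al * u * (1 + v) + be * v * (1 + u))) by (field; lra).
      generalize (ker (g + 1) a x y v u). intros K. unfold g. ring.
  - lip2_tac.
Qed.

(** The measures are even, so only the constant term of the numerator survives. This fixes the
    leading coefficient of the double integral at infinity. *)
Lemma numer_mass : nu_int2 al be (numer al be) = 1.
Proof.
  assert (Ht : test_fun (fun u => u)).
  { split; [intros; apply continuous_id|]. exists 1. unfold unit_interval; intros; apply Rabs_le; lra. }
  assert (Hmean : forall c, 0 < c -> nu_int c (fun u => u) = 0).
  { intros c Hc. assert (E := nu_int_opp c Hc _ Ht). simpl in E.
    assert (E' : nu_int c (fun u => - u) = - nu_int c (fun u => u)).
    { replace (- nu_int c (fun u => u)) with ((-1) * nu_int c (fun u => u)) by ring.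
      rewrite <- nu_int_scal by auto. apply nu_int_ext; auto.
      - split; [intros; apply (continuous_opp (V := R_NormedModule)), continuous_id|].
        exists 1. unfold unit_interval; intros; apply Rabs_le; lra.
      - intros; ring. }
    lra. }
  assert (E1 : forall c0 c1 c, 0 < c -> nu_int c (fun u => c0 + c1 * u) = c0).
  { intros c0 c1 c Hc. rewrite (nu_int_plus c Hc (fun _ => c0) (fun u => c1 * u)).
    - rewrite nu_int_const, nu_int_scal, Hmean by auto. ring.
    - apply test_fun_const.
    - split; [intros; apply (continuous_scal_r (V := R_NormedModule)), continuous_id|].
      exists (Rabs c1 * 1). intros u Hu. rewrite Rabs_mult. apply Rmult_le_compat_l; [apply Rabs_pos|].
      unfold unit_interval in Hu. apply Rabs_le; lra. }
  unfold nu_int2. rewrite <- (E1 1 (1 - 2 / (al + be) * be) be Hbe) at 1.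
  assert (LN : lip2 (numer al be)) by lip2_tac.
  apply nu_int_ext; auto; [apply lip2_inner; auto|].
  intros v Hv. rewrite <- (E1 (1 + (1 - 2 / (al + be) * be) * v)
     ((1 + v) - 2 / (al + be) * (al * (1 + v) + be * v)) al Hal).
  apply nu_int_ext; auto; [apply lip2_section; auto|]. intros u Hu. unfold numer. ring.
Qed.

End Core.

(** * The product [A_fun] *)

(* [n]-fold division by linear factors leaves the constant [c]: polynomials of degree [n]
   with leading coefficient [c], without coefficients. *)
Fixpoint is_poly (n : nat) (f : R -> R) (c : R) : Prop :=
  match n with
  | O => forall s, f s = c
  | S m => forall r, exists g, is_poly m g c /\ forall s, f s = (s - r) * g s + f r
  end.

Lemma is_poly_ext n f g c : (forall s, f s = g s) -> is_poly n f c -> is_poly n g c.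
Proof.
  destruct n as [|n]; simpl; intros E H.
  - intros s. now rewrite <- E.
  - intros r. destruct (H r) as (h & Hh & Hs). exists h. split; auto.
    intros s. now rewrite <- !E.
Qed.

Lemma is_poly_add_const n f c e : is_poly (S n) f c -> is_poly (S n) (fun s => f s + e) c.
Proof.
  intros H r. destruct (H r) as (h & Hh & Hs). exists h. split; auto.
  intros s. rewrite (Hs s). ring.
Qed.

Lemma is_poly_raise n f c : is_poly n f c -> is_poly (S n) f 0.
Proof.
  revert f. induction n as [|n IH]; intros f H.
  - simpl in *. intros r. exists (fun _ => 0). split; auto. intros s. rewrite !H. ring.
  - intros r. destruct (H r) as (h & Hh & Hs). exists h. split; auto.
Qed.

Lemma is_poly_add_lower n f g c d e : is_poly (S n) f c -> is_poly n g d ->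
  is_poly (S n) (fun s => f s + e * g s) c.
Proof.
  revert f g. induction n as [|n IH]; intros f g Hf Hg.
  - apply is_poly_ext with (fun s => f s + e * d); [intros s; now rewrite Hg|].
    now apply is_poly_add_const.
  - intros r. destruct (Hf r) as (h & Hh & Hs). destruct (Hg r) as (k & Hk & Hs').
    exists (fun s => h s + e * k s). split; [apply IH; auto|].
    intros s. rewrite (Hs s), (Hs' s). ring.
Qed.

Lemma is_poly_mulX n f c : is_poly n f c -> is_poly (S n) (fun s => s * f s) c.
Proof.
  intros H r. destruct n as [|n].
  - exists f. split; auto. intros s. simpl in H. rewrite !H. ring.
  - destruct (H r) as (h & Hh & Hs). exists (fun s => f s + r * h s).
    split; [apply (is_poly_add_lower n f h c c r); auto|].
    intros s. rewrite (Hs s). ring.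
Qed.

Lemma is_poly_roots n f c (rho : nat -> R) : is_poly n f c ->
  (forall i, (i < n)%nat -> f (rho i) = 0) ->
  (forall i j, (i < j < n)%nat -> rho i <> rho j) ->
  forall s, f s = c * prodR (fun i => s - rho i) n.
Proof.
  revert f. induction n as [|n IH]; intros f Hf H0 Hd s.
  - simpl in *. rewrite Hf. ring.
  - destruct (Hf (rho n)) as (g & Hg & Hs). rewrite (H0 n) in Hs by lia.
    rewrite Hs. simpl. rewrite (IH g Hg).
    + ring.
    + intros i Hi. assert (E := Hs (rho i)). rewrite H0 in E by lia.
      assert (D := Hd i n ltac:(lia)).
      apply Rmult_eq_reg_l with (rho i - rho n); lra.
    + intros i j Hij. apply Hd; lia.
Qed.

(* The value [2] at [n = 0] comes from the normalisation
   [cheb b n (b * cos th) = 2 * (b / 2) ^ n * cos (n * th)], which makes the others monic. *)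
Fixpoint cheb (b : R) (n : nat) (s : R) : R :=
  match n with
  | O => 2
  | S O => s
  | S ((S p) as m) => s * cheb b m s - b ^ 2 / 4 * cheb b p s
  end.

Lemma cheb_SS b n s : cheb b (S (S n)) s = s * cheb b (S n) s - b ^ 2 / 4 * cheb b n s.
Proof. reflexivity. Qed.

Lemma cheb_cos b n th : cheb b n (b * cos th) = 2 * (b / 2) ^ n * cos (INR n * th).
Proof.
  enough (H : cheb b n (b * cos th) = 2 * (b / 2) ^ n * cos (INR n * th) /\
    cheb b (S n) (b * cos th) = 2 * (b / 2) ^ (S n) * cos (INR (S n) * th)) by apply H.
  induction n as [|n [IH1 IH2]].
  - split; simpl; rewrite ?Rmult_0_l, ?cos_0, ?Rmult_1_l; field.
  - split; auto. rewrite cheb_SS, IH1, IH2.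
    replace (INR (S (S n)) * th) with (INR (S n) * th + th) by (rewrite (S_INR (S n)); ring).
    replace (INR n * th) with (INR (S n) * th - th) by (rewrite S_INR; ring).
    rewrite cos_plus, cos_minus. simpl pow. field.
Qed.

Lemma is_poly_cheb b n : is_poly (S n) (cheb b (S n)) 1.
Proof.
  enough (H : is_poly (S n) (cheb b (S n)) 1 /\ is_poly (S (S n)) (cheb b (S (S n))) 1) by apply H.
  assert (H1 : is_poly 1 (cheb b 1) 1).
  { intros r. exists (fun _ => 1). split; [intros s; auto|]. intros s. simpl. ring. }
  induction n as [|n [IH1 IH2]].
  - split; auto.
    apply is_poly_ext with (fun s => s * cheb b 1 s + - (b ^ 2 / 2)).
    + intros s. rewrite cheb_SS. simpl. field.
    + apply is_poly_add_const. apply is_poly_mulX. auto.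
  - split; auto.
    apply is_poly_ext with (fun s => s * cheb b (S (S n)) s + - (b ^ 2 / 4) * cheb b (S n) s).
    + intros s. rewrite (cheb_SS b (S n)). ring.
    + apply (is_poly_add_lower (S (S n)) _ _ 1 0).
      * apply is_poly_mulX; auto.
      * apply is_poly_raise with 1. auto.
Qed.

(** The zeros of [sin (n * x)] are isolated. This removes exceptional angles twice: those where
    [A_fun] has multiple roots, and those on the mirrors. *)
Lemma continuous_zero_dense (psi : R -> R) (n : R) : 0 < n ->
  (forall x, continuity_pt psi x) ->
  (forall x, sin (n * x) <> 0 -> psi x = 0) -> forall x, psi x = 0.
Proof.
  intros Hn Hc H x. destruct (Req_dec (sin (n * x)) 0) as [Hs|Hs]; [|auto].
  apply NNPP. intros Hne.
  assert (Hp : 0 < Rabs (psi x)) by (apply Rabs_pos_lt; auto).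
  destruct (Hc x (Rabs (psi x)) Hp) as (d & Hd & HB).
  (* [h <= / n] keeps [n * h] in [(0, 1]], where the sine is positive; at a zero of [sin (n * x)]
     the addition formula then gives a nonzero value at [x + h]. *)
  set (h := Rmin (d / 2) (/ n)).
  assert (Hin : 0 < / n) by (apply Rinv_0_lt_compat; auto).
  assert (Hh : 0 < h) by (apply Rmin_glb_lt; lra).
  assert (h1 : h <= d / 2) by apply Rmin_l. assert (h2 : h <= / n) by apply Rmin_r.
  assert (Hnh : 0 < n * h <= 1).
  { split; [apply Rmult_lt_0_compat; auto|]. rewrite <- (Rinv_r n) by lra.
    apply Rmult_le_compat_l; lra. }
  specialize (HB (x + h)). simpl in HB. unfold Rdist in HB.
  assert (E : psi (x + h) = 0).
  { apply H. rewrite Rmult_plus_distr_l, sin_plus, Hs, Rmult_0_l, Rplus_0_l.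
    apply Rmult_integral_contrapositive_currified.
    - intros Hc0. assert (S := sin2_cos2 (n * x)). rewrite Hs, Hc0 in S. unfold Rsqr in S. lra.
    - assert (HP := PI2_1). apply Rgt_not_eq, sin_gt_0; lra. }
  rewrite E in HB. assert (Rabs (0 - psi x) < Rabs (psi x)).
  { apply HB. split; [split; [constructor | lra]|].
    replace (x + h - x) with h by ring. rewrite Rabs_right; lra. }
  rewrite Rminus_0_l, Rabs_Ropp in H0. lra.
Qed.

(** The difference of the cosines is a product of two sines. One would vanish only if [(j - i) / k]
    were an integer, the other only if [q] were a multiple of [PI]. *)
Lemma chebyshev_roots_distinct k b q i j : 0 < b -> sin q <> 0 -> (i < j < k)%nat ->
  b * cos ((q + 2 * PI * INR i) / INR k) <> b * cos ((q + 2 * PI * INR j) / INR k).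
Proof.
  intros Hb Hq Hij E. apply Rmult_eq_reg_l in E; [|lra].
  assert (Hk : 0 < INR k) by (apply lt_0_INR; lia).
  assert (Hj : INR i + 1 <= INR j) by (rewrite <- S_INR; apply le_INR; lia).
  assert (Hjk : INR j < INR k) by (apply lt_INR; lia).
  assert (Hi0 := pos_INR i). assert (HP := PI_RGT_0).
  assert (F := form2 ((q + 2 * PI * INR i) / INR k) ((q + 2 * PI * INR j) / INR k)).
  assert (Z : sin (((q + 2 * PI * INR i) / INR k - (q + 2 * PI * INR j) / INR k) / 2) *
     sin (((q + 2 * PI * INR i) / INR k + (q + 2 * PI * INR j) / INR k) / 2) = 0) by lra.
  apply Rmult_integral in Z. destruct Z as [Z|Z].
  - replace (((q + 2 * PI * INR i) / INR k - (q + 2 * PI * INR j) / INR k) / 2)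
      with (- (PI * ((INR j - INR i) / INR k))) in Z by (field; lra).
    rewrite sin_neg in Z.
    assert (0 < (INR j - INR i) / INR k) by (apply Rdiv_lt_0_compat; lra).
    assert ((INR j - INR i) / INR k < 1).
    { apply Rmult_lt_reg_r with (INR k); auto. unfold Rdiv. rewrite Rmult_assoc, Rinv_l; lra. }
    assert (0 < sin (PI * ((INR j - INR i) / INR k))) by (apply sin_gt_0; nra). lra.
  - apply sin_eq_0_0 in Z. destruct Z as [n Hn].
    replace (((q + 2 * PI * INR i) / INR k + (q + 2 * PI * INR j) / INR k) / 2)
      with ((q + PI * (INR i + INR j)) / INR k) in Hn by (field; lra).
    apply Hq. apply sin_eq_0_1. exists (n * Z.of_nat k - Z.of_nat i - Z.of_nat j)%Z.
    rewrite !minus_IZR, mult_IZR, <- !INR_IZR_INZ.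
    assert (E2 : q + PI * (INR i + INR j) = IZR n * PI * INR k).
    { rewrite <- Hn. field. lra. }
    lra.
Qed.

Lemma continuity_pt_prodR (f : nat -> R -> R) n x :
  (forall i, (i < n)%nat -> continuity_pt (f i) x) -> continuity_pt (fun t => prodR (fun i => f i t) n) x.
Proof.
  induction n as [|n IH]; intros H; simpl.
  - apply continuity_pt_const. intros t t'; auto.
  - apply (continuity_pt_mult (fun t => prodR (fun i => f i t) n) (f n)).
    + apply IH. intros; apply H; lia.
    + apply H; lia.
Qed.

(** The right side is monic of degree [k] in [s], and by [cheb_cos] it vanishes at the [k] roots
    displayed in [A_fun]. These are distinct when [sin q <> 0] and [b > 0]; continuity in [q] gives
    the remaining angles, and for [b = 0] both sides are [s ^ k]. *)
Lemma A_fun_cheb k s b q : (1 <= k)%nat -> 0 <= b ->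
  A_fun k s b q = cheb b k s - 2 * (b / 2) ^ k * cos q.
Proof.
  intros Hk Hb. assert (Hk0 : 0 < INR k) by (apply lt_0_INR; lia).
  destruct (Req_dec b 0) as [->|Hb0].
  - destruct k as [|k]; [lia|].
    assert (E1 : cheb 0 (S k) s = s ^ S k).
    { clear. induction k as [|k IH]; [simpl; ring|].
      rewrite cheb_SS, IH. simpl. field. }
    rewrite E1. unfold A_fun. replace (2 * (0 / 2) ^ S k * cos q) with 0 by (simpl; field).
    rewrite Rminus_0_r.
    assert (E2 : forall (f : nat -> R) n, prodR (fun l => s - 0 * f l) n = s ^ n).
    { intros f n. induction n as [|n IH]; simpl; [auto|]. rewrite IH. ring. }
    apply (E2 (fun l => cos ((q + 2 * PI * INR l) / INR (S k)))).
  - assert (Hb1 : 0 < b) by lra.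
    enough (H : forall q, A_fun k s b q - (cheb b k s - 2 * (b / 2) ^ k * cos q) = 0)
      by (specialize (H q); lra).
    clear q. apply (continuous_zero_dense _ 1 Rlt_0_1).
    + intros q. apply continuity_pt_minus.
      * unfold A_fun. apply (continuity_pt_prodR (fun l q => s - b * cos ((q + 2 * PI * INR l) / INR k))).
        intros i _. apply (is_derive_continuity_pt _ _ (b * / INR k * sin ((q + 2 * PI * INR i) / INR k))).
        auto_derive; [auto|]. unfold Rdiv. ring.
      * apply (is_derive_continuity_pt _ _ (2 * (b / 2) ^ k * sin q)). auto_derive; auto. ring.
    + intros q Hq. rewrite Rmult_1_l in Hq.
      destruct k as [|k]; [lia|].
      assert (HP : is_poly (S k) (fun s => cheb b (S k) s + - (2 * (b / 2) ^ S k * cos q)) 1).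
      { apply is_poly_add_const, is_poly_cheb. }
      assert (E := is_poly_roots _ _ _ (fun l => b * cos ((q + 2 * PI * INR l) / INR (S k))) HP).
      unfold A_fun.
      assert (E2 : cheb b (S k) s + - (2 * (b / 2) ^ S k * cos q)
         = 1 * prodR (fun l => s - b * cos ((q + 2 * PI * INR l) / INR (S k))) (S k)).
      { apply E.
        - intros i _. rewrite cheb_cos.
          replace (INR (S k) * ((q + 2 * PI * INR i) / INR (S k))) with (q + 2 * INR i * PI) by (field; lra).
          rewrite cos_period. ring.
        - intros i j Hij. apply chebyshev_roots_distinct; auto. }
      lra.
Qed.

(** * Bounds and the logarithmic derivative of [A_fun] *)

Fixpoint rsum (f : nat -> R) (n : nat) : R :=
  match n with
  | O => 0
  | S m => rsum f m + f m
  end.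

Lemma prodR_bounds f n x y : 0 < x -> (forall i, (i < n)%nat -> x <= f i <= y) ->
  x ^ n <= prodR f n <= y ^ n.
Proof.
  intros Hx H. induction n as [|n IH]; simpl; [lra|].
  assert (H1 := IH ltac:(intros; apply H; lia)). assert (H2 := H n ltac:(lia)).
  assert (0 < x ^ n) by (apply pow_lt; auto).
  rewrite (Rmult_comm x), (Rmult_comm y). split; apply Rmult_le_compat; lra.
Qed.

Lemma A_fun_bounds k s b q : 0 <= b -> b < s -> (s - b) ^ k <= A_fun k s b q <= (s + b) ^ k.
Proof.
  intros Hb Hs. apply prodR_bounds; [lra|].
  intros i _. generalize (COS_bound ((q + 2 * PI * INR i) / INR k)). nra.
Qed.

Lemma A_fun_pos k s b q : 0 <= b -> b < s -> 0 < A_fun k s b q.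
Proof.
  intros Hb Hs. apply Rlt_le_trans with ((s - b) ^ k); [apply pow_lt; lra|].
  apply A_fun_bounds; auto.
Qed.

Lemma is_derive_prodR (rho : nat -> R) n s : (forall i, (i < n)%nat -> s - rho i <> 0) ->
  is_derive (fun s => prodR (fun i => s - rho i) n) s
    (prodR (fun i => s - rho i) n * rsum (fun i => / (s - rho i)) n).
Proof.
  induction n as [|n IH]; intros H; simpl.
  - evar_last; [apply @is_derive_const|]. rewrite Rmult_0_r. reflexivity.
  - evar_last.
    + apply (is_derive_mult (fun s => prodR (fun i => s - rho i) n) (fun s => s - rho n)).
      * apply IH. intros; apply H; lia.
      * auto_derive; auto.
      * intros; apply Rmult_comm.
    + unfold plus, Hierarchy.mult; simpl. unfold Hierarchy.mult; simpl. field. apply H; lia.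
Qed.

(** [cheb b k] differs from [A_fun] by a constant in [s], so its derivative is the product times its
    logarithmic derivative. The function does not involve [q]; comparing two angles is what links
    the two classes of reflections. *)
Lemma is_derive_cheb k s b q : (1 <= k)%nat -> 0 <= b -> b < s ->
  is_derive (cheb b k) s
    (A_fun k s b q * rsum (fun l => / (s - b * cos ((q + 2 * PI * INR l) / INR k))) k).
Proof.
  intros Hk Hb Hs.
  apply is_derive_ext with (fun s => A_fun k s b q + 2 * (b / 2) ^ k * cos q).
  { intros t. change (A_fun k t b q + 2 * (b / 2) ^ k * cos q = cheb b k t).
    rewrite A_fun_cheb; auto. ring. }
  evar_last.
  - apply (is_derive_plus (V := R_NormedModule) (fun s => A_fun k s b q)).
    + apply (is_derive_prodR (fun l => b * cos ((q + 2 * PI * INR l) / INR k))).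
      intros i _. generalize (COS_bound ((q + 2 * PI * INR i) / INR k)). nra.
    + apply @is_derive_const.
  - unfold plus, zero; simpl. rewrite Rplus_0_r. reflexivity.
Qed.

(** * The differential system satisfied by the double integral *)

Lemma rsum_ext f g n : (forall i, (i < n)%nat -> f i = g i) -> rsum f n = rsum g n.
Proof.
  induction n as [|n IH]; intros H; simpl; auto. rewrite IH, H; auto.
Qed.

Lemma rsum_scal c f n : rsum (fun i => c * f i) n = c * rsum f n.
Proof. induction n as [|n IH]; simpl; [ring | rewrite IH; ring]. Qed.

Lemma rsum_plus f g n : rsum (fun i => f i + g i) n = rsum f n + rsum g n.
Proof. induction n as [|n IH]; simpl; [ring | rewrite IH; ring]. Qed.

Lemma rsum_even_odd f n :
  rsum f (2 * n) = rsum (fun l => f (2 * l)%nat) n + rsum (fun l => f (2 * l + 1)%nat) n.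
Proof.
  induction n as [|n IH]; [simpl; ring|].
  replace (2 * S n)%nat with (S (S (2 * n))) by lia.
  change (rsum f (2 * n) + f (2 * n)%nat + f (S (2 * n))
    = rsum (fun l => f (2 * l)%nat) n + f (2 * n)%nat
      + (rsum (fun l => f (2 * l + 1)%nat) n + f (2 * n + 1)%nat)).
  rewrite IH. replace (2 * n + 1)%nat with (S (2 * n)) by lia. ring.
Qed.

(** Each product is at most half the sum of the squares. The bound keeps the kernel off its
    singularity and the argument of [acos] in [[-1, 1]]. *)
Lemma cos_sin_abs_sum x y : Rabs (cos x * cos y) + Rabs (sin x * sin y) <= 1.
Proof.
  rewrite !Rabs_mult.
  assert (H1 := sin2_cos2 x). assert (H2 := sin2_cos2 y).
  rewrite (Rsqr_abs (sin x)), (Rsqr_abs (cos x)) in H1.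
  rewrite (Rsqr_abs (sin y)), (Rsqr_abs (cos y)) in H2. unfold Rsqr in *.
  assert (0 <= (Rabs (cos x) - Rabs (cos y)) * (Rabs (cos x) - Rabs (cos y))) by apply Rle_0_sqr.
  assert (0 <= (Rabs (sin x) - Rabs (sin y)) * (Rabs (sin x) - Rabs (sin y))) by apply Rle_0_sqr.
  nra.
Qed.

Section RightHandSide.

Variable k : nat.
Variables al be b ph : R.
Hypothesis Hk : (1 <= k)%nat.
Hypothesis Hal : 0 < al.
Hypothesis Hbe : 0 < be.
Hypothesis Hb : 0 <= b.

Let c := 2 * (b / 2) ^ k.

(** [B_fun] times the double integral of the theorem for a [z] of angle [th], where [ph] is the
    angle of [w] and [b = |z| |w|]. The angle is an argument so that the whole orbit of [z] is
    covered. *)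
Definition rhs (th s : R) : R :=
  core al be (cheb b k s) (2 * (b / 2) ^ k * (cos (INR k * th) * cos (INR k * ph)))
    (2 * (b / 2) ^ k * (sin (INR k * th) * sin (INR k * ph))).

Lemma scale_nonneg : 0 <= c.
Proof. unfold c. apply Rmult_le_pos; [lra|]. apply pow_le; lra. Qed.

Lemma scale_lt_cheb s : b < s -> c < cheb b k s.
Proof.
  intros Hs. assert (H := A_fun_pos k s b 0 Hb Hs).
  rewrite A_fun_cheb, cos_0 in H by auto. unfold c. lra.
Qed.

Lemma rhs_args th s : b < s ->
  Rabs (c * (cos (INR k * th) * cos (INR k * ph))) + Rabs (c * (sin (INR k * th) * sin (INR k * ph)))
  < cheb b k s.
Proof.
  intros Hs. apply Rle_lt_trans with (2 := scale_lt_cheb s Hs).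
  rewrite (Rabs_mult c (cos _ * _)), (Rabs_mult c (sin _ * _)), (Rabs_right c) by (apply Rle_ge, scale_nonneg).
  generalize (cos_sin_abs_sum (INR k * th) (INR k * ph)) scale_nonneg. intros. nra.
Qed.

(** [k] times the reflected angle is [- k th] modulo [2 PI] for even [j] and [PI - k th] for odd
    [j]. All reflections of one class thus act on the arguments of [core] by the same sign change,
    as in the case [k = 1]. *)
Lemma rhs_reflect_even th s l :
  rhs (INR (2 * l) * PI / INR k - th) s =
  core al be (cheb b k s) (c * (cos (INR k * th) * cos (INR k * ph)))
    (- (c * (sin (INR k * th) * sin (INR k * ph)))).
Proof.
  assert (Hk0 : 0 < INR k) by (apply lt_0_INR; lia). unfold rhs. fold c.
  replace (INR k * (INR (2 * l) * PI / INR k - th)) with (- (INR k * th) + 2 * INR l * PI)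
    by (rewrite mult_INR; simpl; field; lra).
  rewrite cos_period, sin_period, cos_neg, sin_neg. f_equal. ring.
Qed.

Lemma rhs_reflect_odd th s l :
  rhs (INR (2 * l + 1) * PI / INR k - th) s =
  core al be (cheb b k s) (- (c * (cos (INR k * th) * cos (INR k * ph))))
    (c * (sin (INR k * th) * sin (INR k * ph))).
Proof.
  assert (Hk0 : 0 < INR k) by (apply lt_0_INR; lia). unfold rhs. fold c.
  replace (INR k * (INR (2 * l + 1) * PI / INR k - th)) with (PI - (INR k * th) + 2 * INR l * PI)
    by (rewrite plus_INR, mult_INR; simpl; field; lra).
  rewrite cos_period, sin_period, sin_PI_x, Rtrigo_facts.cos_pi_minus. f_equal. ring.
Qed.

(** The derivative of [core] in [a] has one term per class, with denominators [a - x + y] and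
    [a + x - y] that are themselves values of [A_fun]. Writing the derivative of [cheb] with the
    matching angle in each term cancels the denominator and leaves the sum of [1 / (s - d)] over
    that class. *)
Lemma is_derive_rhs th s : b < s ->
  is_derive (rhs th) s
    (- rsum (fun j => mult al be j * (rhs (INR j * PI / INR k - th) s
         / (s - b * cos (INR j * PI / INR k - th - ph)))) (2 * k)).
Proof.
  intros Hs. assert (Hk0 : 0 < INR k) by (apply lt_0_INR; lia).
  set (a := cheb b k s).
  set (x := c * (cos (INR k * th) * cos (INR k * ph))).
  set (y := c * (sin (INR k * th) * sin (INR k * ph))).
  assert (Hxy : Rabs x + Rabs y < a) by (apply rhs_args; auto).
  assert (Hc : cos (INR k * (th + ph)) = cos (INR k * th) * cos (INR k * ph) - sin (INR k * th) * sin (INR k * ph)).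
  { rewrite <- cos_plus. f_equal. ring. }
  (* With these values [(q0 + 2 PI l) / k] and [(q1 + 2 PI l) / k] are the angles of the images of
     [z] under the reflections [2 l] and [2 l + 1], less [ph]. *)
  pose (q0 := - (INR k * (th + ph))). pose (q1 := PI - INR k * (th + ph)).
  assert (D0 := is_derive_cheb k s b q0 Hk Hb Hs).
  assert (D1 := is_derive_cheb k s b q1 Hk Hb Hs).
  assert (E := is_derive_unique _ _ _ D0). rewrite (is_derive_unique _ _ _ D1) in E.
  assert (P0 := A_fun_pos k s b q0 Hb Hs). assert (P1 := A_fun_pos k s b q1 Hb Hs).
  assert (A0 : A_fun k s b q0 = a - x + y).
  { rewrite A_fun_cheb by auto. unfold q0. rewrite cos_neg, Hc. unfold a, x, y. fold c. ring. }
  assert (A1 : A_fun k s b q1 = a + x - y).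
  { rewrite A_fun_cheb by auto. unfold q1. rewrite Rtrigo_facts.cos_pi_minus, Hc. unfold a, x, y. fold c. ring. }
  rewrite A0 in *. rewrite A1 in *.
  set (S0 := rsum (fun l => / (s - b * cos ((q0 + 2 * PI * INR l) / INR k))) k) in *.
  set (S1 := rsum (fun l => / (s - b * cos ((q1 + 2 * PI * INR l) / INR k))) k) in *.
  rewrite rsum_even_odd. evar_last.
  - apply (is_derive_comp (fun a => core al be a x y) (cheb b k)).
    + apply is_derive_core; auto.
    + exact D0.
  - unfold scal; cbn -[Nat.mul Nat.add INR]; unfold Hierarchy.mult; cbn -[Nat.mul Nat.add INR]. fold a.
    rewrite (rsum_ext (fun l => mult al be (2 * l) * _) (fun l => al * core al be a x (- y) * / (s - b * cos ((q0 + 2 * PI * INR l) / INR k)))).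
    + rewrite (rsum_ext (fun l => mult al be (2 * l + 1) * _)
         (fun l => be * core al be a (- x) y * / (s - b * cos ((q1 + 2 * PI * INR l) / INR k)))).
      * rewrite !rsum_scal. fold S0 S1.
        replace ((a - x + y) * S0 * - (al * (core al be a x (- y) / (a - x + y))
            + be * (core al be a (- x) y / (a + x - y))))
          with (- (al * core al be a x (- y) * S0
             + be * core al be a (- x) y * (((a - x + y) * S0) / (a + x - y)))) by (field; lra).
        rewrite <- E. f_equal. f_equal. field. lra.
      * intros l _. rewrite rhs_reflect_odd. fold a x y.
        replace (mult al be (2 * l + 1)) with be.
        -- replace (INR (2 * l + 1) * PI / INR k - th - ph) with ((q1 + 2 * PI * INR l) / INR k)
             by (unfold q1; rewrite plus_INR, mult_INR; simpl; field; lra). unfold Rdiv. ring.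
        -- unfold mult. rewrite Nat.add_1_r, Nat.even_succ, <- Nat.negb_even, Nat.even_mul. reflexivity.
    + intros l _. rewrite rhs_reflect_even. fold a x y.
      replace (mult al be (2 * l)) with al.
      * replace (INR (2 * l) * PI / INR k - th - ph) with ((q0 + 2 * PI * INR l) / INR k)
          by (unfold q0; rewrite mult_INR; simpl; field; lra). unfold Rdiv. ring.
      * unfold mult. rewrite Nat.even_mul. reflexivity.
Qed.

Lemma xi_bound v u X Y : unit_interval v -> unit_interval u -> Rabs X + Rabs Y <= 1 ->
  -1 <= v * X + u * Y <= 1.
Proof.
  intros Hv Hu H. assert (B := ker_arg_bound 1 X Y v u Hv Hu).
  assert (B' := ker_arg_bound 1 (- X) (- Y) v u Hv Hu). rewrite !Rabs_Ropp in B'. lra.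
Qed.

Lemma ker_A_fun d th s v u : unit_interval v -> unit_interval u ->
  ker d (cheb b k s) (c * (cos (INR k * th) * cos (INR k * ph))) (c * (sin (INR k * th) * sin (INR k * ph))) v u
  = / Rpower (A_fun k s b (q_uv u v (INR k * th) (INR k * ph))) d.
Proof.
  intros Hv Hu. unfold ker, q_uv. rewrite A_fun_cheb by auto. fold c.
  assert (B := xi_bound v u _ _ Hv Hu (cos_sin_abs_sum (INR k * th) (INR k * ph))).
  rewrite cos_acos.
  - rewrite <- Rpower_Ropp. f_equal. unfold xi_uv. ring.
  - unfold xi_uv. lra.
Qed.

(** [A_fun] lies between [(s - b) ^ k] and [(s + b) ^ k], so [(s - b)^p] times the kernel lies
    between [((s - b) / (s + b))^p] and [1], uniformly in [u] and [v]; the limit is then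
    [numer_mass]. *)
Lemma rhs_limit th eps : 0 < eps -> exists S, b < S /\ forall s, S < s ->
  Rabs (Rpower (s - b) (INR k * (al + be)) * rhs th s - 1) <= eps.
Proof.
  intros He. set (g := al + be). assert (Hg : 0 < g) by (unfold g; lra).
  assert (Hk0 : 0 < INR k) by (apply lt_0_INR; lia).
  assert (LN : lip2 (numer al be)) by lip2_tac. assert (LN' := LN). destruct LN' as [M [HM _]].
  assert (HM0 : 0 <= M).
  { assert (D0 : unit_interval 0) by (unfold unit_interval; lra).
    apply Rle_trans with (2 := HM 0 0 D0 D0), Rabs_pos. }
  set (p := INR k * g).
  assert (HC : continuity_pt (fun t => Rpower t p) 1).
  { eapply is_derive_continuity_pt. apply is_derive_Rpower; lra. }
  destruct (HC (eps / (M + 1))) as (d & Hd & HD); [apply Rdiv_lt_0_compat; lra|].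
  (* Chosen so that [1 - t = 2 * b / (s + b)] is below [d]; the [1] keeps the threshold above [b]
     when [b = 0]. *)
  exists (b + 1 + 2 * b / d).
  assert (H0 : 0 <= 2 * b / d) by (apply Rmult_le_pos; [lra | left; apply Rinv_0_lt_compat; auto]).
  split; [lra|]. intros s Hs.
  assert (Hsb : b < s) by lra.
  set (t := (s - b) / (s + b)).
  assert (Ht : 0 < t <= 1).
  { split; [apply Rdiv_lt_0_compat; lra|]. apply Rmult_le_reg_r with (s + b); [lra|].
    unfold t, Rdiv. rewrite Rmult_assoc, Rinv_l; lra. }
  assert (Htd : 1 - t < d).
  { replace (1 - t) with (2 * b / (s + b)) by (unfold t; field; lra).
    apply Rmult_lt_reg_r with (s + b); [lra|]. unfold Rdiv. rewrite Rmult_assoc, Rinv_l, Rmult_1_r by lra.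
    assert (2 * b = 2 * b / d * d) by (field; lra). nra. }
  assert (Htp : 1 - Rpower t p <= eps / (M + 1)).
  { destruct (Req_dec t 1) as [->|Hne].
    - unfold Rpower. rewrite ln_1, Rmult_0_r, exp_0, Rminus_diag. left; apply Rdiv_lt_0_compat; lra.
    - assert (B := HD t). simpl in B. unfold Rdist in B.
      replace (Rpower 1 p) with 1 in B by (unfold Rpower; rewrite ln_1, Rmult_0_r, exp_0; auto).
      assert (Rabs (Rpower t p - 1) < eps / (M + 1)).
      { apply B. split; [split; [constructor | lra]|]. rewrite Rabs_left1; lra. }
      apply Rabs_def2 in H. lra. }
  unfold rhs, core. fold c g.
  set (x := c * (cos (INR k * th) * cos (INR k * ph))).
  set (y := c * (sin (INR k * th) * sin (INR k * ph))). set (a := cheb b k s).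
  assert (Hxy : Rabs x + Rabs y < a) by (apply rhs_args; auto).
  assert (L1 : lip2 (fun v u => numer al be v u * ker g a x y v u)) by lip2_tac.
  rewrite <- (numer_mass al be Hal Hbe), <- (nu_int2_scal al be Hal Hbe) by auto.
  replace (_ - _) with (nu_int2 al be (fun v u => Rpower (s - b) p * (numer al be v u * ker g a x y v u)
     + (-1) * numer al be v u)).
  - apply nu_int2_abs_le; auto.
    + apply (lip2_plus (fun v u => Rpower (s - b) p * (numer al be v u * ker g a x y v u))).
      * apply (lip2_scal (Rpower (s - b) p)); auto.
      * apply lip2_scal; auto.
    + intros v u Hv Hu.
      replace (_ + _) with (numer al be v u * (Rpower (s - b) p * ker g a x y v u - 1)) by ring.
      unfold x, y, a. rewrite ker_A_fun by auto.
      set (A := A_fun _ _ _ _). assert (BA : (s - b) ^ k <= A <= (s + b) ^ k) by (apply A_fun_bounds; auto).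
      assert (P1 : 0 < (s - b) ^ k) by (apply pow_lt; lra).
      assert (E1 : Rpower (s - b) p = Rpower ((s - b) ^ k) g).
      { unfold p. rewrite <- Rpower_mult, Rpower_pow; [auto | lra]. }
      assert (E2 : Rpower (s + b) p = Rpower ((s + b) ^ k) g).
      { unfold p. rewrite <- Rpower_mult, Rpower_pow; [auto | lra]. }
      assert (PA := Rpower_pos A g). assert (PS := Rpower_pos (s - b) p). assert (PT := Rpower_pos (s + b) p).
      assert (U : Rpower (s - b) p <= Rpower A g) by (rewrite E1; apply Rle_Rpower_l; lra).
      assert (V : Rpower A g <= Rpower (s + b) p) by (rewrite E2; apply Rle_Rpower_l; lra).
      assert (W : Rpower t p * Rpower (s + b) p = Rpower (s - b) p).
      { rewrite Rpower_mult_distr by lra. f_equal. unfold t. field. lra. }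
      assert (Q1 : Rpower (s - b) p * / Rpower A g <= 1).
      { apply Rmult_le_reg_r with (Rpower A g); auto. rewrite Rmult_assoc, Rinv_l; lra. }
      assert (Q2 : Rpower t p <= Rpower (s - b) p * / Rpower A g).
      { apply Rmult_le_reg_r with (Rpower A g); auto. rewrite Rmult_assoc, Rinv_l, Rmult_1_r by lra.
        rewrite <- W. apply Rmult_le_compat_l; [left; apply Rpower_pos | auto]. }
      rewrite Rabs_mult. apply Rle_trans with (M * (eps / (M + 1))).
      * apply Rmult_le_compat; auto using Rabs_pos. apply Rabs_le; lra.
      * apply Rle_trans with ((M + 1) * (eps / (M + 1))).
        -- apply Rmult_le_compat_r; [left; apply Rdiv_lt_0_compat|]; lra.
        -- right; field; lra.
  - rewrite (nu_int2_plus al be Hal Hbe (fun v u => Rpower (s - b) p * (numer al be v u * ker g a x y v u))).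
    + rewrite (nu_int2_scal al be Hal Hbe (-1)) by auto. ring.
    + apply (lip2_scal (Rpower (s - b) p)); auto.
    + apply lip2_scal; auto.
Qed.

End RightHandSide.

(** * The Dunkl system along rays *)

Lemma cont2_comp (G : pt -> R) (p q : R -> R) x : cont2 G ->
  continuity_pt p x -> continuity_pt q x -> continuity_pt (fun t => G (p t, q t)) x.
Proof.
  intros HG Hp Hq eps He.
  destruct (HG (p x, q x) eps He) as (d & Hd & HB). simpl in HB.
  destruct (Hp d Hd) as (d1 & Hd1 & H1). destruct (Hq d Hd) as (d2 & Hd2 & H2).
  simpl in *. unfold Rdist in *.
  exists (Rmin d1 d2). split; [apply Rmin_glb_lt; auto|].
  intros y [[_ Hne] Hy]. simpl in *. unfold Rdist in *.
  apply HB; simpl.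
  - apply H1. repeat split; auto. apply Rlt_le_trans with (1 := Hy), Rmin_l.
  - apply H2. repeat split; auto. apply Rlt_le_trans with (1 := Hy), Rmin_r.
Qed.

(** The increment is split at the corner [(x, v)], with the mean value theorem on each of the two
    segments. *)
Lemma cont2_differentiable (g D1 D2 : pt -> R) x y : cont2 D1 -> cont2 D2 ->
  (forall x : pt, derivable_pt_lim (fun t => g (t, snd x)) (fst x) (D1 x)) ->
  (forall x : pt, derivable_pt_lim (fun t => g (fst x, t)) (snd x) (D2 x)) ->
  differentiable_pt_lim (fun u v => g (u, v)) x y (D1 (x, y)) (D2 (x, y)).
Proof.
  intros C1 C2 H1 H2 eps.
  destruct (C1 (x, y) (eps / 2)) as (d1 & Hd1 & B1); [generalize (cond_pos eps); lra|].
  destruct (C2 (x, y) (eps / 2)) as (d2 & Hd2 & B2); [generalize (cond_pos eps); lra|].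
  simpl in *.
  assert (Hd : 0 < Rmin d1 d2) by (apply Rmin_glb_lt; auto).
  exists (mkposreal _ Hd). simpl. intros u v Hu Hv.
  assert (L1 := Rmin_l d1 d2). assert (L2 := Rmin_r d1 d2).
  destruct (MVT_gen (fun t => g (t, v)) x u (fun t => D1 (t, v))) as (c1 & P1 & E1).
  { intros t _. apply is_derive_Reals. exact (H1 (t, v)). }
  { intros t _. apply (is_derive_continuity_pt _ _ (D1 (t, v))), is_derive_Reals. exact (H1 (t, v)). }
  destruct (MVT_gen (fun t => g (x, t)) y v (fun t => D2 (x, t))) as (c2 & P2 & E2).
  { intros t _. apply is_derive_Reals. exact (H2 (x, t)). }
  { intros t _. apply (is_derive_continuity_pt _ _ (D2 (x, t))), is_derive_Reals. exact (H2 (x, t)). }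
  assert (K1 : Rabs (c1 - x) <= Rabs (u - x)).
  { revert P1. unfold Rmin, Rmax, Rabs. repeat destruct Rle_dec; repeat destruct Rcase_abs; intros; lra. }
  assert (K2 : Rabs (c2 - y) <= Rabs (v - y)).
  { revert P2. unfold Rmin, Rmax, Rabs. repeat destruct Rle_dec; repeat destruct Rcase_abs; intros; lra. }
  specialize (B1 (c1, v)). specialize (B2 (x, c2)). simpl in *.
  assert (Q1 : Rabs (D1 (c1, v) - D1 (x, y)) < eps / 2) by (apply B1; lra).
  assert (Q2 : Rabs (D2 (x, c2) - D2 (x, y)) < eps / 2).
  { apply B2; [rewrite Rminus_diag, Rabs_R0; auto | lra]. }
  replace (g (u, v) - g (x, y) - (D1 (x, y) * (u - x) + D2 (x, y) * (v - y)))
    with ((D1 (c1, v) - D1 (x, y)) * (u - x) + (D2 (x, c2) - D2 (x, y)) * (v - y)) by lra.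
  apply Rle_trans with (1 := Rabs_triang _ _). rewrite !Rabs_mult.
  set (M := Rmax _ _). assert (M1 : Rabs (u - x) <= M) by apply Rmax_l.
  assert (M2 : Rabs (v - y) <= M) by apply Rmax_r.
  apply Rle_trans with (eps / 2 * M + eps / 2 * M); [|lra].
  apply Rplus_le_compat; apply Rmult_le_compat; auto using Rabs_pos; lra.
Qed.

Lemma sum_f_R0_rsum f n : (1 <= n)%nat -> sum_f_R0 f (n - 1) = rsum f n.
Proof.
  intros Hn. destruct n as [|n]; [lia|]. replace (S n - 1)%nat with n by lia. clear Hn.
  induction n as [|n IH]; [simpl; ring|].
  change (sum_f_R0 f n + f (S n) = rsum f (S n) + f (S n)). now rewrite IH.
Qed.

Lemma continuity_pt_rsum (f : nat -> R -> R) n x :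
  (forall i, (i < n)%nat -> continuity_pt (f i) x) -> continuity_pt (fun t => rsum (fun i => f i t) n) x.
Proof.
  induction n as [|n IH]; intros H; simpl.
  - apply continuity_pt_const. intros t t'; auto.
  - apply (continuity_pt_plus (fun t => rsum (fun i => f i t) n) (f n)).
    + apply IH. intros; apply H; lia.
    + apply H; lia.
Qed.

Section Rays.

Variable k : nat.
Variables al be : R.
Variable w : pt.
Variables g D1 D2 : pt -> R.
Hypothesis Hk : (1 <= k)%nat.
Hypothesis Hg : cont2 g.
Hypothesis HD1 : cont2 D1.
Hypothesis HD2 : cont2 D2.
Hypothesis Hp1 : forall x : pt, derivable_pt_lim (fun t => g (t, snd x)) (fst x) (D1 x).
Hypothesis Hp2 : forall x : pt, derivable_pt_lim (fun t => g (fst x, t)) (snd x) (D2 x).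
Hypothesis HT : forall x : pt, (forall j, (j < 2 * k)%nat -> inner (root k j) x <> 0) ->
  D1 x + dunkl_term k al be g (1, 0) x = fst w * g x /\
  D2 x + dunkl_term k al be g (0, 1) x = snd w * g x.

Lemma refl_polar j r th :
  refl k j (r * cos th, r * sin th)
  = (r * cos (INR j * PI / INR k - th), r * sin (INR j * PI / INR k - th)).
Proof. unfold refl; simpl. rewrite cos_minus, sin_minus. f_equal; ring. Qed.

(** The mirrors lie at the angles [j PI / (2 k)], which are zeros of [sin (2 k th)]. *)
Lemma root_polar_neq0 j r th : r <> 0 -> sin (2 * INR k * th) <> 0 ->
  inner (root k j) (r * cos th, r * sin th) <> 0.
Proof.
  intros Hr Hs H. assert (Hk0 : 0 < INR k) by (apply lt_0_INR; lia).
  unfold inner, root in H; simpl in H.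
  assert (E : r * sin (th - INR j * PI / INR k / 2) = 0) by (rewrite sin_minus; lra).
  apply Rmult_integral in E. destruct E as [E|E]; [auto|].
  apply sin_eq_0_0 in E. destruct E as [n Hn].
  apply Hs, sin_eq_0_1. exists (2 * Z.of_nat k * n + Z.of_nat j)%Z.
  rewrite plus_IZR, !mult_IZR, <- !INR_IZR_INZ.
  replace th with (IZR n * PI + INR j * PI / INR k / 2) by lra. field. lra.
Qed.

(* Pairing the Dunkl operators with the position removes the denominators, so the identity
   extends to the mirrors by continuity. *)
Lemma dunkl_euler r th :
  r * cos th * D1 (r * cos th, r * sin th) + r * sin th * D2 (r * cos th, r * sin th)
  + rsum (fun j => mult al be j * (g (r * cos th, r * sin th)
       - g (r * cos (INR j * PI / INR k - th), r * sin (INR j * PI / INR k - th)))) (2 * k)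
  = (r * cos th * fst w + r * sin th * snd w) * g (r * cos th, r * sin th).
Proof.
  destruct (Req_dec r 0) as [->|Hr].
  { rewrite !Rmult_0_l. rewrite (rsum_ext _ (fun _ => 0 * 0)).
    - rewrite rsum_scal. ring.
    - intros j _. rewrite !Rmult_0_l. ring. }
  assert (Hk0 : 0 < INR k) by (apply lt_0_INR; lia).
  apply Rminus_diag_uniq. revert th.
  apply (continuous_zero_dense _ (2 * INR k)); [lra| |].
  - intros th.
    assert (Cc : continuity_pt (fun th => r * cos th) th).
    { apply (is_derive_continuity_pt _ _ (- (r * sin th))). auto_derive; auto; ring. }
    assert (Cs : continuity_pt (fun th => r * sin th) th).
    { apply (is_derive_continuity_pt _ _ (r * cos th)). auto_derive; auto; ring. }
    assert (CG : forall G, cont2 G -> continuity_pt (fun th => G (r * cos th, r * sin th)) th).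
    { intros G HG. apply cont2_comp; auto. }
    assert (CC : forall c, continuity_pt (fun _ => c) th) by (intros c; apply continuity_pt_const; intros t t'; auto).
    apply continuity_pt_minus; [apply continuity_pt_plus; [apply continuity_pt_plus|]|].
    + apply continuity_pt_mult; auto.
    + apply continuity_pt_mult; auto.
    + apply (continuity_pt_rsum (fun j th => mult al be j * (g (r * cos th, r * sin th)
       - g (r * cos (INR j * PI / INR k - th), r * sin (INR j * PI / INR k - th))))).
      intros j _. apply continuity_pt_mult; auto. apply continuity_pt_minus; auto.
      apply cont2_comp; auto.
      * apply (is_derive_continuity_pt _ _ (r * sin (INR j * PI / INR k - th))). auto_derive; auto. unfold Rminus, Rdiv. ring.
      * apply (is_derive_continuity_pt _ _ (- (r * cos (INR j * PI / INR k - th)))). auto_derive; auto. unfold Rminus, Rdiv. ring.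
    + apply continuity_pt_mult; auto. apply continuity_pt_plus; apply continuity_pt_mult; auto.
  - intros th Hs. set (x := (r * cos th, r * sin th)).
    assert (HN : forall j, inner (root k j) x <> 0) by (intros j; apply root_polar_neq0; auto).
    destruct (HT x (fun j _ => HN j)) as [E1 E2].
    unfold dunkl_term in E1, E2. rewrite sum_f_R0_rsum in E1, E2 by lia.
    set (S1 := rsum _ _) in E1. set (S2 := rsum _ _) in E2.
    assert (ES : rsum (fun j => mult al be j * (g x
       - g (r * cos (INR j * PI / INR k - th), r * sin (INR j * PI / INR k - th)))) (2 * k)
       = r * cos th * S1 + r * sin th * S2).
    { unfold S1, S2. rewrite <- !rsum_scal, <- rsum_plus. apply rsum_ext. intros j _.
      rewrite <- refl_polar. fold x. specialize (HN j). unfold inner in *. simpl in *. field. auto. }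
    rewrite ES. replace (D1 x) with (fst w * g x - S1) by lra.
    replace (D2 x) with (snd w * g x - S2) by lra. ring.
Qed.

Variables zr wr ph : R.
Hypothesis Hw : w = (wr * cos ph, wr * sin ph).

Definition ray (th t : R) : R := g (t * (zr * cos th), t * (zr * sin th)).

Lemma is_derive_ray th t : 0 < t ->
  is_derive (ray th) t (zr * wr * cos (th - ph) * ray th t
    - / t * rsum (fun j => mult al be j * (ray th t - ray (INR j * PI / INR k - th) t)) (2 * k)).
Proof.
  intros Ht.
  assert (D : derivable_pt_lim (ray th) t
     (D1 (t * (zr * cos th), t * (zr * sin th)) * (zr * cos th)
      + D2 (t * (zr * cos th), t * (zr * sin th)) * (zr * sin th))).
  { unfold ray. apply (derivable_pt_lim_comp_2d (fun u v => g (u, v))).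
    - apply cont2_differentiable; auto.
    - apply is_derive_Reals. auto_derive; auto. ring.
    - apply is_derive_Reals. auto_derive; auto. ring. }
  apply is_derive_Reals in D. evar_last; [exact D|].
  assert (E := dunkl_euler (t * zr) th). rewrite Hw in E. simpl in E.
  rewrite !Rmult_assoc in E. fold (ray th t) in E.
  rewrite (rsum_ext _ (fun j => mult al be j * (ray th t - ray (INR j * PI / INR k - th) t))) in E.
  2:{ intros j _. unfold ray. now rewrite !Rmult_assoc. }
  set (S := rsum _ _) in *. change (k + (k + 0))%nat with (2 * k)%nat in E.
  apply Rmult_eq_reg_l with t; [|lra].
  replace (t * (zr * wr * cos (th - ph) * ray th t - / t * S))
    with (t * (zr * wr * cos (th - ph) * ray th t) - S) by (field; lra).
  rewrite cos_minus. lra.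
Qed.

Lemma continuity_ray th t : continuity_pt (ray th) t.
Proof.
  unfold ray. apply (cont2_comp g (fun t => t * (zr * cos th)) (fun t => t * (zr * sin th))); auto.
  - apply (is_derive_continuity_pt _ _ (zr * cos th)). auto_derive; auto; ring.
  - apply (is_derive_continuity_pt _ _ (zr * sin th)). auto_derive; auto; ring.
Qed.

End Rays.

(** * Sums over an orbit of the dihedral group *)

Lemma rsum_le f g n : (forall i, (i < n)%nat -> f i <= g i) -> rsum f n <= rsum g n.
Proof.
  induction n as [|n IH]; intros H; simpl; [lra|].
  apply Rplus_le_compat; [apply IH; auto | auto].
Qed.

Lemma rsum_const c n : rsum (fun _ => c) n = INR n * c.
Proof.
  induction n as [|n IH]; [simpl; ring|]. rewrite S_INR. simpl rsum. rewrite IH. ring.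
Qed.

Lemma rsum_term_le f n i : (forall j, (j < n)%nat -> 0 <= f j) -> (i < n)%nat -> f i <= rsum f n.
Proof.
  intros H Hi. induction n as [|n IH]; [lia|]. simpl.
  assert (H0 : 0 <= rsum f n).
  { rewrite <- (Rmult_0_r (INR n)), <- rsum_const. apply rsum_le. auto. }
  destruct (Nat.eq_dec i n) as [->|Hne]; [lra|].
  assert (H1 := H n ltac:(lia)). assert (H2 := IH ltac:(auto) ltac:(lia)). lra.
Qed.

Lemma rsum_exchange (F : nat -> nat -> R) m n :
  rsum (fun i => rsum (fun j => F i j) n) m = rsum (fun j => rsum (fun i => F i j) m) n.
Proof.
  induction m as [|m IH]; simpl.
  - rewrite rsum_const. ring.
  - rewrite IH, <- rsum_plus. reflexivity.
Qed.

Lemma rsum_first f n : rsum f (S n) = f O + rsum (fun i => f (S i)) n.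
Proof.
  induction n as [|n IH]; [simpl; ring|].
  change (rsum f (S n) + f (S n) = f O + (rsum (fun i => f (S i)) n + f (S n))). rewrite IH. ring.
Qed.

(** Listing the terms backwards turns the reflection into a translation, and a translation by one
    drops the first term of a period and adds an equal one at its end. *)
Lemma rsum_periodic_reflect (f : Z -> R) n j : (forall m, f (m + Z.of_nat n)%Z = f m) ->
  rsum (fun i => f (j - Z.of_nat i)%Z) n = rsum (fun i => f (Z.of_nat i)) n.
Proof.
  intros Hf.
  assert (Hrev : forall n j, rsum (fun i => f (j - Z.of_nat i)%Z) n
     = rsum (fun i => f (j - Z.of_nat n + 1 + Z.of_nat i)%Z) n).
  { clear Hf n j. intros n. induction n as [|n IH]; intros j; [reflexivity|].
    rewrite (rsum_first (fun i => f (j - Z.of_nat (S n) + 1 + Z.of_nat i)%Z)).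
    change (rsum (fun i => f (j - Z.of_nat i)%Z) (S n))
      with (rsum (fun i => f (j - Z.of_nat i)%Z) n + f (j - Z.of_nat n)%Z).
    rewrite (rsum_ext (fun i => f (j - Z.of_nat (S n) + 1 + Z.of_nat (S i))%Z)
       (fun i => f (j - Z.of_nat n + 1 + Z.of_nat i)%Z)).
    - rewrite <- IH. rewrite Rplus_comm. f_equal. f_equal. lia.
    - intros i _. f_equal. lia. }
  assert (Hstep : forall c, rsum (fun i => f (c + 1 + Z.of_nat i)%Z) n = rsum (fun i => f (c + Z.of_nat i)%Z) n).
  { intros c. assert (E := rsum_first (fun i => f (c + Z.of_nat i)%Z) n).
    change (rsum (fun i => f (c + Z.of_nat i)%Z) (S n))
      with (rsum (fun i => f (c + Z.of_nat i)%Z) n + f (c + Z.of_nat n)%Z) in E.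
    rewrite Hf in E. replace (c + Z.of_nat 0)%Z with c in E by lia.
    rewrite (rsum_ext _ (fun i => f (c + Z.of_nat (S i))%Z)); [lra|].
    intros i _. f_equal. lia. }
  assert (Hshift : forall c, rsum (fun i => f (c + Z.of_nat i)%Z) n = rsum (fun i => f (Z.of_nat i)) n).
  { intros c. induction c using Z.peano_ind.
    - apply rsum_ext. intros i _. f_equal.
    - unfold Z.succ. rewrite Hstep. auto.
    - rewrite <- IHc, <- Hstep. apply rsum_ext. intros i _. f_equal. lia. }
  rewrite Hrev. apply Hshift.
Qed.

Section Orbit.

Variable k : nat.
Variables al be : R.
Hypothesis Hk : (1 <= k)%nat.
Hypothesis Hal : 0 < al.
Hypothesis Hbe : 0 < be.

(* The orbit of a point of angle [ph] consists of the angles [ph + m PI / k] (index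
   [(false, m)]) and [m PI / k - ph] (index [(true, m)]), with [m] modulo [2 k];
   the [j]-th reflection exchanges [(c, m)] and [(negb c, j - m)]. *)
Definition orbit_sum (f : bool -> Z -> R) : R :=
  rsum (fun i => f false (Z.of_nat i) + f true (Z.of_nat i)) (2 * k).

Definition orbit_periodic (f : bool -> Z -> R) : Prop :=
  forall c m, f c (m + Z.of_nat (2 * k))%Z = f c m.

Definition reflect_sum (f : bool -> Z -> R) (c : bool) (m : Z) : R :=
  rsum (fun j => mult al be j * f (negb c) (Z.of_nat j - m)%Z) (2 * k).

Lemma orbit_sum_ext f h : (forall c m, f c m = h c m) -> orbit_sum f = orbit_sum h.
Proof. intros E. apply rsum_ext. intros i _. now rewrite !E. Qed.

Lemma orbit_sum_le f h : (forall c m, f c m <= h c m) -> orbit_sum f <= orbit_sum h.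
Proof. intros E. apply rsum_le. intros i _. apply Rplus_le_compat; apply E. Qed.

Lemma orbit_sum_plus f h :
  orbit_sum (fun c m => f c m + h c m) = orbit_sum f + orbit_sum h.
Proof. unfold orbit_sum. rewrite <- rsum_plus. apply rsum_ext. intros; ring. Qed.

Lemma orbit_sum_scal x f : orbit_sum (fun c m => x * f c m) = x * orbit_sum f.
Proof. unfold orbit_sum. rewrite <- rsum_scal. apply rsum_ext. intros; ring. Qed.

Lemma orbit_sum_reflect f j : orbit_periodic f ->
  orbit_sum (fun c m => f (negb c) (j - m)%Z) = orbit_sum f.
Proof.
  intros Hf. unfold orbit_sum. simpl negb. rewrite !rsum_plus, Rplus_comm.
  rewrite (rsum_periodic_reflect (f false)), (rsum_periodic_reflect (f true)); auto.
Qed.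

Lemma mult_pos j : 0 < mult al be j.
Proof. unfold mult. destruct Nat.even; auto. Qed.

Lemma mult_total : rsum (mult al be) (2 * k) = INR k * (al + be).
Proof.
  rewrite rsum_even_odd.
  rewrite (rsum_ext _ (fun _ => al)), (rsum_ext (fun l => mult al be (2 * l + 1)) (fun _ => be)).
  - rewrite !rsum_const. ring.
  - intros l _. unfold mult. rewrite Nat.add_1_r, Nat.even_succ, <- Nat.negb_even, Nat.even_mul. reflexivity.
  - intros l _. unfold mult. rewrite Nat.even_mul. reflexivity.
Qed.

(** Each reflection permutes the orbit, so pairing [p] with the reflected [q] costs at most half the
    sum of the two squared norms, and the multiplicities add up to [k (al + be)]. The growth
    estimate uses it with equal arguments, uniqueness with a rescaled second one. *)
Lemma orbit_sum_reflect_bound p q : orbit_periodic q ->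
  orbit_sum (fun c m => p c m * reflect_sum q c m)
  <= INR k * (al + be) * (/ 2 * orbit_sum (fun c m => (p c m)²) + / 2 * orbit_sum (fun c m => (q c m)²)).
Proof.
  intros Hq.
  assert (E : orbit_sum (fun c m => p c m * reflect_sum q c m)
    = rsum (fun j => mult al be j * orbit_sum (fun c m => p c m * q (negb c) (Z.of_nat j - m)%Z)) (2 * k)).
  { unfold orbit_sum at 1, reflect_sum.
    rewrite (rsum_ext _ (fun i => rsum (fun j => mult al be j *
       (p false (Z.of_nat i) * q true (Z.of_nat j - Z.of_nat i)%Z
        + p true (Z.of_nat i) * q false (Z.of_nat j - Z.of_nat i)%Z)) (2 * k))).
    - rewrite rsum_exchange. apply rsum_ext. intros j _. rewrite rsum_scal. reflexivity.
    - intros i _. rewrite <- !rsum_scal, <- rsum_plus. apply rsum_ext. intros j _. simpl negb. ring. }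
  rewrite E, <- mult_total. rewrite (Rmult_comm (rsum _ _)), <- rsum_scal.
  apply rsum_le. intros j _. rewrite (Rmult_comm (_ + _)).
  apply Rmult_le_compat_l; [left; apply mult_pos|].
  assert (Hq2 : orbit_periodic (fun c m => (q c m)²)) by (intros c m; now rewrite Hq).
  rewrite <- (orbit_sum_reflect _ (Z.of_nat j) Hq2), <- !orbit_sum_scal, <- orbit_sum_plus.
  apply orbit_sum_le. intros c m.
  generalize (p c m) (q (negb c) (Z.of_nat j - m)%Z). intros x y.
  assert (0 <= (x - y)²) by apply Rle_0_sqr. unfold Rsqr in *. lra.
Qed.

Lemma orbit_sum_term_le f : (forall c m, 0 <= f c m) -> f false 0%Z <= orbit_sum f.
Proof.
  intros Hf. unfold orbit_sum.
  apply Rle_trans with (f false (Z.of_nat 0) + f true (Z.of_nat 0)).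
  - generalize (Hf true 0%Z). simpl. lra.
  - apply (rsum_term_le (fun i => f false (Z.of_nat i) + f true (Z.of_nat i))); [|lia].
    intros j _. generalize (Hf false (Z.of_nat j)) (Hf true (Z.of_nat j)). lra.
Qed.

Lemma is_derive_rsum (f : nat -> R -> R) (l : nat -> R) n x :
  (forall i, (i < n)%nat -> is_derive (f i) x (l i)) ->
  is_derive (fun t => rsum (fun i => f i t) n) x (rsum l n).
Proof.
  induction n as [|n IH]; intros H; simpl.
  - apply @is_derive_const.
  - apply (is_derive_plus (V := R_NormedModule) (fun t => rsum (fun i => f i t) n) (f n)).
    + apply IH; auto.
    + apply H; auto.
Qed.

Lemma is_derive_orbit_sum_sqr (f : bool -> Z -> R -> R) (l : bool -> Z -> R) x :
  (forall c m, is_derive (f c m) x (l c m)) ->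
  is_derive (fun t => orbit_sum (fun c m => (f c m t)²)) x (2 * orbit_sum (fun c m => f c m x * l c m)).
Proof.
  intros H.
  assert (Hs : forall c m, is_derive (fun t => (f c m t)²) x (2 * (f c m x * l c m))).
  { intros c m. unfold Rsqr. evar_last.
    - apply (is_derive_mult (f c m) (f c m)); [apply H | apply H | intros; apply Rmult_comm].
    - unfold plus, Hierarchy.mult; simpl. unfold Hierarchy.mult; simpl. ring. }
  rewrite <- orbit_sum_scal. unfold orbit_sum.
  apply (is_derive_rsum (fun i t => (f false (Z.of_nat i) t)² + (f true (Z.of_nat i) t)²)).
  intros i _. apply (is_derive_plus (V := R_NormedModule) (fun t => (f false (Z.of_nat i) t)²)); apply Hs.
Qed.

(** In the derivative of the squared norm the terms in [1 / t] are at most zero in total by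
    [orbit_sum_reflect_bound], which leaves the rate [2 b]. The equation is given for [t > 0] only,
    and continuity links it to the initial values. *)
Lemma orbit_growth (Y : bool -> Z -> R -> R) (d : bool -> Z -> R) b :
  (forall c m, d c m <= b) ->
  (forall t, orbit_periodic (fun c m => Y c m t)) ->
  (forall c m t, continuity_pt (Y c m) t) ->
  (forall c m t, 0 < t -> is_derive (Y c m) t
     (d c m * Y c m t - / t * (INR k * (al + be) * Y c m t - reflect_sum (fun c m => Y c m t) c m))) ->
  forall t, 0 <= t ->
    orbit_sum (fun c m => (Y c m t)²) <= orbit_sum (fun c m => (Y c m 0)²) * exp (2 * b * t).
Proof.
  intros Hd Hper Hc HY t Ht.
  set (E := fun t => orbit_sum (fun c m => (Y c m t)²)).
  set (p := INR k * (al + be)).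
  assert (HE : forall t, 0 < t -> exists l, is_derive E t l /\ l <= 2 * b * E t).
  { intros r Hr. eexists. split; [apply (is_derive_orbit_sum_sqr Y); intros c m; apply HY; auto|].
    set (y := fun c m => Y c m r).
    assert (H1 := orbit_sum_reflect_bound y y (Hper r)).
    assert (H2 : orbit_sum (fun c m => Y c m r * (d c m * Y c m r - / r * (p * Y c m r - reflect_sum y c m)))
       <= orbit_sum (fun c m => (b + (- (/ r * p))) * (y c m)² + / r * (y c m * reflect_sum y c m))).
    { apply orbit_sum_le. intros c m. fold (y c m). specialize (Hd c m).
      assert (0 <= (y c m)²) by apply Rle_0_sqr. unfold Rsqr in *. nra. }
    rewrite orbit_sum_plus, !orbit_sum_scal in H2.
    fold (E r) in H2. change (orbit_sum (fun c m => (y c m)²)) with (E r) in H1, H2. fold p in H1.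
    assert (Hir : 0 < / r) by (apply Rinv_0_lt_compat; auto).
    fold y p. assert (/ r * orbit_sum (fun c m => y c m * reflect_sum y c m) <= / r * (p * E r)).
    { apply Rmult_le_compat_l; lra. }
    lra. }
  assert (HEc : forall r, continuity_pt E r).
  { intros r. unfold E, orbit_sum.
    apply (continuity_pt_rsum (fun i t => (Y false (Z.of_nat i) t)² + (Y true (Z.of_nat i) t)²)).
    intros i _. apply continuity_pt_plus; apply continuity_pt_mult; auto. }
  assert (HF : - (exp (- (2 * b * 0)) * E 0) <= - (exp (- (2 * b * t)) * E t)).
  { apply (nonneg_derive_le (fun t => - (exp (- (2 * b * t)) * E t))
      (fun t => - (exp (- (2 * b * t)) * (Derive E t - 2 * b * E t)))); auto.
    - intros r Hr. destruct (HE r) as (l & Hl & _); [lra|].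
      evar_last.
      + apply (is_derive_opp (V := R_NormedModule)).
        apply (is_derive_mult (fun t => exp (- (2 * b * t))) E).
        * auto_derive; auto.
        * exact Hl.
        * intros; apply Rmult_comm.
      + rewrite (is_derive_unique _ _ _ Hl).
        unfold opp, plus, Hierarchy.mult; simpl. unfold Hierarchy.mult; simpl. ring.
    - intros r _. apply continuity_pt_opp, continuity_pt_mult; auto.
      apply (is_derive_continuity_pt _ _ (- (2 * b) * exp (- (2 * b * r)))). auto_derive; auto; ring.
    - intros r Hr. destruct (HE r) as (l & Hl & Hle); [lra|].
      rewrite (is_derive_unique _ _ _ Hl). assert (0 < exp (- (2 * b * r))) by apply exp_pos. nra. }
  rewrite Rmult_0_r, Ropp_0, exp_0, Rmult_1_l in HF.
  assert (HX : exp (- (2 * b * t)) * exp (2 * b * t) = 1).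
  { rewrite <- exp_plus, <- exp_0. f_equal. ring. }
  assert (0 < exp (2 * b * t)) by apply exp_pos.
  fold (E t) (E 0). apply Rmult_le_reg_l with (exp (- (2 * b * t))); [apply exp_pos|].
  rewrite (Rmult_comm (E 0)), <- Rmult_assoc, HX. lra.
Qed.

(** * Uniqueness of solutions of order [o(s^(-p))] at infinity *)

Definition tends_to_0 (f : R -> R) : Prop :=
  forall eps, 0 < eps -> exists S, forall s, S < s -> Rabs (f s) <= eps.

Lemma tends_to_0_plus f h : tends_to_0 f -> tends_to_0 h -> tends_to_0 (fun s => f s + h s).
Proof.
  intros Hf Hh eps He. destruct (Hf (eps / 2)) as [S HS]; [lra|]. destruct (Hh (eps / 2)) as [T HT]; [lra|].
  exists (Rmax S T). intros s Hs. generalize (Rmax_l S T) (Rmax_r S T). intros.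
  apply Rle_trans with (1 := Rabs_triang _ _).
  specialize (HS s ltac:(lra)). specialize (HT s ltac:(lra)). lra.
Qed.

Lemma tends_to_0_scal x f : tends_to_0 f -> tends_to_0 (fun s => x * f s).
Proof.
  intros Hf eps He. assert (Hx : 0 < Rabs x + 1) by (generalize (Rabs_pos x); lra).
  destruct (Hf (eps / (Rabs x + 1))) as [S HS]; [apply Rdiv_lt_0_compat; lra|].
  exists S. intros s Hs. rewrite Rabs_mult. specialize (HS s Hs).
  apply Rle_trans with ((Rabs x + 1) * (eps / (Rabs x + 1))).
  - apply Rmult_le_compat; try apply Rabs_pos; lra.
  - right; field; lra.
Qed.

Lemma tends_to_0_sqr f : tends_to_0 f -> tends_to_0 (fun s => (f s)²).
Proof.
  intros Hf eps He. destruct (Hf (sqrt eps)) as [S HS]; [apply sqrt_lt_R0; auto|].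
  exists S. intros s Hs. specialize (HS s Hs). rewrite Rabs_right by (apply Rle_ge, Rle_0_sqr).
  rewrite <- (sqrt_sqrt eps) by lra. rewrite Rsqr_abs. unfold Rsqr.
  apply Rmult_le_compat; auto using Rabs_pos.
Qed.

Lemma tends_to_0_rsum (f : nat -> R -> R) n :
  (forall i, tends_to_0 (f i)) -> tends_to_0 (fun s => rsum (fun i => f i s) n).
Proof.
  intros H. induction n as [|n IH]; simpl.
  - intros eps He. exists 0. intros. rewrite Rabs_R0. lra.
  - apply (tends_to_0_plus (fun s => rsum (fun i => f i s) n)); auto.
Qed.

(* [(s - b)^(2p)] times the energy is nondecreasing, so a solution that is
   [o(s^(-p))] at infinity vanishes. *)
Lemma orbit_system_unique (X : bool -> Z -> R -> R) (d : bool -> Z -> R) b :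
  (forall c m, d c m <= b) ->
  (forall s, orbit_periodic (fun c m => X c m s)) -> orbit_periodic d ->
  (forall c m s, b < s -> is_derive (X c m) s
     (- reflect_sum (fun c m => X c m s / (s - d c m)) c m)) ->
  (forall c m, tends_to_0 (fun s => Rpower (s - b) (INR k * (al + be)) * X c m s)) ->
  forall s, b < s -> X false 0%Z s = 0.
Proof.
  intros Hd Hper Hdper HX Hlim s Hs. set (p := INR k * (al + be)) in *.
  set (N := fun s => orbit_sum (fun c m => (X c m s)²)).
  assert (HN0 : forall s, 0 <= N s).
  { intros r. unfold N, orbit_sum. rewrite <- (Rmult_0_r (INR (2 * k))), <- rsum_const.
    apply rsum_le. intros i _. apply Rplus_le_le_0_compat; apply Rle_0_sqr. }
  assert (HN : forall s, b < s -> exists l, is_derive N s l /\ - (2 * p * / (s - b) * N s) <= l).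
  { intros r Hr. eexists. split; [apply (is_derive_orbit_sum_sqr X); intros c m; apply HX; auto|].
    (* The factor [r - b] makes every entry of [q] at most the corresponding entry of [x] in
       absolute value, since [d c m <= b]. *)
    set (x := fun c m => X c m r). set (q := fun c m => (r - b) * (X c m r / (r - d c m))).
    assert (Hq : orbit_periodic q).
    { intros c m. unfold q. assert (H := Hper r c m). cbv beta in H. rewrite H, (Hdper c m). auto. }
    assert (H1 := orbit_sum_reflect_bound x q Hq). fold p in H1.
    assert (Hqx : orbit_sum (fun c m => (q c m)²) <= N r).
    { apply orbit_sum_le. intros c m. unfold q. specialize (Hd c m).
      replace ((r - b) * (X c m r / (r - d c m))) with ((r - b) / (r - d c m) * X c m r) by (field; lra).
      rewrite Rsqr_mult. rewrite <- (Rmult_1_l ((X c m r)²)) at 2.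
      apply Rmult_le_compat_r; [apply Rle_0_sqr|].
      assert (0 < (r - b) / (r - d c m) <= 1).
      { split; [apply Rdiv_lt_0_compat; lra|]. apply Rmult_le_reg_r with (r - d c m); [lra|].
        unfold Rdiv. rewrite Rmult_assoc, Rinv_l; lra. }
      unfold Rsqr. nra. }
    change (orbit_sum (fun c m => (x c m)²)) with (N r) in H1.
    assert (Hp : 0 <= p) by (unfold p; apply Rmult_le_pos; [apply pos_INR | lra]).
    assert (H2 : orbit_sum (fun c m => x c m * reflect_sum q c m) <= p * N r).
    { apply Rle_trans with (1 := H1). apply Rmult_le_compat_l; lra. }
    rewrite (orbit_sum_ext _ (fun c m => - (/ (r - b)) * (x c m * reflect_sum q c m))).
    - rewrite orbit_sum_scal. assert (0 < / (r - b)) by (apply Rinv_0_lt_compat; lra). nra.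
    - intros c m. unfold x.
      replace (reflect_sum q c m) with ((r - b) * reflect_sum (fun c m => X c m r / (r - d c m)) c m).
      + field. lra.
      + unfold reflect_sum. rewrite <- rsum_scal. apply rsum_ext. intros j _. unfold q. ring. }
  assert (Hmono : forall r r', b < r -> r <= r' -> Rpower (r - b) (2 * p) * N r <= Rpower (r' - b) (2 * p) * N r').
  { intros r r' Hr Hrr'.
    assert (HDer : forall t, b < t -> is_derive (fun t => Rpower (t - b) (2 * p) * N t) t
       (2 * p * Rpower (t - b) (2 * p - 1) * N t + Rpower (t - b) (2 * p) * Derive N t)).
    { intros t Ht. destruct (HN t Ht) as (l & Hl & _). evar_last.
      - apply (is_derive_mult (fun t => Rpower (t - b) (2 * p)) N); [|exact Hl|intros; apply Rmult_comm].
        apply (is_derive_comp (fun t => Rpower t (2 * p)) (fun t => t - b)).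
        + apply is_derive_Rpower; lra.
        + auto_derive; auto.
      - rewrite (is_derive_unique _ _ _ Hl).
        unfold plus, scal, Hierarchy.mult; simpl. unfold Hierarchy.mult; simpl. ring. }
    apply (nonneg_derive_le (fun t => Rpower (t - b) (2 * p) * N t) _ r r' Hrr'
       (fun t Ht => HDer t ltac:(lra))).
    - intros t Ht. exact (is_derive_continuity_pt _ _ _ (HDer t ltac:(lra))).
    - intros t Ht. destruct (HN t) as (l & Hl & Hle); [lra|].
      rewrite (is_derive_unique _ _ _ Hl). rewrite (Rpower_pred (t - b) (2 * p)) by lra.
      assert (HP := Rpower_pos (t - b) (2 * p - 1)).
      assert ((t - b) * l >= - (2 * p * N t)).
      { apply Rle_ge. replace (- (2 * p * N t)) with ((t - b) * (- (2 * p * / (t - b) * N t))) by (field; lra).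
        apply Rmult_le_compat_l; lra. }
      nra. }
  assert (HT : tends_to_0 (fun s => orbit_sum (fun c m => (Rpower (s - b) p * X c m s)²))).
  { unfold orbit_sum.
    apply (tends_to_0_rsum (fun i s => (Rpower (s - b) p * X false (Z.of_nat i) s)²
        + (Rpower (s - b) p * X true (Z.of_nat i) s)²)).
    intros i. apply (tends_to_0_plus (fun s => (Rpower (s - b) p * X false (Z.of_nat i) s)²));
      apply (tends_to_0_sqr (fun s => Rpower (s - b) p * X _ (Z.of_nat i) s)); auto. }
  assert (HPhi : Rpower (s - b) (2 * p) * N s <= 0).
  { apply Rnot_lt_le. intros Hlt.
    destruct (HT (Rpower (s - b) (2 * p) * N s / 2)) as [S HS]; [lra|].
    set (r := Rmax (S + 1) s). assert (r1 := Rmax_l (S + 1) s). assert (r2 := Rmax_r (S + 1) s). fold r in r1, r2.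
    specialize (HS r ltac:(lra)). assert (HM := Hmono s r Hs r2).
    assert (E : orbit_sum (fun c m => (Rpower (r - b) p * X c m r)²) = Rpower (r - b) (2 * p) * N r).
    { unfold N. rewrite <- orbit_sum_scal. apply orbit_sum_ext. intros c m.
      rewrite Rsqr_mult. f_equal. unfold Rsqr. rewrite <- Rpower_plus. f_equal. ring. }
    rewrite E in HS. apply Rabs_le_between in HS. lra. }
  assert (HNs : N s <= 0).
  { apply Rnot_lt_le. intros Hlt. assert (HP := Rpower_pos (s - b) (2 * p)). nra. }
  assert (Hle := orbit_sum_term_le (fun c m => (X c m s)²) (fun c m => Rle_0_sqr _)).
  change (orbit_sum (fun c m => (X c m s)²)) with (N s) in Hle. simpl in Hle.
  apply Rsqr_0_uniq. apply Rle_antisym; [lra | apply Rle_0_sqr].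
Qed.

End Orbit.

(** * Laplace transforms *)

Definition exp_bounded (b C : R) (h : R -> R) : Prop :=
  (forall t, half_line t -> continuous h t) /\
  (forall t, half_line t -> Rabs (h t) <= C * exp (b * t)).

(** The power [t^q] is part of the transform because differentiation in [s] raises [q] by one. *)
Definition laplace (q : R) (h : R -> R) (s : R) : R :=
  integral half_line (fun t => laguerre q s t * h t).

Lemma laguerre_shift q s b t : laguerre q s t * exp (b * t) = laguerre q (s - b) t.
Proof. unfold laguerre. rewrite Rmult_assoc, <- exp_plus. do 2 f_equal. ring. Qed.

Section Laplace.

Variables b C : R.

Lemma laplace_spec q s h : exp_bounded b C h -> -1 < q -> b < s ->
  improper half_line (fun t => laguerre q s t * h t) (laplace q h s).
Proof.
  intros [Hc HB] Hq Hs. apply integral_correct.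
  apply (improper_dominated_ex half_line_open _ (fun t => C * laguerre q (s - b) t)
    (C * (Gamma (q + 1) / Rpower (s - b) (q + 1)))).
  - intros t Ht. apply (continuous_mult (K := R_AbsRing)); auto. apply continuous_laguerre; auto.
  - intros t Ht. rewrite Rabs_mult, (Rabs_right (laguerre _ _ _)) by (left; apply laguerre_pos).
    rewrite <- (laguerre_shift q s b), <- Rmult_assoc, (Rmult_comm C), Rmult_assoc.
    apply Rmult_le_compat_l; [left; apply laguerre_pos | auto].
  - apply (improper_scal half_line_open). apply laguerre_mass; lra.
Qed.

Lemma exp_taylor t m s s' : 0 <= t -> m <= s -> m <= s' ->
  Rabs (exp (- (s' * t)) - exp (- (s * t)) - (s' - s) * (- t * exp (- (s * t))))
  <= t * t * exp (- (m * t)) * (s' - s)².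
Proof.
  intros Ht Hs Hs'.
  apply (taylor1_bound (fun s => exp (- (s * t))) (fun s => - t * exp (- (s * t)))
    (fun s => t * t * exp (- (s * t)))).
  - intros r _. auto_derive; auto. ring.
  - intros r _. auto_derive; auto. ring.
  - intros r Hr. assert (m <= r) by (apply Rle_trans with (2 := proj1 Hr), Rmin_glb; auto).
    rewrite Rabs_right.
    + apply Rmult_le_compat_l; [nra|]. apply exp_monotone. nra.
    + apply Rle_ge, Rmult_le_pos; [nra | left; apply exp_pos].
Qed.

Lemma is_derive_laplace q h s : exp_bounded b C h -> -1 < q -> b < s ->
  is_derive (laplace q h) s (- laplace (q + 1) h s).
Proof.
  (* Half the distance to [b]: for [s'] within [d] of [s] the remainder is dominated by a multiple
     of [t^(q+2) exp (- d t)], whose integral gives [K]. *)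
  intros Hh Hq Hs. set (d := (s - b) / 2). assert (Hd : 0 < d) by (unfold d; lra).
  set (K := C * (Gamma (q + 2 + 1) / Rpower d (q + 2 + 1))).
  apply (is_derive_quadratic _ s _ K d Hd).
  intros s' Hs'. apply Rabs_def2 in Hs'.
  assert (I1 := laplace_spec q s' h Hh Hq ltac:(unfold d in *; lra)).
  assert (I0 := laplace_spec q s h Hh Hq Hs).
  assert (I2 := laplace_spec (q + 1) s h Hh ltac:(lra) Hs).
  assert (I : improper half_line (fun t => laguerre q s' t * h t + ((-1) * (laguerre q s t * h t)
      + (s' - s) * (laguerre (q + 1) s t * h t)))
      (laplace q h s' + ((-1) * laplace q h s + (s' - s) * laplace (q + 1) h s))).
  { apply (improper_plus half_line_open); auto.
    apply (improper_plus half_line_open); apply (improper_scal half_line_open); auto. }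
  replace (laplace q h s' - laplace q h s - (s' - s) * - laplace (q + 1) h s)
    with (laplace q h s' + ((-1) * laplace q h s + (s' - s) * laplace (q + 1) h s)) by ring.
  assert (IK : improper half_line (fun t => (s' - s)² * C * laguerre (q + 2) d t)
      ((s' - s)² * C * (Gamma (q + 2 + 1) / Rpower d (q + 2 + 1)))).
  { apply (improper_scal half_line_open). apply laguerre_mass; lra. }
  replace ((s' - s)² * C * (Gamma (q + 2 + 1) / Rpower d (q + 2 + 1))) with (K * (s' - s)²) in IK
    by (unfold K; ring).
  assert (B : forall t, half_line t -> Rabs (laguerre q s' t * h t + ((-1) * (laguerre q s t * h t)
      + (s' - s) * (laguerre (q + 1) s t * h t))) <= (s' - s)² * C * laguerre (q + 2) d t).
  { intros t Ht. destruct Hh as [_ HB]. specialize (HB t Ht).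
    assert (T := exp_taylor t (b + d) s s' ltac:(unfold half_line in Ht; lra) ltac:(unfold d in *; lra) ltac:(unfold d in *; lra)).
    rewrite laguerre_succ by auto. unfold laguerre at 1 2 3.
    replace (_ + _) with (Rpower t q * (h t * (exp (- (s' * t)) - exp (- (s * t)) - (s' - s) * (- t * exp (- (s * t)))))) by ring.
    rewrite !Rabs_mult, (Rabs_right (Rpower _ _)) by (left; apply Rpower_pos).
    replace ((s' - s)² * C * laguerre (q + 2) d t)
      with (Rpower t q * ((C * exp (b * t)) * (t * t * exp (- ((b + d) * t)) * (s' - s)²))).
    - apply Rmult_le_compat_l; [left; apply Rpower_pos|].
      apply Rmult_le_compat; auto using Rabs_pos.
    - replace (q + 2) with (q + 1 + 1) by ring. rewrite !laguerre_succ by auto. unfold laguerre.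
      replace (exp (- (d * t))) with (exp (b * t) * exp (- ((b + d) * t))); [ring|].
      rewrite <- exp_plus. f_equal. ring. }
  apply Rabs_le. split.
  - assert (IK' := improper_scal half_line_open (-1) _ _ IK).
    replace (- (K * (s' - s)²)) with ((-1) * (K * (s' - s)²)) by ring.
    apply (improper_le half_line_open) with (2 := IK') (3 := I).
    intros t Ht. specialize (B t Ht). apply Rabs_le_between in B. lra.
  - apply (improper_le half_line_open) with (2 := I) (3 := IK).
    intros t Ht. specialize (B t Ht). apply Rabs_le_between in B. lra.
Qed.

(* Near [0] the function is close to [exp (b t)], and elsewhere the error is absorbed by
   [t exp (b t)], whose transform decays one order faster. *)
Lemma laplace_limit p h d : exp_bounded b C h -> -1 < p -> d <= b ->
  continuity_pt h 0 -> h 0 = 1 ->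
  tends_to_0 (fun s => Rpower (s - b) p * ((s - d) * laplace p h s) - Gamma (p + 1)).
Proof.
  intros Hh Hp Hd Hc0 Hh0 eps Heps.
  assert (G1 := Gamma_pos (p + 1) ltac:(lra)). assert (G2 := Gamma_pos (p + 1 + 1) ltac:(lra)).
  (* The [6] allots [eps / 3] to the contribution [2 * eta * Gamma (p + 1)] from near [0]; the rest
     is of order [1 / (s - b)]. *)
  set (eta := eps / (6 * Gamma (p + 1))).
  assert (Heta : 0 < eta) by (apply Rdiv_lt_0_compat; lra).
  assert (HK : exists K, 0 <= K /\ forall t, half_line t -> Rabs (h t - exp (b * t)) <= exp (b * t) * (eta + K * t)).
  { assert (Hc : continuity_pt (fun t => exp (- (b * t)) * h t) 0).
    { apply continuity_pt_mult; auto.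
      apply (is_derive_continuity_pt _ _ (- b * exp (- (b * 0)))). auto_derive; auto; ring. }
    destruct (Hc eta Heta) as (r & Hr & HB). simpl in HB. unfold Rdist in HB.
    rewrite Rmult_0_r, Ropp_0, exp_0, Hh0, Rmult_1_l in HB.
    destruct Hh as [_ Hb'].
    assert (HC0 : 0 <= C).
    { specialize (Hb' 1 ltac:(unfold half_line; lra)). assert (0 < exp (b * 1)) by apply exp_pos.
      generalize (Rabs_pos (h 1)). nra. }
    (* For [t >= r] the trivial bound [(C + 1) exp (b t)] is at most [(C + 1) / r * t] times the
       exponential. *)
    exists ((C + 1) / r).
    assert (HK0 : 0 <= (C + 1) / r) by (apply Rmult_le_pos; [lra | left; apply Rinv_0_lt_compat; auto]).
    split; auto. intros t Ht. unfold half_line in *.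
    assert (HE := exp_pos (b * t)).
    destruct (Rlt_dec t r) as [Hlt|Hge].
    - specialize (HB t). assert (HB' : Rabs (exp (- (b * t)) * h t - 1) < eta).
      { apply HB. split; [split; [constructor|lra]|]. rewrite Rminus_0_r, Rabs_right; lra. }
      replace (h t - exp (b * t)) with (exp (b * t) * (exp (- (b * t)) * h t - 1)).
      + rewrite Rabs_mult, (Rabs_right (exp (b * t))) by lra.
        apply Rmult_le_compat_l; [lra|]. assert (0 <= (C + 1) / r * t) by (apply Rmult_le_pos; lra). lra.
      + rewrite Rmult_minus_distr_l, <- Rmult_assoc, <- exp_plus, Rplus_opp_r, exp_0. ring.
    - assert (1 <= / r * t).
      { apply Rmult_le_reg_l with r; auto. rewrite <- Rmult_assoc, Rinv_r; lra. }
      assert (C + 1 <= (C + 1) / r * t).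
      { unfold Rdiv. rewrite Rmult_assoc. rewrite <- (Rmult_1_r (C + 1)) at 1. apply Rmult_le_compat_l; lra. }
      apply Rle_trans with (exp (b * t) * (C + 1)).
      + apply Rle_trans with (Rabs (h t) + Rabs (exp (b * t))).
        * unfold Rminus. rewrite <- (Rabs_Ropp (exp (b * t))). apply Rabs_triang.
        * specialize (Hb' t Ht). rewrite (Rabs_right (exp (b * t))) by lra. lra.
      + apply Rmult_le_compat_l; lra. }
  destruct HK as (K & HK0 & HK).
  set (G' := Gamma (p + 1 + 1)) in *. set (G := Gamma (p + 1)) in *.
  set (Q := 2 * K * G' + (b - d) * G).
  assert (HQ : 0 <= Q).
  { unfold Q. assert (0 <= K * G') by (apply Rmult_le_pos; lra).
    assert (0 <= (b - d) * G) by (apply Rmult_le_pos; lra). lra. }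
  (* The summand [b - d] ensures [s - d <= 2 * (s - b)], and [2 * Q / eps] brings the terms of order
     [1 / (s - b)] below [eps / 2]. *)
  exists (b + 1 + (b - d) + 2 * Q / eps). intros s Hs.
  assert (HQe : 0 <= 2 * Q / eps) by (apply Rmult_le_pos; [lra | left; apply Rinv_0_lt_compat; auto]).
  assert (Hsb : b < s) by lra. set (sg := s - b). assert (Hsg : 0 < sg) by (unfold sg; lra).
  assert (Il := laplace_spec p s h Hh Hp Hsb).
  assert (Ie := laguerre_mass p sg Hp Hsg). assert (Ie1 := laguerre_mass (p + 1) sg ltac:(lra) Hsg).
  fold G in Ie. fold G' in Ie1.
  set (L := laplace p h s) in *. set (X := G / Rpower sg (p + 1)) in *.
  set (X1 := G' / Rpower sg (p + 1 + 1)) in *.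
  assert (Bd : Rabs (L - X) <= eta * X + K * X1).
  { assert (Iu : improper half_line (fun t => laguerre p s t * h t + (-1) * laguerre p sg t) (L + (-1) * X)).
    { apply (improper_plus half_line_open); auto. apply (improper_scal half_line_open); auto. }
    assert (Iv : improper half_line (fun t => eta * laguerre p sg t + K * laguerre (p + 1) sg t) (eta * X + K * X1)).
    { apply (improper_plus half_line_open); apply (improper_scal half_line_open); auto. }
    assert (B : forall t, half_line t -> Rabs (laguerre p s t * h t + (-1) * laguerre p sg t)
        <= eta * laguerre p sg t + K * laguerre (p + 1) sg t).
    { intros t Ht. rewrite laguerre_succ by auto. unfold sg. rewrite <- (laguerre_shift p s b).
      replace (_ + _) with (laguerre p s t * (h t - exp (b * t))) by ring.
      rewrite Rabs_mult, (Rabs_right (laguerre p s t)) by (left; apply laguerre_pos).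
      replace (eta * (laguerre p s t * exp (b * t)) + K * (t * (laguerre p s t * exp (b * t))))
        with (laguerre p s t * (exp (b * t) * (eta + K * t))) by ring.
      apply Rmult_le_compat_l; [left; apply laguerre_pos | auto]. }
    replace (L - X) with (L + (-1) * X) by ring. apply Rabs_le. split.
    - assert (Iv' := improper_scal half_line_open (-1) _ _ Iv).
      replace (- (eta * X + K * X1)) with ((-1) * (eta * X + K * X1)) by ring.
      apply (improper_le half_line_open) with (2 := Iv') (3 := Iu).
      intros t Ht. specialize (B t Ht). apply Rabs_le_between in B. lra.
    - apply (improper_le half_line_open) with (2 := Iu) (3 := Iv).
      intros t Ht. specialize (B t Ht). apply Rabs_le_between in B. lra. }
  set (P := Rpower sg p). assert (HP : 0 < P) by apply Rpower_pos.
  assert (EX : X = G / (sg * P)).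
  { unfold X, P. rewrite (Rpower_pred sg (p + 1)) by auto. do 3 f_equal. ring. }
  assert (EX1 : X1 = G' / (sg * (sg * P))).
  { unfold X1, P. rewrite (Rpower_pred sg (p + 1 + 1)) by auto. rewrite (Rpower_pred sg (p + 1 + 1 - 1)) by auto.
    do 4 f_equal. ring. }
  assert (Hsd : s - d = sg + (b - d)) by (unfold sg; ring). rewrite Hsd.
  replace (P * ((sg + (b - d)) * L) - G)
    with (P * (sg + (b - d)) * (L - X) + (b - d) * G / sg) by (rewrite EX; field; lra).
  apply Rle_trans with (1 := Rabs_triang _ _).
  assert (H1 : Rabs (P * (sg + (b - d)) * (L - X)) <= 2 * eta * G + 2 * K * G' / sg).
  { rewrite Rabs_mult, (Rabs_right (P * (sg + (b - d)))).
    2: apply Rle_ge, Rmult_le_pos; lra.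
    apply Rle_trans with (P * (2 * sg) * (eta * X + K * X1)).
    - apply Rmult_le_compat; auto using Rabs_pos.
      + apply Rmult_le_pos; lra.
      + apply Rmult_le_compat_l; [lra|]. unfold sg in *. lra.
    - right. rewrite EX, EX1. field. lra. }
  assert (H2 : Rabs ((b - d) * G / sg) = (b - d) * G / sg).
  { apply Rabs_right, Rle_ge, Rmult_le_pos; [apply Rmult_le_pos; lra | left; apply Rinv_0_lt_compat; auto]. }
  rewrite H2. assert (H3 : 2 * eta * G = eps / 3) by (unfold eta; field; lra).
  assert (H4 : 2 * K * G' / sg + (b - d) * G / sg = Q / sg) by (unfold Q; field; lra).
  assert (H5 : Q / sg <= eps / 2).
  { apply Rmult_le_reg_r with sg; auto. unfold Rdiv at 1. rewrite Rmult_assoc, Rinv_l, Rmult_1_r by lra.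
    replace Q with (eps / 2 * (2 * Q / eps)) by (field; lra).
    apply Rmult_le_compat_l; [lra|]. unfold sg. lra. }
  lra.
Qed.

End Laplace.

(** * The Laplace transform of the Dunkl kernel *)

Lemma improper_rsum D (HD : open_interval D) (f : nat -> R -> R) (l : nat -> R) n :
  (forall i, improper D (f i) (l i)) ->
  improper D (fun x => rsum (fun i => f i x) n) (rsum l n).
Proof.
  intros H. induction n as [|n IH]; simpl; [apply improper_0; auto|].
  apply (improper_plus HD (fun x => rsum (fun i => f i x) n)); auto.
Qed.

Definition orbit_angle (k : nat) (ph : R) (c : bool) (m : Z) : R :=
  if c then IZR m * PI / INR k - ph else ph + IZR m * PI / INR k.

Lemma orbit_angle_reflect k ph c m j :
  INR j * PI / INR k - orbit_angle k ph c m = orbit_angle k ph (negb c) (Z.of_nat j - m).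
Proof.
  unfold orbit_angle. destruct c; simpl negb; cbv iota;
    rewrite minus_IZR, <- INR_IZR_INZ; unfold Rdiv; ring.
Qed.

Lemma orbit_angle_period k ph c m : (1 <= k)%nat ->
  orbit_angle k ph c (m + Z.of_nat (2 * k)) = orbit_angle k ph c m + 2 * PI.
Proof.
  intros Hk. assert (Hk0 : 0 < INR k) by (apply lt_0_INR; lia).
  unfold orbit_angle. rewrite plus_IZR, <- INR_IZR_INZ, mult_INR. simpl (INR 2).
  destruct c; field; lra.
Qed.

Lemma cos_add_2PI x : cos (x + 2 * PI) = cos x.
Proof. replace (x + 2 * PI) with (x + 2 * INR 1 * PI) by (simpl; ring). apply cos_period. Qed.

Lemma sin_add_2PI x : sin (x + 2 * PI) = sin x.
Proof. replace (x + 2 * PI) with (x + 2 * INR 1 * PI) by (simpl; ring). apply sin_period. Qed.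

Section Kernel.

Variable k : nat.
Variables al be : R.
Variable w : pt.
Variables g D1 D2 : pt -> R.
Variables zr wr ph : R.
Hypothesis Hk : (1 <= k)%nat.
Hypothesis Hal : 0 < al.
Hypothesis Hbe : 0 < be.
Hypothesis Hg0 : g (0, 0) = 1.
Hypothesis Hg : cont2 g.
Hypothesis HD1 : cont2 D1.
Hypothesis HD2 : cont2 D2.
Hypothesis Hp1 : forall x : pt, derivable_pt_lim (fun t => g (t, snd x)) (fst x) (D1 x).
Hypothesis Hp2 : forall x : pt, derivable_pt_lim (fun t => g (fst x, t)) (snd x) (D2 x).
Hypothesis HT : forall x : pt, (forall j, (j < 2 * k)%nat -> inner (root k j) x <> 0) ->
  D1 x + dunkl_term k al be g (1, 0) x = fst w * g x /\
  D2 x + dunkl_term k al be g (0, 1) x = snd w * g x.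
Hypothesis Hw : w = (wr * cos ph, wr * sin ph).
Hypothesis Hzr : 0 <= zr.
Hypothesis Hwr : 0 <= wr.

Let b := zr * wr.
Let p := INR k * (al + be).
Let ry := ray g zr.

Lemma ray_at_0 th : ry th 0 = 1.
Proof. unfold ry, ray. now rewrite !Rmult_0_l. Qed.

Lemma eigenvalue_le th : b * cos (th - ph) <= b.
Proof.
  assert (0 <= b) by (apply Rmult_le_pos; auto). generalize (COS_bound (th - ph)). nra.
Qed.

Lemma ray_add_2PI th t : ry (th + 2 * PI) t = ry th t.
Proof. unfold ry, ray. now rewrite cos_add_2PI, sin_add_2PI. Qed.

Lemma is_derive_ray_multiplicity th t : 0 < t ->
  is_derive (ry th) t (b * cos (th - ph) * ry th t
    - / t * (p * ry th t - rsum (fun j => mult al be j * ry (INR j * PI / INR k - th) t) (2 * k))).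
Proof.
  intros Ht. evar_last.
  - apply (is_derive_ray k al be w g D1 D2 Hk Hg HD1 HD2 Hp1 Hp2 HT zr wr ph Hw th t Ht).
  - f_equal. f_equal. f_equal. unfold p. rewrite <- mult_total.
    fold ry. replace (rsum (mult al be) (2 * k) * ry th t)
      with (rsum (fun j => ry th t * mult al be j) (2 * k)) by (rewrite rsum_scal; ring).
    set (S1 := rsum (fun j => mult al be j * ry _ t) _).
    replace (rsum (fun j => ry th t * mult al be j) (2 * k) - S1)
      with (rsum (fun j => ry th t * mult al be j) (2 * k) + (-1) * S1) by ring.
    unfold S1. rewrite <- rsum_scal, <- rsum_plus. apply rsum_ext. intros j _. ring.
Qed.

(** Every value on the orbit is [1] at [t = 0], so the squared norm over the [4 k] indices starts at
    [4 k], which also bounds its own square root. The exponent [b] is what lets the transform exist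
    for all [s > |z| |w|]. *)
Lemma ray_exp_bounded th : exp_bounded b (4 * INR k) (ry th).
Proof.
  assert (Hk1 : 1 <= INR k) by (apply (le_INR 1); auto).
  split.
  { intros t _. apply continuity_pt_filterlim. apply (continuity_ray g Hg zr th t). }
  intros t Ht. unfold half_line in Ht.
  set (Y := fun c m => ry (orbit_angle k th c m)).
  assert (HG := orbit_growth k al be Hal Hbe Y
     (fun c m => b * cos (orbit_angle k th c m - ph)) b).
  assert (HE : orbit_sum k (fun c m => (Y c m t)²) <= orbit_sum k (fun c m => (Y c m 0)²) * exp (2 * b * t)).
  { apply HG; [| | | |lra].
    - intros c m. apply eigenvalue_le.
    - intros r c m. unfold Y. rewrite orbit_angle_period by auto. apply ray_add_2PI.
    - intros c m r. apply (continuity_ray g Hg zr).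
    - intros c m r Hr. unfold Y. evar_last; [apply is_derive_ray_multiplicity; auto|].
      fold p. f_equal. f_equal. f_equal. unfold reflect_sum. apply rsum_ext. intros j _.
      now rewrite orbit_angle_reflect. }
  assert (E0 : orbit_sum k (fun c m => (Y c m 0)²) = 4 * INR k).
  { unfold orbit_sum. rewrite (rsum_ext _ (fun _ => 2)).
    - rewrite rsum_const, mult_INR. simpl. ring.
    - intros i _. unfold Y. rewrite !ray_at_0. unfold Rsqr. ring. }
  assert (H1 := orbit_sum_term_le k Hk (fun c m => (Y c m t)²) (fun c m => Rle_0_sqr _)).
  cbv beta in H1. unfold Y at 1 in H1.
  replace (orbit_angle k th false 0) with th in H1 by (unfold orbit_angle, Rdiv; ring).
  rewrite E0 in HE.
  apply Rsqr_incr_0; [|apply Rabs_pos|].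
  2: apply Rmult_le_pos; [lra | left; apply exp_pos].
  rewrite <- Rsqr_abs. apply Rle_trans with (1 := Rle_trans _ _ _ H1 HE).
  rewrite Rsqr_mult. replace ((exp (b * t))²) with (exp (2 * b * t)).
  - apply Rmult_le_compat_r; [left; apply exp_pos|]. unfold Rsqr. nra.
  - unfold Rsqr. rewrite <- exp_plus. f_equal. ring.
Qed.

Lemma p_pos : 0 < p.
Proof. apply Rmult_lt_0_compat; [apply lt_0_INR; lia | lra]. Qed.

(** The derivative of [t^(p+1) exp (- s t) y] integrates to zero, and its terms in [p] cancel
    because [p] is the total multiplicity. *)
Lemma laplace_ray_identity th s : b < s ->
  (s - b * cos (th - ph)) * laplace (p + 1) (ry th) s
  = laplace p (ry th) s + rsum (fun j => mult al be j * laplace p (ry (INR j * PI / INR k - th)) s) (2 * k).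
Proof.
  intros Hs. assert (Hp := p_pos).
  assert (I0 := laplace_spec b _ p s (ry th) (ray_exp_bounded th) ltac:(lra) Hs).
  assert (I1 := laplace_spec b _ (p + 1) s (ry th) (ray_exp_bounded th) ltac:(lra) Hs).
  assert (IS : improper half_line (fun t => rsum (fun j => mult al be j *
       (laguerre p s t * ry (INR j * PI / INR k - th) t)) (2 * k))
       (rsum (fun j => mult al be j * laplace p (ry (INR j * PI / INR k - th)) s) (2 * k))).
  { apply (improper_rsum _ half_line_open (fun j t => mult al be j * (laguerre p s t * ry (INR j * PI / INR k - th) t))).
    intros j. apply (improper_scal half_line_open).
    apply (laplace_spec b (4 * INR k)); auto; [apply ray_exp_bounded | lra]. }
  assert (I : improper half_line (fun t => (laguerre p s t * ry th t + rsum (fun j => mult al be j *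
       (laguerre p s t * ry (INR j * PI / INR k - th) t)) (2 * k))
       + (- (s - b * cos (th - ph))) * (laguerre (p + 1) s t * ry th t))
     ((laplace p (ry th) s + rsum (fun j => mult al be j * laplace p (ry (INR j * PI / INR k - th)) s) (2 * k))
       + (- (s - b * cos (th - ph))) * laplace (p + 1) (ry th) s)).
  { apply (improper_plus half_line_open); [|apply (improper_scal half_line_open); auto].
    apply (improper_plus half_line_open); auto. }
  assert (Z : improper half_line (fun t => (laguerre p s t * ry th t + rsum (fun j => mult al be j *
       (laguerre p s t * ry (INR j * PI / INR k - th) t)) (2 * k))
       + (- (s - b * cos (th - ph))) * (laguerre (p + 1) s t * ry th t)) 0).
  { apply (improper_derive half_line_open (fun t => laguerre (p + 1) s t * ry th t)).
    - intros t Ht. evar_last.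
      + apply (is_derive_mult (laguerre (p + 1) s) (ry th)).
        * apply is_derive_laguerre; auto.
        * apply is_derive_ray_multiplicity; auto.
        * intros; apply Rmult_comm.
      + unfold plus, Hierarchy.mult; cbn -[Nat.mul INR]. unfold Hierarchy.mult; cbn -[Nat.mul INR].
        rewrite laguerre_succ by auto.
        rewrite (rsum_ext (fun j => mult al be j * (laguerre p s t * _))
          (fun j => laguerre p s t * (mult al be j * ry (INR j * PI / INR k - th) t))) by (intros; ring).
        rewrite rsum_scal. set (S1 := rsum _ _). field. unfold half_line in Ht; lra.
    - apply I.
    - assert (V := laguerre_vanishes (p + 1) (s - b) (fun t => exp (- (b * t)) * ry th t) (4 * INR k)
        ltac:(lra) ltac:(lra)).
      assert (HB : forall t, half_line t -> Rabs (exp (- (b * t)) * ry th t) <= 4 * INR k).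
      { intros t Ht. destruct (ray_exp_bounded th) as [_ B]. specialize (B t Ht).
        rewrite Rabs_mult, (Rabs_right (exp _)) by (left; apply exp_pos).
        apply Rmult_le_compat_l with (r := exp (- (b * t))) in B; [|left; apply exp_pos].
        replace (exp (- (b * t)) * (4 * INR k * exp (b * t))) with (4 * INR k) in B; auto.
        replace (exp (- (b * t)) * (4 * INR k * exp (b * t)))
          with (4 * INR k * (exp (- (b * t)) * exp (b * t))) by ring.
        rewrite <- exp_plus, Rplus_opp_l, exp_0. ring. }
      specialize (V HB).
      assert (E : forall t, laguerre (p + 1) (s - b) t * (exp (- (b * t)) * ry th t) = laguerre (p + 1) s t * ry th t).
      { intros t. rewrite <- (laguerre_shift (p + 1) s b).
        replace (laguerre (p + 1) s t * exp (b * t) * (exp (- (b * t)) * ry th t))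
          with (laguerre (p + 1) s t * (exp (b * t) * exp (- (b * t))) * ry th t) by ring.
        rewrite <- exp_plus, Rplus_opp_r, exp_0. ring. }
      intros eps He. destruct (V eps He) as (x0 & y0 & Hx & Hy & HV).
      exists x0, y0. split; [auto|split; [auto|]]. intros x y Dx Dy h1 h2.
      rewrite <- !E. exact (HV x y Dx Dy h1 h2). }
  assert (E := improper_unique half_line_open _ _ _ I Z). lra.
Qed.

Definition kernel_transform (th s : R) : R :=
  (s - b * cos (th - ph)) * laplace p (ry th) s.

(** The derivative of the factor [s - d] contributes one copy of the transform of exponent [p];
    [laplace_ray_identity] cancels it and leaves the reflected terms. *)
Lemma is_derive_kernel_transform th s : b < s ->
  is_derive (kernel_transform th) s
    (- rsum (fun j => mult al be j * (kernel_transform (INR j * PI / INR k - th) s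
         / (s - b * cos (INR j * PI / INR k - th - ph)))) (2 * k)).
Proof.
  intros Hs. assert (Hp := p_pos). evar_last.
  - apply (is_derive_mult (fun s => s - b * cos (th - ph)) (laplace p (ry th))).
    + auto_derive; auto.
    + apply (is_derive_laplace b (4 * INR k)); auto; [apply ray_exp_bounded | lra].
    + intros; apply Rmult_comm.
  - assert (E := laplace_ray_identity th s Hs).
    rewrite (rsum_ext _ (fun j => mult al be j * laplace p (ry (INR j * PI / INR k - th)) s)).
    + set (S1 := rsum _ _) in *. unfold plus, Hierarchy.mult; cbn -[Nat.mul INR].
      unfold Hierarchy.mult; cbn -[Nat.mul INR]. lra.
    + intros j _. unfold kernel_transform. field.
      assert (H := eigenvalue_le (INR j * PI / INR k - th)). lra.
Qed.

Lemma kernel_transform_rhs th s : b < s ->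
  kernel_transform th s = Gamma (p + 1) * rhs k al be b ph th s.
Proof.
  intros Hs. assert (Hb : 0 <= b) by (apply Rmult_le_pos; auto). assert (Hp := p_pos).
  (* The system is linear, so the difference solves it on the whole orbit, and the equal leading
     terms at infinity cancel. *)
  set (X := fun c m s => kernel_transform (orbit_angle k th c m) s
     - Gamma (p + 1) * rhs k al be b ph (orbit_angle k th c m) s).
  assert (H0 : X false 0%Z s = 0).
  { apply (orbit_system_unique k al be Hk Hal Hbe X (fun c m => b * cos (orbit_angle k th c m - ph)) b); auto.
    - intros c m. apply eigenvalue_le.
    - intros r c m. unfold X, kernel_transform, rhs. rewrite orbit_angle_period by auto.
      set (x := orbit_angle k th c m).
      replace (x + 2 * PI - ph) with (x - ph + 2 * PI) by ring. rewrite cos_add_2PI.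
      replace (INR k * (x + 2 * PI)) with (INR k * x + 2 * INR k * PI) by ring.
      rewrite cos_period, sin_period. f_equal. f_equal.
      unfold laplace. f_equal. apply functional_extensionality. intros t. now rewrite ray_add_2PI.
    - intros c m. rewrite orbit_angle_period by auto.
      replace (orbit_angle k th c m + 2 * PI - ph) with (orbit_angle k th c m - ph + 2 * PI) by ring.
      now rewrite cos_add_2PI.
    - intros c m r Hr. unfold X. evar_last.
      + apply (is_derive_minus (V := R_NormedModule)).
        * apply is_derive_kernel_transform; auto.
        * apply is_derive_scal. apply is_derive_rhs; auto.
      + unfold minus, plus, opp; cbn -[Nat.mul INR]. unfold reflect_sum.
        rewrite Ropp_mult_distr_r_reverse, Ropp_involutive, <- rsum_scal.
        match goal with |- - ?A + ?B = - ?C => enough (EE : A + (-1) * B = C) by lra end.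
        rewrite <- rsum_scal, <- rsum_plus. apply rsum_ext. intros j _.
        rewrite !orbit_angle_reflect. unfold Rdiv. ring.
    - intros c m. set (x := orbit_angle k th c m).
      assert (T1 := laplace_limit b (4 * INR k) p (ry x) (b * cos (x - ph)) (ray_exp_bounded x) ltac:(lra)
        (eigenvalue_le x) (continuity_ray g Hg zr x 0) (ray_at_0 x)).
      assert (T2 : tends_to_0 (fun s => Rpower (s - b) p * rhs k al be b ph x s - 1)).
      { intros eps He. destruct (rhs_limit k al be b ph Hk Hal Hbe Hb x eps He) as (S & _ & HS).
        exists S. exact HS. }
      apply (tends_to_0_scal (- Gamma (p + 1))) in T2.
      assert (T := tends_to_0_plus _ _ T1 T2). intros eps He. destruct (T eps He) as [S HS].
      exists S. intros r Hr. specialize (HS r Hr). cbv beta in HS. unfold X, kernel_transform. fold x p.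
      replace (Rpower (r - b) p * ((r - b * cos (x - ph)) * laplace p (ry x) r - Gamma (p + 1) * rhs k al be b ph x r))
        with (Rpower (r - b) p * ((r - b * cos (x - ph)) * laplace p (ry x) r) - Gamma (p + 1) +
          - Gamma (p + 1) * (Rpower (r - b) p * rhs k al be b ph x r - 1)) by ring.
      exact HS. }
  unfold X in H0. replace (orbit_angle k th false 0) with th in H0 by (unfold orbit_angle, Rdiv; ring).
  lra.
Qed.

End Kernel.

Theorem mainTheorem12 (k : nat) (a b : R) (z w : pt) (phi1 phi2 s : R)
  (g : pt -> R) :
  (1 <= k)%nat -> 0 < a -> 0 < b ->
  z = (norm2 z * cos phi1, norm2 z * sin phi1) ->
  w = (norm2 w * cos phi2, norm2 w * sin phi2) ->
  is_dunkl_kernel k a b w g ->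
  s > norm2 z * norm2 w ->
  exists (F : R -> R) (L : R),
    (forall v, -1 < v < 1 ->
       improper_int_open
         (fun u =>
            ((1 + u) * (1 + v) - 2 / (a + b) * (a * u * (1 + v) + b * v * (1 + u)))
            / (B_fun s z w *
               Rpower (A_fun k s (norm2 z * norm2 w)
                         (q_uv u v (INR k * phi1) (INR k * phi2))) (a + b))
            * nu_density a u)
         (-1) 1 (F v)) /\
    improper_int_open (fun v => F v * nu_density b v) (-1) 1 L /\
    improper_int_0_inf
      (fun t => exp (- (s * t)) *
                (Rpower t (INR k * (a + b)) * g (t * fst z, t * snd z)))
      (Gamma (INR k * (a + b) + 1) * L).
Proof.
  intros Hk Ha Hb Hz Hw (Hg0 & Hg & D1 & D2 & HD1 & HD2 & Hp1 & Hp2 & HT) Hs.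
  set (zr := norm2 z) in *. set (wr := norm2 w) in *.
  assert (Hzr : 0 <= zr) by apply sqrt_pos. assert (Hwr : 0 <= wr) by apply sqrt_pos.
  set (r := zr * wr) in *. assert (Hr : 0 <= r) by (apply Rmult_le_pos; auto).
  assert (HB : B_fun s z w = s - r * cos (phi1 - phi2)).
  { unfold B_fun, inner. rewrite Hz, Hw. simpl. rewrite cos_minus. unfold r. ring. }
  assert (HB0 : 0 < s - r * cos (phi1 - phi2)).
  { generalize (COS_bound (phi1 - phi2)). nra. }
  assert (HK := kernel_transform_rhs k a b w g D1 D2 zr wr phi2 Hk Ha Hb Hg0 Hg HD1 HD2 Hp1 Hp2 HT
    Hw Hzr Hwr phi1 s Hs).
  unfold kernel_transform in HK. fold r in HK. rewrite HB. set (B := s - r * cos (phi1 - phi2)) in *.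
  set (x := 2 * (r / 2) ^ k * (cos (INR k * phi1) * cos (INR k * phi2))).
  set (y := 2 * (r / 2) ^ k * (sin (INR k * phi1) * sin (INR k * phi2))).
  assert (Hxy : Rabs x + Rabs y < cheb r k s) by (apply rhs_args; auto).
  set (f := fun v u => numer a b v u * ker (a + b) (cheb r k s) x y v u).
  assert (Lf : lip2 f) by (unfold f; lip2_tac).
  (* [/ B] involves neither [u] nor [v], so both iterated integrals are scaled integrals of [f]. *)
  exists (fun v => / B * nu_int a (f v)), (/ B * rhs k a b r phi2 phi1 s).
  split; [|split].
  - intros v Hv. apply improper_unit_interval.
    apply (improper_ext unit_interval_open) with
      (2 := improper_scal unit_interval_open (/ B) _ _ (nu_int_spec a Ha (f v) (lip2_section f v Lf Hv))).
    intros u Hu. unfold f, x, y. rewrite ker_A_fun by auto. unfold numer. field.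
    assert (HP := Rpower_pos (A_fun k s r (q_uv u v (INR k * phi1) (INR k * phi2))) (a + b)). lra.
  - apply improper_unit_interval.
    apply (improper_ext unit_interval_open) with
      (2 := improper_scal unit_interval_open (/ B) _ _
         (nu_int_spec b Hb (fun v => nu_int a (f v)) (lip2_inner a f Ha Lf))).
    intros v _. ring.
  - apply improper_half_line.
    assert (Hp : 0 < INR k * (a + b)) by (apply Rmult_lt_0_compat; [apply lt_0_INR; lia | lra]).
    replace (Gamma (INR k * (a + b) + 1) * (/ B * rhs k a b r phi2 phi1 s))
      with (laplace (INR k * (a + b)) (ray g zr phi1) s).
    + apply (improper_ext half_line_open) with (2 := laplace_spec r (4 * INR k) (INR k * (a + b)) s _
        (ray_exp_bounded k a b w g D1 D2 zr wr phi2 Hk Ha Hb Hg0 Hg HD1 HD2 Hp1 Hp2 HT Hw Hzr Hwr phi1)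
        ltac:(lra) Hs).
      intros t _. unfold laguerre, ray. rewrite Hz. simpl. ring.
    + apply Rmult_eq_reg_l with B; [|lra]. rewrite HK. field. lra.
Qed.
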